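(* Let $(M,g)$ be a non-flat Kasner spacetime of dimension 4 with $p_1\le p_2\le p_3<1$, let $\tau=-\ln t$, and let $\omega=\omega_\tau d\tau+\omega_jdx^j$ be a smooth one-form on $M$ solving $\Box_g\omega=0$. Let $u_{\mu,\pm}\in C^\infty(\mathbb{T}^3)$ ($\mu=0,1,2,3$) be the components of its asymptotic data. Then there are functions $\alpha_1,\alpha_2,\alpha_3\in C^\infty(\mathbb{T}^3)$, depending linearly on the $u_{\mu,\pm}$ and their derivatives, such that with $$u_1=u_{1,-}+\tfrac{1}{2p_1}\partial_1u_{0,+}+\alpha_1,\qquad u_i=u_{i,+}-\tfrac{1}{2p_i}\partial_iu_{0,+}+\alpha_i\quad(i=2,3),$$ the following holds for every positive integer $n$ (for some non-negative integer $N$ that may depend on $n$): $$\begin{pmatrix}\omega_\tau\\\partial_\tau\omega_\tau\end{pmatrix}=u_{0,+}\begin{pmatrix}1\\0\end{pmatrix}+\sum_{k=1}^{q_{0n}}P_{0k}(\tau)e^{-a_{0k}\tau}+O(\langle\tau\rangle^Ne^{-n(1-p_3)\tau}),$$ $$\begin{pmatrix}\omega_1\\\partial_\tau\omega_1\end{pmatrix}=u_1e^{-2p_1\tau}\begin{pmatrix}1\\-2p_1\end{pmatrix}+\sum_{k=1}^{q_{1n}}P_{1k}(\tau)e^{-a_{1k}\tau}+O(\langle\tau\rangle^Ne^{[1-p_1-n(1-p_3)]\tau}),$$ $$\begin{pmatrix}\omega_i\\\partial_\tau\omega_i\end{pmatrix}=\begin{pmatrix}u_i+\partial_iu_{0,+}\tau\\\partial_iu_{0,+}\end{pmatrix}+\sum_{k=1}^{q_{in}}P_{ik}(\tau)e^{-a_{ik}\tau}+O(\langle\tau\rangle^Ne^{[1-p_i-n(1-p_3)]\tau}),\quad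 i=2,3,$$ where the $q_{\mu n}$ are non-negative integers, non-decreasing in $n$, with $q_{\mu1}=0$; the $a_{\mu k}$ are real numbers that only depend on the $p_i$ and are increasing in $k$, and $a_{\mu k}>0$ for $\mu\ne1$. Furthermore, the $P_{\mu k}$ are polynomials in $\tau$ with coefficients in $C^\infty(\mathbb{T}^3,\mathbb{R}^2)$, whose components are functions in $C^\infty(\mathbb{T}^3)$ which only depend linearly on $u_1,u_2,u_3$, on $u_{0,\pm},u_{1,+},u_{2,-},u_{3,-}$, and on their derivatives. Additionally, $a_{11}=\min\{2p_1+2(1-p_3),0\}$ and $a_{01}=a_{i1}=2(1-p_3)$ for $i=2,3$.
   Context: **Kasner spacetime.** $M=(0,\infty)\times\mathbb{T}^3$, $g=-dt\otimes dt+\sum_{i=1}^3t^{2p_i}dx^i\otimes dx^i$ with $\sum p_i=\sum p_i^2=1$; non-flat means $p_3<1$ (ordering $p_1\le p_2\le p_3$, so $p_1<0<p_2$). $\Box_g\omega=\mathrm{tr}_g(\nabla^2\omega)$. The singularity $t=0$ corresponds to $\tau=\infty$. **$O$ notation.** For $f$ a function of $\tau$, $u=O(f(\tau))$ means that for every $s\in\mathbb{R}$ there is a constant $C_s$ (possibly depending on $\omega$) with $\|u(\tau)\|_{(s)}\le C_s|f(\tau)|$ for $\tau\ge0$, where $\|u\|_{(s)}=\left(\sum_{n\in\mathbb{Z}^3}(1+|n|^2)^s|\hat u(n)|^2\right)^{1/2}$ is the Sobolev norm on $\mathbb{T}^3$. $\langle\tau\rangle=(1+\tau^2)^{1/2}$.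 **Asymptotic data.** Put $\widehat\omega_j=e^{-(1-p_j)\tau}\omega_j$, $j=1,2,3$, and $\widehat\omega=(\omega_\tau,\widehat\omega_1,\widehat\omega_2,\widehat\omega_3)$ (index $\mu=0,\dots,3$). Then $\Box_g\omega=0$ is equivalent to $$\partial_\tau^2\omega_\tau-\sum_ie^{-2(1-p_i)\tau}\partial_i^2\omega_\tau+2\partial_\tau\omega_\tau-\sum_i2p_ie^{-(1-p_i)\tau}\partial_i\widehat\omega_i=0,$$ $$\partial_\tau^2\widehat\omega_j-\sum_ie^{-2(1-p_i)\tau}\partial_i^2\widehat\omega_j+2\partial_\tau\widehat\omega_j-2p_je^{-(1-p_j)\tau}\partial_j\omega_\tau+(1-p_j^2)\widehat\omega_j=0.$$ Let $A_\infty=\begin{pmatrix}0&I_4\\-\mathrm{diag}(0,1-p_1^2,1-p_2^2,1-p_3^2)&-2I_4\end{pmatrix}$; its eigenvalues are $0,-2,-1\pm p_i$, with eigenvectors (in $\mathbb{R}^8$, $e_0,\dots,e_7$ the standard basis) $v_{0,+}=e_0$, $v_{0,-}=e_0-2e_4$, $v_{i,\pm}=e_i+(-1\pm p_i)e_{i+4}$. Let $D(u,v)=(0,0,0,0,D_0u,D_1u,D_2u,D_3u)$ for $u,v$ with values in $\mathbb{R}^4$, where $D_0u=\sum_i(e^{-2(1-p_i)\tau}\partial_i^2u_0+2p_ie^{-(1-p_i)\tau}\partial_iu_i)$ and $D_ju=\sum_ie^{-2(1-p_i)\tau}\partial_i^2u_j+2p_je^{-(1-p_j)\tau}\partial_ju_0$.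 Let $\mathcal{N}$ be the smallest integer with $2<\mathcal{N}(1-p_3)$, and for $1\le n\le\mathcal{N}$ let $E^n$ be the sum of the eigenspaces of $A_\infty$ with eigenvalues in $(-n(1-p_3),-(n-1)(1-p_3)]$, with associated projections $\pi_n:\mathbb{R}^8\to E^n$. There are unique $V_{\infty,n}\in C^\infty(\mathbb{T}^3,E^1\oplus\cdots\oplus E^n)$, $1\le n\le\mathcal{N}$, such that, with $F_{\infty,0}=0$ and $F_{\infty,n}(\tau)=e^{A_\infty\tau}V_{\infty,n}+\int_0^\tau e^{A_\infty(\tau-r)}DF_{\infty,n-1}(r)dr$, for every $s$ there are $C,N$ with $\|(\widehat\omega,\partial_\tau\widehat\omega)-F_{\infty,n}\|_{(s)}\le C\langle\tau\rangle^Ne^{-n(1-p_3)\tau}$ for $\tau\ge0$. The asymptotic data is $\mathcal{V}_\infty=V_{\infty,1}+\pi_2(V_{\infty,2})+\cdots+\pi_{\mathcal{N}}(V_{\infty,\mathcal{N}})$, and $u_{\mu,\pm}\in C^\infty(\mathbb{T}^3)$ are defined by $\mathcal{V}_\infty=\sum_{\mu=0}^3(u_{\mu,+}v_{\mu,+}+u_{\mu,-}v_{\mu,-})$. *)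

(* Defs.v *)
From HB Require Import structures.
From mathcomp Require Import all_boot all_order all_algebra.
From mathcomp Require Import all_classical all_reals all_analysis.

Set Implicit Arguments.
Unset Strict Implicit.
Unset Printing Implicit Defensive.

Import Order.TTheory GRing.Theory Num.Theory.
Import numFieldNormedType.Exports.

Local Open Scope classical_set_scope.
Local Open Scope ring_scope.

(* Points of R^n are row vectors.  A function on the torus T^3 = (R/2piZ)^3 is a
   function on R^3 that is 2pi-periodic in each variable; likewise a tensor on
   (0,oo) x T^3 is given by its components in the global coordinate frame, which
   are functions of (t, x) in R^(1+3), 2pi-periodic in x. *)

Section Calculus.
Context {R : realType}.

Definition partial n (i : 'I_n) (f : 'rV[R]_n -> R) : 'rV[R]_n -> R :=
  fun x => 'D_(delta_mx 0 i) f x.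

Definition partials n (l : seq 'I_n) (f : 'rV[R]_n -> R) : 'rV[R]_n -> R :=
  foldr (@partial n) f l.

(* On an open set U this is C^oo: iterated partial derivatives that are all
   differentiable are in particular all continuous. *)
Definition smooth_on n (U : set 'rV[R]_n) (f : 'rV[R]_n -> R) : Prop :=
  forall (l : seq 'I_n) x, U x -> differentiable (partials l f) x.

Definition smooth_torus (f : 'rV[R]_3 -> R) : Prop :=
  smooth_on setT f /\
  forall i x, f (x + (2 * pi) *: delta_mx 0 i) = f x.

Definition vec2 (a b : R) : 'cV[R]_2 := \col_k [:: a; b]`_k.

Definition expmx n (A : 'M[R]_n.+1) : 'M[R]_n.+1 :=
  limn (series (fun k => (k`!%:R)^-1 *: A ^+ k)).

End Calculus.

Section Sobolev.
Context {R : realType}.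

Definition torus_int (f : 'rV[R]_3 -> R) : R :=
  \int[lebesgue_measure]_(a in `[0, 2 * pi])
  \int[lebesgue_measure]_(b in `[0, 2 * pi])
  \int[lebesgue_measure]_(c in `[0, 2 * pi])
    f (\row_k [:: a; b; c]`_k).

Definition freq_dot (n : 'rV[int]_3) (x : 'rV[R]_3) : R :=
  \sum_i (n 0 i)%:~R * x 0 i.

Definition freq_sqr (n : 'rV[int]_3) : R := \sum_i (n 0 i)%:~R ^+ 2.

(* |u^(n)|^2 for a real-valued u, where
   u^(n) = (2pi)^-3 \int_{T^3} u(x) e^{-i n.x} dx. *)
Definition fourier_sqr (u : 'rV[R]_3 -> R) (n : 'rV[int]_3) : R :=
  ((2 * pi) ^- 3 * torus_int (fun x => u x * cos (freq_dot n x))) ^+ 2 +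
  ((2 * pi) ^- 3 * torus_int (fun x => u x * sin (freq_dot n x))) ^+ 2.

Definition sobolev_norm m (s : R) (u : 'rV[R]_3 -> 'cV[R]_m) : \bar R :=
  sqrte (\esum_(n in [set: 'rV[int]_3])
    ((1 + freq_sqr n) `^ s *
       \sum_k fourier_sqr (fun x => u x k 0) n)%:E).

Definition is_bigO m (u : R -> 'rV[R]_3 -> 'cV[R]_m) (f : R -> R) : Prop :=
  forall s : R, exists C : R, forall tau : R, 0 <= tau ->
    (sobolev_norm s (u tau) <= (C * `|f tau|)%:E)%E.

Definition japanese (tau : R) : R := Num.sqrt (1 + tau ^+ 2).

End Sobolev.

Section Geometry.
Context {R : realType} {n : nat}.
Variable g : 'rV[R]_n -> 'M[R]_n.

Definition christoffel (k i j : 'I_n) (X : 'rV[R]_n) : R :=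
  2^-1 * \sum_l invmx (g X) k l *
    (partial i (fun Y => g Y j l) X + partial j (fun Y => g Y i l) X
     - partial l (fun Y => g Y i j) X).

(* (nabla_a omega)_b *)
Definition nabla1 (omega : 'I_n -> 'rV[R]_n -> R) (a b : 'I_n) (X : 'rV[R]_n) : R :=
  partial a (omega b) X - \sum_c christoffel c a b X * omega c X.

(* (nabla^2 omega)(e_a, e_b; e_c) = (nabla_a (nabla omega))(e_b; e_c) *)
Definition nabla2 (omega : 'I_n -> 'rV[R]_n -> R) (a b c : 'I_n) (X : 'rV[R]_n) : R :=
  partial a (nabla1 omega b c) X
  - \sum_d christoffel d a b X * nabla1 omega d c X
  - \sum_d christoffel d a c X * nabla1 omega b d X.

Definition box (omega : 'I_n -> 'rV[R]_n -> R) (c : 'I_n) (X : 'rV[R]_n) : R :=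
  \sum_a \sum_b invmx (g X) a b * nabla2 omega a b c X.

End Geometry.

Section Kasner.
Context {R : realType}.
Variable p : 'I_3 -> R.

(* Spacetime coordinates are (t, x): index 0 is time, [lift ord0 i] is x^i.
   The Kasner exponents p_1, p_2, p_3 are [p] at the ordinals 0, 1, 2. *)
Definition spatial (i : 'I_3) : 'I_4 := lift ord0 i.

Definition is_kasner : Prop := \sum_i p i = 1 /\ \sum_i p i ^+ 2 = 1.

Definition kasner_metric (X : 'rV[R]_4) : 'M[R]_4 :=
  diag_mx (\row_mu if unlift ord0 mu is Some i then X 0 ord0 `^ (2 * p i) else -1).

Definition kasner_domain : set 'rV[R]_4 := [set X | 0 < X 0 ord0].

Definition smooth_one_form (omega : 'I_4 -> 'rV[R]_4 -> R) : Prop :=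
  forall mu, smooth_on kasner_domain (omega mu) /\
    forall i X, kasner_domain X ->
      omega mu (X + (2 * pi) *: delta_mx 0 (spatial i)) = omega mu X.

Definition box_free (omega : 'I_4 -> 'rV[R]_4 -> R) : Prop :=
  forall mu X, kasner_domain X -> box kasner_metric omega mu X = 0.

(* Components with respect to (dtau, dx^1, dx^2, dx^3), tau = - ln t, of the form
   with components [omega] with respect to (dt, dx^1, dx^2, dx^3):
   dt = - e^{-tau} dtau. *)
Definition tau_comp (omega : 'I_4 -> 'rV[R]_4 -> R) (mu : 'I_4) (tau : R)
    (x : 'rV[R]_3) : R :=
  (if mu == ord0 then - expR (- tau) else 1) *
  omega mu (row_mx (expR (- tau))%:M x : 'rV[R]_(1 + 3)).

(* p_mu with the convention p_0 = 1, for which the formulas for omega^, for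
   A_oo and for its eigenvalues and eigenvectors become uniform in mu. *)
Definition p4 (mu : 'I_4) : R := oapp p 1 (unlift ord0 mu).

Definition hat_comp (omega : 'I_4 -> 'rV[R]_4 -> R) (mu : 'I_4) (tau : R)
    (x : 'rV[R]_3) : R :=
  expR (- (1 - p4 mu) * tau) * tau_comp omega mu tau x.

(* (omega^, d_tau omega^) *)
Definition hat_state (omega : 'I_4 -> 'rV[R]_4 -> R) (tau : R) (x : 'rV[R]_3) : 'cV[R]_8 :=
  (col_mx (\col_mu hat_comp omega mu tau x)
          (\col_mu derive1 (fun s => hat_comp omega mu s x) tau) : 'cV[R]_(4 + 4)).

Definition A_infty : 'M[R]_8 :=
  (block_mx 0 1%:M (- diag_mx (\row_mu (1 - p4 mu ^+ 2))) (- 2)%:M : 'M[R]_(4 + 4)).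

(* The boolean is the sign: [true] for +, [false] for -. *)
Definition eigval (k : 'I_4 * bool) : R := -1 + (if k.2 then p4 k.1 else - p4 k.1).

Definition eigvec (k : 'I_4 * bool) : 'cV[R]_8 :=
  (col_mx (delta_mx k.1 0) (eigval k *: delta_mx k.1 0) : 'cV[R]_(4 + 4)).

Local Notation p3 := (p ord_max).

(* The space E^n, as a row space; a column vector X of R^8 belongs to it iff
   X^T does, hence the transposition of A_oo. *)
Definition E_space (n : nat) : 'M[R]_8 :=
  (\sum_(k : 'I_4 * bool |
       ((- (n%:R * (1 - p3)) < eigval k) && (eigval k <= - (n.-1%:R * (1 - p3))))%R)
     eigenspace A_infty^T (eigval k))%MS.

Definition in_E_upto (n : nat) (X : 'cV[R]_8) : bool :=
  (X^T <= \sum_(1 <= m < n.+1) E_space m)%MS.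

(* pi_n, relative to the decomposition of R^8 as E^1 + ... + E^calN *)
Definition E_proj (calN n : nat) (X : 'cV[R]_8) : 'cV[R]_8 :=
  (X^T *m proj_mx (E_space n) (\sum_(1 <= m < calN.+1 | m != n) E_space m)%MS)^T.

Definition is_calN (calN : nat) : Prop :=
  2 < calN%:R * (1 - p3) /\ forall m : nat, 2 < m%:R * (1 - p3) -> (calN <= m)%N.

(* (D_0 u, ..., D_3 u) at time tau, where u is the upper half of the state v *)
Definition D_half (tau : R) (v : 'rV[R]_3 -> 'cV[R]_8) (x : 'rV[R]_3) : 'cV[R]_4 :=
  let u (mu : 'I_4) := fun y => usubmx (v y : 'cV[R]_(4 + 4)) mu 0 in
  \col_mu
    (\sum_i expR (- 2 * (1 - p i) * tau) * partials [:: i; i] (u mu) x +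
     if unlift ord0 mu is Some j
     then 2 * p j * expR (- (1 - p j) * tau) * partial j (u ord0) x
     else \sum_i 2 * p i * expR (- (1 - p i) * tau) * partial i (u (spatial i)) x).

Definition D_op (tau : R) (v : 'rV[R]_3 -> 'cV[R]_8) (x : 'rV[R]_3) : 'cV[R]_8 :=
  (col_mx 0 (D_half tau v x) : 'cV[R]_(4 + 4)).

(* Only relevant for tau >= 0. *)
Fixpoint F_infty (V : nat -> 'rV[R]_3 -> 'cV[R]_8) (n : nat) (tau : R)
    (x : 'rV[R]_3) : 'cV[R]_8 :=
  if n is m.+1 then
    expmx (tau *: A_infty) *m V n x +
    \col_k \int[lebesgue_measure]_(r in `[0, tau])
      (expmx ((tau - r) *: A_infty) *m D_op r (F_infty V m r) x) k 0
  else 0.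

(* [u (mu, b)] are the components u_{mu,+-} of the asymptotic data of omega. *)
Definition is_asymptotic_data (omega : 'I_4 -> 'rV[R]_4 -> R)
    (u : 'I_4 * bool -> 'rV[R]_3 -> R) : Prop :=
  (forall k, smooth_torus (u k)) /\
  exists (calN : nat) (V : nat -> 'rV[R]_3 -> 'cV[R]_8),
  [/\ is_calN calN,
      forall n, (1 <= n <= calN)%N ->
        [/\ forall k, smooth_torus (fun x => V n x k 0),
            forall x, in_E_upto n (V n x) &
            forall s : R, exists (C : R) (N : nat), forall tau : R, 0 <= tau ->
              (sobolev_norm s (fun x => hat_state omega tau x - F_infty V n tau x)%R
               <= (C * japanese tau ^+ N * expR (- (n%:R * (1 - p3) * tau)))%:E)%E] &
      forall x, V 1%N x + \sum_(2 <= n < calN.+1) E_proj calN n (V n x) =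
                \sum_k u k x *: eigvec k].

End Kasner.

Section Expansion.
Context {R : realType}.

(* A constant-coefficient linear differential operator acting on the families
   (f (mu, b)): a list of terms (c, k, l), standing for c * d_l (f k). *)
Definition ldo : Type := seq (R * ('I_4 * bool) * seq 'I_3).

Definition ldo_eval (L : ldo) (f : 'I_4 * bool -> 'rV[R]_3 -> R) (x : 'rV[R]_3) : R :=
  \sum_(m <- L) m.1.1 * partials m.2 (f m.1.2) x.

Definition smooth_value (L : ldo) (f : 'I_4 * bool -> 'rV[R]_3 -> R)
    (h : 'rV[R]_3 -> R) : Prop :=
  smooth_torus h /\ forall x, h x = ldo_eval L f x.

(* u_1 = u_{1,-} + d_1 u_{0,+} / (2 p_1) + alpha_1 and
   u_i = u_{i,+} - d_i u_{0,+} / (2 p_i) + alpha_i for i = 2, 3. *)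
Definition leading_coef (p : 'I_3 -> R) (u : 'I_4 * bool -> 'rV[R]_3 -> R)
    (alpha : 'I_3 -> 'rV[R]_3 -> R) (i : 'I_3) (x : 'rV[R]_3) : R :=
  if i == ord0
  then u (spatial i, false) x + (2 * p i)^-1 * partial i (u (ord0, true)) x + alpha i x
  else u (spatial i, true) x - (2 * p i)^-1 * partial i (u (ord0, true)) x + alpha i x.

(* The family u with u_{1,-}, u_{2,+}, u_{3,+} replaced by u_1, u_2, u_3. *)
Definition leading_family (p : 'I_3 -> R) (u : 'I_4 * bool -> 'rV[R]_3 -> R)
    (alpha : 'I_3 -> 'rV[R]_3 -> R) (k : 'I_4 * bool) : 'rV[R]_3 -> R :=
  if unlift ord0 k.1 is Some i
  then if k.2 == (i != ord0) then leading_coef p u alpha i else u k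
  else u k.

(* (omega_mu, d_tau omega_mu) *)
Definition comp_jet (omega : 'I_4 -> 'rV[R]_4 -> R) (mu : 'I_4) (tau : R)
    (x : 'rV[R]_3) : 'cV[R]_2 :=
  vec2 (tau_comp omega mu tau x) (derive1 (fun s => tau_comp omega mu s x) tau).

(* The polynomial in tau of degree at most d with coefficients c 0, ..., c d. *)
Definition tau_poly (d : nat) (c : nat -> 'I_2 -> 'rV[R]_3 -> R) (tau : R)
    (x : 'rV[R]_3) : 'cV[R]_2 :=
  \sum_(j < d.+1) tau ^+ j *: \col_r c j r x.

(* sum_{k=1}^q P_k(tau) e^{-a_k tau} *)
Definition exp_poly_sum (q : nat) (a : nat -> R) (deg : nat -> nat)
    (c : nat -> nat -> 'I_2 -> 'rV[R]_3 -> R) (tau : R) (x : 'rV[R]_3) : 'cV[R]_2 :=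
  \sum_(1 <= k < q.+1) expR (- (a k * tau)) *: tau_poly (deg k) (c k) tau x.

End Expansion.

(* Main.v *)
(** Along the eigenvectors of A_oo, the equation for (omega^, d_tau omega^) becomes
    y_k' = lambda_k y_k + (sources), where every source carries a factor e^{-beta tau}
    with beta >= delta = 1 - p_3.  Hence one can write down a formal solution, a sum of
    terms tau^j e^{-e tau} d^l u_k, order by order: the n-th increment solves the linear
    equation with the (n-1)-st increment as source, resonances producing powers of tau,
    and its constant of integration is only kept for eigenvalues in the windows not yet
    passed.  The key estimate is that y_k minus the formal solution of order n decays
    like e^{-n delta tau} up to epsilon, for every n.  For n <= calN the formal solution
    agrees with F_{oo,n}, because two solutions of the same equation differ by a multiple
    of e^{lambda_k tau}, and this multiple is fixed by the data or killed by decay; for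
    n >= calN the estimate propagates, since n delta > 2 >= -lambda_k leaves no room for
    homogeneous solutions.  All of this is done on Fourier coefficients: the Sobolev
    bounds of every order are equivalent to bounds by arbitrary powers of 1 + |n|^2.
    The terms of the formal solution whose exponent is below the first correction are
    then explicit, and the others are sorted by exponent; u_{1,-}, u_{2,+}, u_{3,+} are
    eliminated in favour of u_1, u_2, u_3 by recursion on the windows. *)
Require Import Defs.
From HB Require Import structures.
From mathcomp Require Import all_boot all_order all_algebra.
From mathcomp Require Import all_classical all_reals all_analysis.
From mathcomp Require Import ring lra zify.

Set Implicit Arguments.
Unset Strict Implicit.
Unset Printing Implicit Defensive.

Import Order.TTheory GRing.Theory Num.Theory.
Import numFieldNormedType.Exports.

Local Open Scope classical_set_scope.
Local Open Scope ring_scope.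

(** * Integrals depending on a parameter *)

Section SegmentIntegrals.
Context {R : realType}.
Implicit Types (a b : R).
Local Notation mu := (@lebesgue_measure R).

(** The exponents, the degrees and the differential operators of the statement must be chosen before
    the one-form. Hence the formal solution is a syntactic object, a list of [xterm] depending on
    the p_i alone, and a family [Phi] evaluates the same list either pointwise or on Fourier
    coefficients. The given V_{oo,n} are a priori unrelated for different n, while the data keep,
    for each eigenvector, the coordinate of a single one of them; comparison with a solution built
    from the u_k alone removes this redundancy. Two losses shape the estimates. The operator D costs
    derivatives, that is powers of 1 + |n|^2, which is harmless because all orders are controlled at
    once. The power of <tau> in the data may depend on the Sobolev index, whereas the conclusion
    wants a single N. So rates are first proved up to e^{epsilon tau} only, and the sharp rate with
    a uniform N is recovered at the end by expanding beyond order n: the error of the longer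
    expansion beats e^{-n delta tau}, and the extra terms are explicit exponential polynomials of
    known degree. *)

Lemma integrable_continuous a b (f : R -> R) : continuous f ->
  mu.-integrable `[a, b] (EFin \o f).
Proof.
move=> cf; apply: (@continuous_compact_integrable R f).
  exact: segment_compact.
by move=> x; apply: continuous_subspaceT.
Qed.

Lemma continuous_slice (S T U : topologicalType) (f : S -> T -> U) s :
  continuous (fun z : S * T => f z.1 z.2) -> continuous (f s).
Proof.
move=> cf t.
apply: (@continuous_comp _ _ _ (fun t : T => (s, t)) (fun z : S * T => f z.1 z.2)).
  by apply: cvg_pair => /=; [exact: cvg_cst|exact: cvg_id].
exact: cf.
Qed.

(** The integrand is uniformly close to its value at [t0] because the segment is compact: the
    near-covering form of compactness turns closeness around each (t0, c) into one neighbourhood of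
    [t0]. *)
Lemma continuous_Rintegral_param (T : topologicalType) a b (f : T -> R -> R) :
  a <= b -> continuous (fun z : T * R => f z.1 z.2) ->
  continuous (fun t => \int[mu]_(c in `[a, b]) f t c).
Proof.
move=> ab cf t0; apply/cvgrPdist_le => e e0.
(* Dividing by the length plus 1 keeps [d] meaningful when a = b. *)
have L0 : 0 < b - a + 1 by rewrite ltr_wpDl// subr_ge0.
pose d := e / (b - a + 1).
have d0 : 0 < d by rewrite divr_gt0.
have : \forall t \near t0, `[a, b] `<=` (fun c => `|f t0 c - f t c| <= d).
  have /compact_near_coveringP := @segment_compact R a b; apply.
  move=> c cab.
  have d20 : 0 < d / 2 by rewrite divr_gt0.
  have /cvgrPdist_le/(_ _ d20)[[/= A B] [At Bc] AB] := cf (t0, c).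
  exists (B, A) => //= -[c' t] /= [Bc' At'].
  have h1 := AB (t, c') (conj At' Bc').
  have h2 := AB (t0, c') (conj (nbhs_singleton At) Bc').
  rewrite /= in h1 h2.
  rewrite (_ : _ - _ = (f t0 c - f t c') - (f t0 c - f t0 c')); last by ring.
  by rewrite (le_trans (ler_normB _ _))// (splitr d) lerD.
apply: filterS => t ht.
have ift s : mu.-integrable `[a, b] (EFin \o f s).
  by apply: integrable_continuous; exact: continuous_slice cf.
rewrite -RintegralB//.
have ic r : mu.-integrable `[a, b] (EFin \o cst r).
  by apply: integrable_continuous => x; exact: cvg_cst.
have iB : mu.-integrable `[a, b] (EFin \o (fun x => f t0 x - f t x)).
  by apply: integrable_continuous => x; apply: cvgB; exact: continuous_slice cf _.
rewrite (le_trans (le_normr_Rintegral _ iB))//.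
rewrite (@le_trans _ _ (\int[mu]_(x in `[a, b]) cst d x))//.
  apply: le_Rintegral => //.
  by apply: integrable_continuous => x; apply: cvg_norm; apply: cvgB; exact: continuous_slice cf _.
rewrite Rintegral_cst//= lebesgue_measure_itv/= lte_fin.
have [ltab|_] := ltP a b; last by rewrite mulr0 ltW.
rewrite -EFinD/= /d mulrAC ler_pdivrMr// ler_wpM2l ?(ltW e0)//.
by rewrite lerDl.
Qed.

(** The dominating function demanded by differentiation under the integral sign is a constant, the
    maximum of |df| over the compact [t - 1, t + 1] x [a, b]. *)
Lemma is_derive_Rintegral_param a b (f df : R -> R -> R) (t : R) :
  a <= b ->
  continuous (fun z : R * R => f z.1 z.2) ->
  continuous (fun z : R * R => df z.1 z.2) ->
  (forall s c : R, is_derive s 1 (fun s => f s c) (df s c)) ->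
  is_derive t 1 (fun s => \int[mu]_(c in `[a, b]) f s c)
                (\int[mu]_(c in `[a, b]) df t c).
Proof.
move=> ab cf cdf fdf.
have d1 s c : partial1of2 f s c = df s c.
  by rewrite partial1of2E; apply: derive_val.
have K : compact (`[t - 1, t + 1] `*` `[a, b] : set (R * R)).
  by apply: compact_setX; exact: segment_compact.
have Kc : {within `[t - 1, t + 1] `*` `[a, b], continuous (fun z : R * R => `|df z.1 z.2|)}.
  apply: continuous_subspaceT => z; apply: cvg_norm; exact: cdf.
have [z [_ zmax]] : exists z : R * R, (`[t - 1, t + 1] `*` `[a, b]) z /\
    forall y, (`[t - 1, t + 1] `*` `[a, b]) y -> `|df y.1 y.2| <= `|df z.1 z.2|.
  have [|z [zK zm]] := @compact_EVT_max _ R (fun z : R * R => `|df z.1 z.2|) _ _ K Kc.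
    by exists (t, a); split; rewrite /= in_itv/= ?lexx ?ab//; apply/andP; split; lra.
  by exists z; split => [|y yK]; [move: zK; rewrite inE|apply: zm; rewrite inE].
pose M := `|df z.1 z.2|.
have It : `]t - 1, t + 1[%classic t by rewrite /= in_itv/=; apply/andP; split; lra.
have intf (x : R) : `]t - 1, t + 1[%classic x -> mu.-integrable `[a, b] (EFin \o f x).
  by move=> _; apply: integrable_continuous; exact: continuous_slice cf.
have derf (x y : R) : `]t - 1, t + 1[%classic x -> `[a, b]%classic y -> derivable (f ^~ y) x 1.
  by move=> _ _; apply: ex_derive.
have M0 (y : R) : 0 <= cst M y by rewrite /= /M.
have iM : mu.-integrable `[a, b] (EFin \o cst M).
  by apply: integrable_continuous => x; exact: cvg_cst.
have ub (x y : R) : `]t - 1, t + 1[%classic x -> `[a, b]%classic y -> `|partial1of2 f x y| <= cst M y.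
  move=> /= xI yI; rewrite d1; apply: (zmax (x, y)); split => //=.
  by move: xI; rewrite !in_itv/= => /andP[? ?]; rewrite !ltW.
have mab : measurable (`[a, b]%classic : set R) by [].
apply: DeriveDef.
  exact: (@derivable_under_integral R _ _ mu f _ mab _ _ _ It intf derf _ M0 iM ub).
rewrite -derive1E (@differentiation_under_integral R _ _ mu f _ mab _ _ _ It intf derf _ M0 iM ub).
by apply: eq_Rintegral => y _; rewrite d1.
Qed.

Lemma Rintegral_derive a b (F f : R -> R) : a <= b -> continuous f ->
  (forall x : R, is_derive x 1 F (f x)) ->
  \int[mu]_(x in `[a, b]) f x = F b - F a.
Proof.
move=> ab cf Ff.
have cF : continuous F.
  move=> x; apply: differentiable_continuous.
  by apply/derivable1_diffP; apply: ex_derive.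
move: ab; rewrite le_eqVlt => /predU1P[->|ab].
  by rewrite set_itv1 Rintegral_set1 subrr.
rewrite /Rintegral (@continuous_FTC2 _ f F)//.
- exact: continuous_subspaceT.
- split.
  + by move=> x _; apply: ex_derive.
  + by apply: cvg_at_right_filter; exact: cF.
  + by apply: cvg_at_left_filter; exact: cF.
- by move=> x _; rewrite derive1E; apply: derive_val.
Qed.

End SegmentIntegrals.

Section LineDerivatives.
Context {R : realType}.

(** Turns a directional derivative into a one-variable derivative at 0, where the differentiation
    rules for functions of a real variable apply. *)
Lemma is_derive_lineP (V : normedModType R) (f : V -> R) x v d :
  is_derive (0 : R) 1 (fun h : R => f (h *: v + x)) d <-> is_derive x v f d.
Proof.
have E : (fun h : R => h^-1 *: (((fun h : R => f (h *: v + x)) \o shift (0 : R)) (h *: (1 : R^o)) -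
                 f (0 *: v + x))) =
         (fun h : R => h^-1 *: ((f \o shift x) (h *: v) - f x)).
  by apply/funext => h /=; rewrite addr0 [_ *: 1]mulr1 scale0r add0r.
by split=> -[d1 d2]; split; move: d1 d2; rewrite /derivable /derive E.
Qed.

Lemma is_derive_along (V : normedModType R) (f : V -> R) (g : R -> V) s v d :
  (forall h, g (h + s) = h *: v + g s) ->
  is_derive (g s) v f d -> is_derive s 1 (fun s => f (g s)) d.
Proof.
move=> gE /is_derive_lineP H; apply/is_derive_lineP.
rewrite (_ : (fun h : R => f (g (h *: 1 + s))) = (fun h => f (h *: v + g s)))//.
by apply/funext => h; rewrite [_ *: 1]mulr1 gE.
Qed.

End LineDerivatives.

Lemma continuous_pair (S T U : topologicalType) (f : S -> T) (g : S -> U) :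
  continuous f -> continuous g -> continuous (fun x => (f x, g x)).
Proof. by move=> cf cg x; apply: cvg_pair; [exact: cf|exact: cg]. Qed.

Lemma continuous_compT (S T U : topologicalType) (f : S -> T) (g : T -> U) :
  continuous f -> continuous g -> continuous (fun x => g (f x)).
Proof. by move=> cf cg x; apply: continuous_comp; [exact: cf|exact: cg]. Qed.

Section TorusIntegrals.
Context {R : realType}.
Local Notation mu := (@lebesgue_measure R).
Local Notation J := (`[0, 2 * pi]%classic : set R).

Let J0 : (0 : R) <= 2 * pi.
Proof. by rewrite mulr_ge0// pi_ge0. Qed.

Definition int3 (F : R -> R -> R -> R) : R :=
  \int[mu]_(a in J) \int[mu]_(b in J) \int[mu]_(c in J) F a b c.

Lemma continuous_int1 (T : topologicalType) (F : T -> R -> R -> R -> R) :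
  continuous (fun z : T * R * R * R => F z.1.1.1 z.1.1.2 z.1.2 z.2) ->
  continuous (fun z : T * R * R => \int[mu]_(c in J) F z.1.1 z.1.2 z.2 c).
Proof.
by move=> cF; apply: (@continuous_Rintegral_param R _ 0 (2 * pi) (fun (z : T * R * R) c => F z.1.1 z.1.2 z.2 c)).
Qed.

Lemma continuous_int2 (T : topologicalType) (F : T -> R -> R -> R -> R) :
  continuous (fun z : T * R * R * R => F z.1.1.1 z.1.1.2 z.1.2 z.2) ->
  continuous (fun z : T * R => \int[mu]_(b in J) \int[mu]_(c in J) F z.1 z.2 b c).
Proof.
move=> /continuous_int1 cF.
by apply: (@continuous_Rintegral_param R _ 0 (2 * pi) (fun (z : T * R) b => \int[mu]_(c in J) F z.1 z.2 b c)).
Qed.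

Section param.
Variables (F dF : R -> R -> R -> R -> R).
Hypothesis cF : continuous (fun z : R * R * R * R => F z.1.1.1 z.1.1.2 z.1.2 z.2).
Hypothesis cdF : continuous (fun z : R * R * R * R => dF z.1.1.1 z.1.1.2 z.1.2 z.2).
Hypothesis FdF : forall s a b c : R, is_derive s 1 (fun s => F s a b c) (dF s a b c).

Lemma is_derive_int1 (a b t : R) :
  is_derive t 1 (fun s => \int[mu]_(c in J) F s a b c) (\int[mu]_(c in J) dF t a b c).
Proof.
have cm : continuous (fun z : R * R => (z.1, a, b, z.2)).
  by do !apply: continuous_pair; move=> z; (exact: cvg_fst || exact: cvg_snd || exact: cvg_cst).
apply: (is_derive_Rintegral_param (f := fun s c => F s a b c) (df := fun s c => dF s a b c)) => //.
- exact: (continuous_compT cm cF).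
- exact: (continuous_compT cm cdF).
Qed.

Lemma is_derive_int2 (a t : R) :
  is_derive t 1 (fun s => \int[mu]_(b in J) \int[mu]_(c in J) F s a b c)
    (\int[mu]_(b in J) \int[mu]_(c in J) dF t a b c).
Proof.
have cm : continuous (fun z : R * R => (z.1, a, z.2)).
  by do !apply: continuous_pair; move=> z; (exact: cvg_fst || exact: cvg_snd || exact: cvg_cst).
apply: (is_derive_Rintegral_param (f := fun s b => \int[mu]_(c in J) F s a b c)
  (df := fun s b => \int[mu]_(c in J) dF s a b c)) => //.
- exact: (continuous_compT cm (continuous_int1 cF)).
- exact: (continuous_compT cm (continuous_int1 cdF)).
- by move=> s c; exact: is_derive_int1.
Qed.

Lemma is_derive_int3 (t : R) : is_derive t 1 (fun s => int3 (F s)) (int3 (dF t)).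
Proof.
apply: (is_derive_Rintegral_param (f := fun s a => \int[mu]_(b in J) \int[mu]_(c in J) F s a b c)
  (df := fun s a => \int[mu]_(b in J) \int[mu]_(c in J) dF s a b c)) => //.
- exact: continuous_int2.
- exact: continuous_int2.
- by move=> s a; exact: is_derive_int2.
Qed.

End param.

Definition pt3 (a b c : R) : 'rV[R]_3 := \row_k [:: a; b; c]`_k.

Lemma pt3E a b c :
  pt3 a b c = a *: delta_mx 0 ord0 + b *: delta_mx 0 (inord 1) + c *: delta_mx 0 ord_max.
Proof.
apply/rowP => k; rewrite !mxE /=.
case: k => -[|[|[|//]]] k3 /=; rewrite -!val_eqE /= ?inordK//= ?mulr1 ?mulr0; lra.
Qed.

Lemma torus_intE f : torus_int f = int3 (fun a b c => f (pt3 a b c)).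
Proof. by []. Qed.

Lemma continuous_pt3 : continuous (fun z : R * R * R => pt3 z.1.1 z.1.2 z.2).
Proof.
rewrite (_ : (fun _ => _) = fun z : R * R * R => z.1.1 *: delta_mx 0 ord0 +
  z.1.2 *: delta_mx 0 (inord 1) + z.2 *: delta_mx 0 ord_max); last first.
  by apply/funext => z; exact: pt3E.
move=> z; apply: cvgD; [apply: cvgD|]; apply: cvgZr_tmp.
- by apply: (continuous_compT (f := fst) (g := fst)) => ?; exact: cvg_fst.
- by apply: (continuous_compT (f := fst) (g := snd)) => ?; [exact: cvg_fst|exact: cvg_snd].
- exact: cvg_snd.
Qed.

End TorusIntegrals.

(** * Smooth functions on the torus *)

Section SmoothFunctions.
Context {R : realType} {n : nat}.
Implicit Types (f g : 'rV[R]_n -> R) (U : set 'rV[R]_n) (l : seq 'I_n).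

Lemma partials_cat l1 l2 f : partials (l1 ++ l2) f = partials l1 (partials l2 f).
Proof. exact: foldr_cat. Qed.

Lemma smooth_on_partials U l f : smooth_on U f -> smooth_on U (partials l f).
Proof. by move=> sf l' x Ux; rewrite -partials_cat; exact: sf. Qed.

Lemma smooth_on_partial U i f : smooth_on U f -> smooth_on U (partial i f).
Proof. exact: (@smooth_on_partials _ [:: i]). Qed.

Lemma smooth_on_differentiable U f x : smooth_on U f -> U x -> differentiable f x.
Proof. by move=> sf; exact: (sf [::]). Qed.

Lemma smooth_on_is_derive U f x i : smooth_on U f -> U x ->
  is_derive x (delta_mx 0 i) f (partial i f x).
Proof.
by move=> sf Ux; apply/derivableP/diff_derivable; exact: smooth_on_differentiable Ux.
Qed.

Lemma smooth_continuous f : smooth_on setT f -> continuous f.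
Proof.
by move=> sf x; apply: differentiable_continuous; exact: (sf [::]).  
Qed.

Lemma partials_lin l (a : R) f g : smooth_on setT f -> smooth_on setT g ->
  partials l (fun x => a * f x + g x) = fun x => a * partials l f x + partials l g x.
Proof.
move=> sf sg; elim: l => //= i l ->; apply/funext => x; rewrite /partial.
have df := smooth_on_is_derive i (smooth_on_partials l sf) (I : setT x).
have dg := smooth_on_is_derive i (smooth_on_partials l sg) (I : setT x).
have -> : (fun x => a * partials l f x + partials l g x) =
   a \*: partials l f + partials l g by [].
by rewrite derive_val.
Qed.

Lemma smooth_lin (a : R) f g : smooth_on setT f -> smooth_on setT g ->
  smooth_on setT (fun x => a * f x + g x).
Proof.
move=> sf sg l x _; rewrite partials_lin//.
have -> : (fun x => a * partials l f x + partials l g x) =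
   a \*: partials l f + partials l g by [].
apply: differentiableD; [apply: differentiableZ|].
  exact: (sf l).
exact: (sg l).
Qed.

Lemma partials_cst0 l : partials l (fun=> 0 : R) = fun _ : 'rV[R]_n => 0.
Proof.
elim: l => //= i l ->; apply/funext => x; rewrite /partial.
by rewrite (_ : (fun=> 0) = cst 0)// derive_val.
Qed.

Lemma smooth_cst0 : smooth_on setT (fun _ : 'rV[R]_n => 0 : R).
Proof. by move=> l x _; rewrite partials_cst0; exact: differentiable_cst. Qed.

Lemma smooth_sum (I : Type) (r : seq I) (c : I -> R) (F : I -> 'rV[R]_n -> R) :
  (forall i, smooth_on setT (F i)) ->
  smooth_on setT (fun x => \sum_(i <- r) c i * F i x) /\
  forall l, partials l (fun x => \sum_(i <- r) c i * F i x) =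
            fun x => \sum_(i <- r) c i * partials l (F i) x.
Proof.
move=> sF; elim: r => [|i r [sr pr]].
  rewrite (_ : (fun _ => _) = fun=> 0); last by apply/funext => x; rewrite big_nil.
  split=> [|l]; first exact: smooth_cst0.
  by rewrite partials_cst0; apply/funext => x; rewrite big_nil.
rewrite (_ : (fun _ => _) = (fun x => c i * F i x + \sum_(i <- r) c i * F i x)).
  split=> [|l]; first exact: smooth_lin.
  by rewrite partials_lin// pr; apply/funext => x; rewrite big_cons.
by apply/funext => x; rewrite big_cons.
Qed.

End SmoothFunctions.

Section SmoothTorus.
Context {R : realType}.
Implicit Types (f g : 'rV[R]_3 -> R).

Lemma derive_periodic (V : normedModType R) (f : V -> R) (w : V) :
  (forall x, f (x + w) = f x) -> forall v x, 'D_v f (x + w) = 'D_v f x.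
Proof.
move=> fw v x; rewrite /derive.
by under eq_fun do rewrite /= addrA !fw.
Qed.

Lemma smooth_torus_partials l f : smooth_torus f -> smooth_torus (partials l f).
Proof.
case=> sf pf; split; first exact: smooth_on_partials.
move=> i; elim: l => [|j l IH] x /=; first exact: pf.
by rewrite /partial derive_periodic.
Qed.

Lemma smooth_torus_partial i f : smooth_torus f -> smooth_torus (partial i f).
Proof. exact: (@smooth_torus_partials [:: i]). Qed.

Lemma smooth_torus_continuous f : smooth_torus f -> continuous f.
Proof. by case=> sf _; exact: smooth_continuous. Qed.

Lemma smooth_torus_sum (I : Type) (r : seq I) (c : I -> R) (F : I -> 'rV[R]_3 -> R) :
  (forall i, smooth_torus (F i)) ->
  smooth_torus (fun x => \sum_(i <- r) c i * F i x).
Proof.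
move=> sF; split; first by apply smooth_sum => i; have [] := sF i.
by move=> i x; apply: eq_bigr => j _; have [_ ->] := sF j.
Qed.

Lemma smooth_torus_lin (a : R) f g : smooth_torus f -> smooth_torus g ->
  smooth_torus (fun x => a * f x + g x).
Proof.
move=> [sf pf] [sg pg]; split; first exact: smooth_lin.
by move=> i x; rewrite pf pg.
Qed.

Lemma smooth_torus_cst0 : smooth_torus (fun _ : 'rV[R]_3 => 0 : R).
Proof. by split => //; exact: smooth_cst0. Qed.

Lemma smooth_torusZ (a : R) f : smooth_torus f -> smooth_torus (fun x => a * f x).
Proof.
move=> sf; have := smooth_torus_lin a sf smooth_torus_cst0.
by under eq_fun do rewrite addr0.
Qed.

Lemma smooth_torusD f g : smooth_torus f -> smooth_torus g ->
  smooth_torus (fun x => f x + g x).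
Proof.
move=> sf sg; have := smooth_torus_lin 1 sf sg.
by under eq_fun do rewrite mul1r.
Qed.

Lemma smooth_torusB f g : smooth_torus f -> smooth_torus g ->
  smooth_torus (fun x => f x - g x).
Proof.
move=> sf sg; have := smooth_torus_lin (-1) sg sf.
by under eq_fun do rewrite mulN1r addrC.
Qed.

End SmoothTorus.

(** * Fourier coefficients and Sobolev norms *)

Section ContinuousTuples.

Lemma continuous_fstT (S T U : topologicalType) (f : S -> T * U) :
  continuous f -> continuous (fun x => (f x).1).
Proof. by move=> cf; apply: (continuous_compT cf) => z; exact: cvg_fst. Qed.

Lemma continuous_sndT (S T U : topologicalType) (f : S -> T * U) :
  continuous f -> continuous (fun x => (f x).2).
Proof. by move=> cf; apply: (continuous_compT cf) => z; exact: cvg_snd. Qed.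

Lemma continuous_idT (S : topologicalType) : continuous (fun x : S => x).
Proof. by move=> x; exact: cvg_id. Qed.

Lemma continuous_cstT (S T : topologicalType) (t : T) : continuous (fun x : S => t).
Proof. by move=> x; exact: cvg_cst. Qed.

Lemma cvg_big_sum (K : numFieldType) (V : normedModType K) (T I : Type) (r : seq I)
    (F : set_system T) {FF : Filter F} (f : I -> T -> V) (l : I -> V) :
  (forall i, f i @ F --> l i) ->
  (fun x => \sum_(i <- r) f i x) @ F --> \sum_(i <- r) l i.
Proof.
move=> fl; elim: r => [|i r IH].
  by rewrite big_nil; under eq_fun do rewrite big_nil; exact: cvg_cst.
by rewrite big_cons; under eq_fun do rewrite big_cons; apply: cvgD.
Qed.

Lemma continuous_mulT (K : numFieldType) (T : topologicalType) (f g : T -> K) :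
  continuous f -> continuous g -> continuous (fun x => f x * g x).
Proof. by move=> cf cg x; apply: cvgM; [exact: cf|exact: cg]. Qed.

Lemma continuous_addT (K : numFieldType) (T : topologicalType) (f g : T -> K) :
  continuous f -> continuous g -> continuous (fun x => f x + g x).
Proof. by move=> cf cg x; apply: cvgD; [exact: cf|exact: cg]. Qed.

End ContinuousTuples.

Ltac ctuple := repeat first
  [ exact: continuous_idT | exact: continuous_cstT | apply: continuous_pair
  | apply: continuous_fstT | apply: continuous_sndT ].

Lemma continuous_pt3T (R : realType) (T : topologicalType) (f : 'rV[R]_3 -> R) (a b c : T -> R) :
  continuous f -> continuous a -> continuous b -> continuous c ->
  continuous (fun t => f (pt3 (a t) (b t) (c t))).
Proof.
move=> cf ca cb cc.
apply: (continuous_compT (f := fun t => (a t, b t, c t)) _ (continuous_compT (@continuous_pt3 R) cf)).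
by do !apply: continuous_pair.
Qed.

Ltac cpt3 := rewrite /=;
  match goal with H : continuous ?h |- continuous (fun z => ?h (pt3 _ _ _)) =>
    refine (continuous_pt3T H _ _ _); ctuple end.

Section FourierCoefficients.
Context {R : realType}.
Implicit Types (f g : 'rV[R]_3 -> R) (nu : 'rV[int]_3) (sg : bool).
Local Notation mu := (@lebesgue_measure R).
Local Notation J := (`[0, 2 * pi]%classic : set R).

Let J0 : (0 : R) <= 2 * pi.
Proof. by rewrite mulr_ge0// pi_ge0. Qed.

(** Fundamental theorem of calculus in the variable x_i, the boundary terms cancelling by
    periodicity. The iterated integral has a fixed order, so the three positions of x_i are treated
    apart, the derivative passing through the integrals that lie inside; integrals are never
    exchanged. *)
Lemma torus_int_partial0 i f df : continuous f -> continuous df ->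
  (forall x, is_derive x (delta_mx 0 i) f (df x)) ->
  (forall x, f (x + (2 * pi) *: delta_mx 0 i) = f x) -> torus_int df = 0.
Proof.
move=> cf cdf fdf pf; rewrite torus_intE /int3.
have i3 : i = ord0 \/ i = inord 1 \/ i = ord_max.
  case: i {fdf pf} => -[|[|[|//]]] k; [left|right; left|right; right]; apply: val_inj => //=.
  by rewrite inordK.
case: i3 => [|[]] iE; rewrite {}iE in fdf pf.
- have der (s b c : R) : is_derive s 1 (fun s => f (pt3 s b c)) (df (pt3 s b c)).
    apply: is_derive_along (fdf _) => h; rewrite !pt3E scalerDl.
    by rewrite -!addrA.
  etransitivity; first apply: (@Rintegral_derive R 0 (2 * pi)
      (fun a => \int[mu]_(b in J) \int[mu]_(c in J) f (pt3 a b c))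
      (fun a => \int[mu]_(b in J) \int[mu]_(c in J) df (pt3 a b c))) => //.
  + apply: (@continuous_Rintegral_param R R 0 (2 * pi) (fun a b => \int[mu]_(c in J) df (pt3 a b c))) => //.
    apply: (@continuous_Rintegral_param R (R * R)%type 0 (2 * pi) (fun z c => df (pt3 z.1 z.2 c))) => //.
    by cpt3.
  + move=> a; apply: (is_derive_int2 (F := fun s _ b c => f (pt3 s b c))
      (dF := fun s _ b c => df (pt3 s b c)) _ _ _ 0); cpt3.
  + apply/eqP; rewrite subr_eq0; apply/eqP; apply: eq_Rintegral => b _; apply: eq_Rintegral => c _.
    by rewrite -[in RHS]pf !pt3E scale0r add0r [in RHS]addrC -!addrA.
- have der (a s c : R) : is_derive s 1 (fun s => f (pt3 a s c)) (df (pt3 a s c)).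
    apply: is_derive_along (fdf _) => h; rewrite !pt3E scalerDl.
    by rewrite [RHS]addrA [in RHS]addrCA.
  transitivity (\int[mu]_(a in J) (0 : R)); last by rewrite Rintegral_cst// mul0r.
  apply: eq_Rintegral => a _.
  etransitivity; first apply: (@Rintegral_derive R 0 (2 * pi)
      (fun b => \int[mu]_(c in J) f (pt3 a b c))
      (fun b => \int[mu]_(c in J) df (pt3 a b c))) => //.
  + apply: (@continuous_Rintegral_param R R 0 (2 * pi) (fun b c => df (pt3 a b c))) => //.
    by cpt3.
  + move=> b; apply: (is_derive_int1 (F := fun s _ _ c => f (pt3 a s c))
      (dF := fun s _ _ c => df (pt3 a s c)) _ _ _ 0 0); cpt3.
  + apply/eqP; rewrite subr_eq0; apply/eqP; apply: eq_Rintegral => c _.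
    rewrite -[in RHS]pf !pt3E scale0r addr0 -!addrA; congr (f (_ + _)).
    by rewrite addrC.
- have der (a b s : R) : is_derive s 1 (fun s => f (pt3 a b s)) (df (pt3 a b s)).
    apply: is_derive_along (fdf _) => h; rewrite !pt3E scalerDl.
    by rewrite addrCA.
  transitivity (\int[mu]_(a in J) (0 : R)); last by rewrite Rintegral_cst// mul0r.
  apply: eq_Rintegral => a _.
  transitivity (\int[mu]_(b in J) (0 : R)); last by rewrite Rintegral_cst// mul0r.
  apply: eq_Rintegral => b _.
  etransitivity; first apply: (@Rintegral_derive R 0 (2 * pi)
      (fun c => f (pt3 a b c)) (fun c => df (pt3 a b c))) => //.
  + by cpt3.
  + by apply/eqP; rewrite subr_eq0; apply/eqP; rewrite -[in RHS]pf !pt3E scale0r addr0.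
Qed.

Definition trig sg : R -> R := if sg then cos else sin.

End FourierCoefficients.

(* Locked: unification would otherwise unfold the integrals. *)
HB.lock Definition fcoef (R : realType) (sg : bool) (nu : 'rV[int]_3) (f : 'rV[R]_3 -> R) : R :=
  (2 * pi) ^- 3 * torus_int (fun x => f x * trig sg (freq_dot nu x)).

Section FourierCoefficientTheory.
Context {R : realType}.
Implicit Types (f g : 'rV[R]_3 -> R) (nu : 'rV[int]_3) (sg : bool).

Lemma fcoefE sg nu f : fcoef sg nu f =
  (2 * pi) ^- 3 * torus_int (fun x => f x * trig sg (freq_dot nu x)).
Proof. by rewrite fcoef.unlock. Qed.

Lemma fourier_sqrE f nu : fourier_sqr f nu = fcoef true nu f ^+ 2 + fcoef false nu f ^+ 2.
Proof. by rewrite !fcoefE. Qed.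

Lemma freq_dot_add nu (h : R) i x :
  freq_dot nu (h *: delta_mx 0 i + x) = h * (nu 0 i)%:~R + freq_dot nu x.
Proof.
rewrite /freq_dot (eq_bigr (fun k => (nu 0 k)%:~R * (h *+ (k == i)) + (nu 0 k)%:~R * x 0 k)).
  rewrite big_split/= (bigD1 i)//= eqxx mulr1n big1 ?addr0 1?[_ * h]mulrC//.
  by move=> k /negPf ->; rewrite mulr0n mulr0.
by move=> k _; rewrite !mxE eqxx/= mulrDr mulr_natr.
Qed.

Lemma continuous_freq_dot nu : continuous (@freq_dot R nu).
Proof.
move=> x; apply: (@cvg_big_sum R R^o _ _ _ (nbhs x) (nbhs_filter x)) => i.
by apply: cvgMl_tmp; exact: coord_continuous.
Qed.

Lemma continuous_trig sg nu : continuous (fun x : 'rV[R]_3 => trig sg (freq_dot nu x)).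
Proof.
apply: (continuous_compT (@continuous_freq_dot nu)).
by case: sg; [exact: continuous_cos|exact: continuous_sin].
Qed.

Lemma is_derive_trig sg nu i x : is_derive x (delta_mx 0 i)
  (fun x : 'rV[R]_3 => trig sg (freq_dot nu x))
  ((if sg then -1 else 1) * (nu 0 i)%:~R * trig (~~ sg) (freq_dot nu x)).
Proof.
apply/is_derive_lineP; set y := freq_dot nu x; set v : R := (nu 0 i)%:~R.
under eq_fun do rewrite freq_dot_add.
rewrite -/y -/v.
have H : is_derive (0 : R) 1 (fun h : R => h * v + y) v.
  apply: is_derive_eq; by rewrite scaler0 add0r addr0 [_ *: _]mulr1.
have -> : (fun h : R => trig sg (h * v + y)) = trig sg \o (fun h => h * v + y) by [].
have D0 : is_derive (0 * v + y) 1 (trig sg) ((if sg then -1 else 1) * trig (~~ sg) y).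
  rewrite mul0r add0r /trig; case: sg => /=; rewrite ?mulN1r ?mul1r.
    exact: is_derive_cos.
  exact: is_derive_sin.
by apply: is_derive_eq; rewrite mulrAC.
Qed.

Lemma trig_periodic sg nu i (x : 'rV[R]_3) :
  trig sg (freq_dot nu (x + (2 * pi) *: delta_mx 0 i)) = trig sg (freq_dot nu x).
Proof.
rewrite addrC freq_dot_add; set y := freq_dot nu x.
have P z k : trig sg (z + pi *+ 2 *+ k) = trig sg z.
  by rewrite /trig; case: sg; rewrite (periodicn _ k)//; [exact: cosD2pi|exact: sinD2pi].
have e : 2 * pi = pi *+ 2 :> R by rewrite mulr_natl.
case: (nu 0 i) => k.
  by rewrite e -pmulrn mulr_natr addrC P.
rewrite NegzE mulrNz mulrN e -pmulrn mulr_natr addrC -{2}(subrK (pi *+ 2 *+ k.+1) y).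
by rewrite P.
Qed.

Lemma torus_int_trig_partial sg nu i f : smooth_torus f ->
  torus_int (fun x => (if sg then -1 else 1) * (nu 0 i)%:~R * (f x * trig (~~ sg) (freq_dot nu x)) +
    partial i f x * trig sg (freq_dot nu x)) = 0.
Proof.
move=> sf.
have cf := smooth_torus_continuous sf.
have cdf := smooth_torus_continuous (smooth_torus_partial i sf).
pose c : R := (if sg then -1 else 1) * (nu 0 i)%:~R.
have c1 : continuous (fun x => partial i f x * trig sg (freq_dot nu x)).
  by apply: continuous_mulT => //; exact: continuous_trig.
have c2 : continuous (fun x => f x * trig (~~ sg) (freq_dot nu x)).
  by apply: continuous_mulT => //; exact: continuous_trig.
apply: (torus_int_partial0 (i := i) (f := fun x => f x * trig sg (freq_dot nu x))).
- by apply: continuous_mulT => //; exact: continuous_trig.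
- apply: continuous_addT => //; apply: continuous_mulT => //; exact: continuous_cstT.
- move=> x.
  have d1 := smooth_on_is_derive i sf.1 (I : setT x).
  have d2 := is_derive_trig sg nu i x.
  apply: is_derive_eq; rewrite /GRing.scale/= -/c; ring.
- by move=> x; rewrite sf.2 trig_periodic.
Qed.

End FourierCoefficientTheory.


Section FourierTheory.
Context {R : realType}.
Implicit Types (f g : 'rV[R]_3 -> R) (nu : 'rV[int]_3) (sg : bool).
Local Notation mu := (@lebesgue_measure R).
Local Notation J := (`[0, 2 * pi]%classic : set R).

Let J0 : (0 : R) <= 2 * pi.
Proof. by rewrite mulr_ge0// pi_ge0. Qed.

Lemma Rintegral_lin (a b k : R) (f g : R -> R) : continuous f -> continuous g ->
  \int[mu]_(x in `[a, b]) (k * f x + g x) =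
  k * \int[mu]_(x in `[a, b]) f x + \int[mu]_(x in `[a, b]) g x.
Proof.
move=> cf cg; rewrite RintegralD//.
- rewrite RintegralZl//; exact: integrable_continuous.
- by apply: integrable_continuous; apply: continuous_mulT => //; exact: continuous_cstT.
- exact: integrable_continuous.
Qed.

Lemma normr_Rintegral_le (a b M : R) (f : R -> R) : a <= b -> continuous f ->
  (forall x, a <= x <= b -> `|f x| <= M) ->
  `|\int[mu]_(x in `[a, b]) f x| <= M * (b - a).
Proof.
move=> ab cf fM.
rewrite (le_trans (le_normr_Rintegral _ (integrable_continuous _ _ cf)))//.
rewrite (@le_trans _ _ (\int[mu]_(x in `[a, b]) cst M x))//.
  apply: le_Rintegral => //.
  - by apply: integrable_continuous; apply: (continuous_compT cf) => x; exact: norm_continuous.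
  - by apply: integrable_continuous; exact: continuous_cstT.
rewrite Rintegral_cst//= lebesgue_measure_itv/= lte_fin.
have [//|ba] := ltP a b.
by rewrite mulr0 (_ : b - a = 0) ?mulr0//; lra.
Qed.

Lemma continuous_inner1 f (a b : R) : continuous f -> continuous (fun c => f (pt3 a b c)).
Proof. by move=> cf; apply: continuous_pt3T => //; ctuple. Qed.

Lemma continuous_inner2 f (a : R) : continuous f ->
  continuous (fun b => \int[mu]_(c in J) f (pt3 a b c)).
Proof.
move=> cf; apply: (@continuous_Rintegral_param R R 0 (2 * pi) (fun b c => f (pt3 a b c))) => //.
by cpt3.
Qed.

Lemma continuous_inner3 f : continuous f ->
  continuous (fun a => \int[mu]_(b in J) \int[mu]_(c in J) f (pt3 a b c)).
Proof.
move=> cf; apply: (@continuous_Rintegral_param R R 0 (2 * pi)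
  (fun a b => \int[mu]_(c in J) f (pt3 a b c))) => //.
apply: (@continuous_Rintegral_param R (R * R)%type 0 (2 * pi) (fun z c => f (pt3 z.1 z.2 c))) => //.
by cpt3.
Qed.

Lemma torus_int_lin (k : R) f g : continuous f -> continuous g ->
  torus_int (fun x => k * f x + g x) = k * torus_int f + torus_int g.
Proof.
move=> cf cg; rewrite !torus_intE /int3.
rewrite -Rintegral_lin; [|exact: continuous_inner3..].
apply: eq_Rintegral => a _; rewrite -Rintegral_lin; [|exact: continuous_inner2..].
apply: eq_Rintegral => b _; rewrite -Rintegral_lin//; exact: continuous_inner1.
Qed.

Lemma normr_torus_int_le (M : R) f : continuous f ->
  (forall a b c, 0 <= a <= 2 * pi -> 0 <= b <= 2 * pi -> 0 <= c <= 2 * pi ->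
     `|f (pt3 a b c)| <= M) ->
  `|torus_int f| <= M * (2 * pi) ^+ 3.
Proof.
move=> cf fM; rewrite torus_intE /int3.
rewrite (_ : M * _ = M * (2 * pi - 0) * (2 * pi - 0) * (2 * pi - 0)); last by rewrite subr0; ring.
apply: normr_Rintegral_le => //; first exact: continuous_inner3.
move=> a aJ; apply: normr_Rintegral_le => //; first exact: continuous_inner2.
move=> b bJ; apply: normr_Rintegral_le => //; first exact: continuous_inner1.
by move=> c cJ; exact: fM.
Qed.

Lemma fcoef_lin sg nu (k : R) f g : continuous f -> continuous g ->
  fcoef sg nu (fun x => k * f x + g x) = k * fcoef sg nu f + fcoef sg nu g.
Proof.
move=> cf cg; rewrite !fcoefE.
have -> : (fun x => (k * f x + g x) * trig sg (freq_dot nu x)) =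
  (fun x => k * (f x * trig sg (freq_dot nu x)) + g x * trig sg (freq_dot nu x)).
  by apply/funext => x; ring.
have ctr (h : 'rV[R]_3 -> R) : continuous h -> continuous (fun x => h x * trig sg (freq_dot nu x)).
  by move=> ch; apply: continuous_mulT => //; exact: continuous_trig.
have E := torus_int_lin k (ctr _ cf) (ctr _ cg).
transitivity ((2 * pi) ^- 3 * (k * torus_int (fun x => f x * trig sg (freq_dot nu x)) +
  torus_int (fun x => g x * trig sg (freq_dot nu x)))); last by rewrite mulrDr mulrCA.
by congr (_ * _).
Qed.

Lemma fcoef0 sg nu : fcoef sg nu (fun _ : 'rV[R]_3 => 0 : R) = 0.
Proof.
have c0 : continuous (fun _ : 'rV[R]_3 => 0 : R) by exact: continuous_cstT.
have E := fcoef_lin sg nu (-1) c0 c0.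
have /(congr1 (fcoef sg nu)) E2 : (fun _ : 'rV[R]_3 => -1 * 0 + 0 : R) = fun=> 0.
  by apply/funext => x; rewrite mulr0 addr0.
by apply: etrans (etrans (esym E2) E) _; rewrite mulN1r addNr.
Qed.

Lemma eq_fcoef sg nu f g : f =1 g -> fcoef sg nu f = fcoef sg nu g.
Proof. by move=> fg; congr fcoef; apply/funext. Qed.

Lemma fcoefZ sg nu (k : R) f : continuous f ->
  fcoef sg nu (fun x => k * f x) = k * fcoef sg nu f.
Proof.
move=> cf; have c0 : continuous (fun _ : 'rV[R]_3 => 0 : R) by exact: continuous_cstT.
apply: etrans (etrans (fcoef_lin sg nu k cf c0) _).
  by apply: eq_fcoef => x; rewrite addr0.
by rewrite fcoef0 addr0.
Qed.

Lemma fcoefD sg nu f g : continuous f -> continuous g ->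
  fcoef sg nu (fun x => f x + g x) = fcoef sg nu f + fcoef sg nu g.
Proof.
move=> cf cg; apply: etrans (etrans (fcoef_lin sg nu 1 cf cg) _).
  by apply: eq_fcoef => x; rewrite mul1r.
by congr (_ + _); exact: mul1r.
Qed.

Lemma fcoefB sg nu f g : continuous f -> continuous g ->
  fcoef sg nu (fun x => f x - g x) = fcoef sg nu f - fcoef sg nu g.
Proof.
move=> cf cg; apply: etrans (etrans (fcoef_lin sg nu (-1) cg cf) _).
  by apply: eq_fcoef => x; rewrite mulN1r addrC.
by rewrite [RHS]addrC; congr (_ + _); exact: mulN1r.
Qed.

Lemma fcoef_sum sg nu (I : Type) (r : seq I) (c : I -> R) (F : I -> 'rV[R]_3 -> R) :
  (forall i, continuous (F i)) ->
  fcoef sg nu (fun x => \sum_(i <- r) c i * F i x) = \sum_(i <- r) c i * fcoef sg nu (F i).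
Proof.
move=> cF.
have cS s : continuous (fun x => \sum_(i <- s) c i * F i x).
  elim: s => [|i s IH].
    by under eq_fun do rewrite big_nil; exact: continuous_cstT.
  under eq_fun do rewrite big_cons.
  by apply: continuous_addT => //; apply: continuous_mulT => //; exact: continuous_cstT.
elim: r => [|i r IH].
  rewrite big_nil -[RHS](fcoef0 sg nu).
  by apply: eq_fcoef => x; rewrite big_nil.
rewrite big_cons -IH; apply: etrans (fcoef_lin sg nu (c i) (cF i) (cS r)).
by apply: eq_fcoef => x; rewrite big_cons.
Qed.

(** Integration by parts. This is the real form of the rule that d_i multiplies the n-th coefficient
    by i n_i: cosine and sine coefficients are exchanged, one of them with a sign. *)
Lemma fcoef_partial sg nu i f : smooth_torus f ->
  fcoef sg nu (partial i f) =
  (if sg then 1 else -1) * (nu 0 i)%:~R * fcoef (~~ sg) nu f.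
Proof.
move=> sf; have E := torus_int_trig_partial sg nu i sf.
have cf := smooth_torus_continuous sf.
have cdf := smooth_torus_continuous (smooth_torus_partial i sf).
rewrite torus_int_lin in E; last 2 first.
- by apply: continuous_mulT => //; exact: continuous_trig.
- by apply: continuous_mulT => //; exact: continuous_trig.
rewrite !fcoefE; move: E; move: (torus_int _) (torus_int _) => A B E.
have -> : A = - ((if sg then -1 else 1) * (nu 0 i)%:~R * B) by apply/eqP; rewrite -addr_eq0 addrC E.
by case: sg {E}; ring.
Qed.

Lemma fcoef_bounded f : continuous f ->
  exists2 C : R, 0 <= C & forall sg nu, `|fcoef sg nu f| <= C.
Proof.
move=> cf.
have K : compact (J `*` J `*` J : set (R * R * R)).
  by apply: compact_setX; [apply: compact_setX|]; exact: segment_compact.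
have cK : {within J `*` J `*` J, continuous (fun z : R * R * R => `|f (pt3 z.1.1 z.1.2 z.2)|)}.
  apply: continuous_subspaceT; apply: (continuous_compT (g := fun y : R => `|y|)
    (f := fun z : R * R * R => f (pt3 z.1.1 z.1.2 z.2))); first by cpt3.
  by move=> x; exact: norm_continuous.
have [|z _ zM] := compact_EVT_max _ K cK.
  by exists (0, 0, 0); rewrite /= !in_itv/= lexx J0.
have p0 : 0 < (2 * pi : R) ^+ 3 by rewrite exprn_gt0// mulr_gt0// pi_gt0.
exists (`|f (pt3 z.1.1 z.1.2 z.2)|) => // sg nu; rewrite fcoefE normrM.
rewrite ger0_norm ?invr_ge0 ?(ltW p0)// ler_pdivrMl// mulrC.
apply: normr_torus_int_le; first by apply: continuous_mulT => //; exact: continuous_trig.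
move=> a b c aJ bJ cJ; rewrite normrM.
have tr1 : `|trig sg (freq_dot nu (pt3 a b c))| <= 1.
  by rewrite /trig; case: (sg); rewrite ler_norml ?cos_geN1 ?cos_le1 ?sin_geN1 ?sin_le1.
rewrite (le_trans (ler_pM _ _ (lexx _) tr1))// mulr1.
by apply: (zM (a, b, c)); rewrite inE/= !in_itv/=.
Qed.

(** The operator 1 - Laplacian, of symbol 1 + |n|^2. The factor 1 gives the sum the shape required
    by the lemmas on linear combinations. *)
Definition laplace1 f : 'rV[R]_3 -> R := fun x =>
  f x - \sum_i 1 * partial i (partial i f) x.

Lemma fcoef_partial2 sg nu i f : smooth_torus f ->
  fcoef sg nu (partial i (partial i f)) = - ((nu 0 i)%:~R ^+ 2) * fcoef sg nu f.
Proof.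
move=> sf; rewrite fcoef_partial; last exact: smooth_torus_partial.
by rewrite fcoef_partial// negbK; case: sg => /=; ring.
Qed.

Lemma freq_sqr_ge0 nu : 0 <= freq_sqr nu :> R.
Proof. by apply: sumr_ge0 => i _; exact: sqr_ge0. Qed.

Lemma smooth_laplace1 f : smooth_torus f -> smooth_torus (laplace1 f).
Proof.
move=> sf; rewrite /laplace1; apply: smooth_torusB; first exact: sf.
apply: smooth_torus_sum => i.
by do 2!apply: smooth_torus_partial.
Qed.

Lemma fcoef_laplace1 sg nu f : smooth_torus f ->
  fcoef sg nu (laplace1 f) = (1 + freq_sqr nu) * fcoef sg nu f.
Proof.
move=> sf; have sff i : smooth_torus (partial i (partial i f)).
  by do 2!apply: smooth_torus_partial.
rewrite /laplace1 fcoefB; last first.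
- by apply: smooth_torus_continuous; apply: smooth_torus_sum.
- exact: smooth_torus_continuous.
rewrite fcoef_sum; last by move=> i; exact: smooth_torus_continuous.
have -> : \sum_i 1 * fcoef sg nu (partial i (partial i f)) = - freq_sqr nu * fcoef sg nu f.
  rewrite /freq_sqr -sumrN mulr_suml; apply: eq_bigr => i _.
  by rewrite mul1r (fcoef_partial2 _ _ _ sf).
by set a := fcoef sg nu f; rewrite mulrDl mul1r mulNr opprK.
Qed.

(** Each further power of 1 + |n|^2 is gained by applying the previous bound to (1 - Laplacian) f
    instead of f. *)
Lemma fcoef_rapid f (s : nat) : smooth_torus f ->
  exists2 C : R, 0 <= C & forall sg nu, `|fcoef sg nu f| <= C * (1 + freq_sqr nu) ^- s.
Proof.
elim: s f => [|s IH] f sf.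
  have [C C0 CP] := fcoef_bounded (smooth_torus_continuous sf).
  by exists C => // sg nu; rewrite expr0 invr1 mulr1.
have [C C0 CP] := IH _ (smooth_laplace1 sf); exists C => // sg nu.
have := CP sg nu; rewrite fcoef_laplace1// normrM.
have q0 : 0 < 1 + freq_sqr nu :> R by rewrite ltr_pwDl// freq_sqr_ge0.
rewrite (ger0_norm (ltW q0)) mulrC -ler_pdivlMr// => /le_trans; apply.
by rewrite exprSr invfM mulrA mulrAC.
Qed.

End FourierTheory.

Section FourierParam.
Context {R : realType}.

Lemma is_derive_fcoef sg nu (F dF : R -> 'rV[R]_3 -> R) :
  continuous (fun z : R * 'rV[R]_3 => F z.1 z.2) ->
  continuous (fun z : R * 'rV[R]_3 => dF z.1 z.2) ->
  (forall (s : R) x, is_derive s 1 (fun s => F s x) (dF s x)) ->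
  forall t : R, is_derive t 1 (fun s => fcoef sg nu (F s)) (fcoef sg nu (dF t)).
Proof.
move=> cF cdF FdF t; rewrite fcoefE.
have cT (G : R -> 'rV[R]_3 -> R) : continuous (fun z : R * 'rV[R]_3 => G z.1 z.2) ->
  continuous (fun z : R * R * R * R => G z.1.1.1 (pt3 z.1.1.2 z.1.2 z.2) *
     trig sg (freq_dot nu (pt3 z.1.1.2 z.1.2 z.2))).
  move=> cG; apply: continuous_mulT.
    apply: (continuous_compT (f := fun z : R * R * R * R =>
      (z.1.1.1, pt3 z.1.1.2 z.1.2 z.2)) _ cG).
    apply: continuous_pair; first by ctuple.
    apply: (continuous_compT (f := fun z : R * R * R * R => (z.1.1.2, z.1.2, z.2)) _ (@continuous_pt3 R)).
    by ctuple.
  by apply: (continuous_pt3T (@continuous_trig R sg nu)); ctuple.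
have := @is_derive_int3 R
  (fun s a b c => F s (pt3 a b c) * trig sg (freq_dot nu (pt3 a b c)))
  (fun s a b c => dF s (pt3 a b c) * trig sg (freq_dot nu (pt3 a b c)))
  (cT _ cF) (cT _ cdF).
have dM (s a b c : R) : is_derive s 1
  (fun s => F s (pt3 a b c) * trig sg (freq_dot nu (pt3 a b c)))
  (dF s (pt3 a b c) * trig sg (freq_dot nu (pt3 a b c))).
  have H := FdF s (pt3 a b c).
  by apply: is_derive_eq; rewrite /GRing.scale/=; ring.
move=> /(_ dM t) H.
rewrite torus_intE.
have -> : (fun s => fcoef sg nu (F s)) =
  (2 * pi) ^- 3 \*: (fun s => int3 (fun a b c => F s (pt3 a b c) * trig sg (freq_dot nu (pt3 a b c)))).
  by apply/funext => s; rewrite fcoefE torus_intE.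
by apply: is_derive_eq.
Qed.

End FourierParam.

(** * Summability over the frequency lattice; Sobolev norms against coefficient bounds *)

Section LatticeSums.
Context {R : realType}.

(** A bounded discrete primitive: its increments dominate 1 / (1 + k^2), so the sums below
    telescope. *)
Let stairs (k : int) : R := 4 * k%:~R / (1 + `|k%:~R|).

Let stairs_bound k : `|stairs k| <= 4.
Proof.
rewrite /stairs normrM normfV normrM normr_nat.
have h : 0 < 1 + `|k%:~R| :> R by rewrite ltr_wpDr.
by rewrite (gtr0_norm h) ler_pdivrMr// ler_pM2l// lerDr.
Qed.

Let stairs_step (k : int) : (1 + (k%:~R : R) ^+ 2)^-1 <= stairs (k + 1) - stairs k.
Proof.
rewrite /stairs intrD mulr1z; set x : R := k%:~R.
have q0 : 0 < 1 + x ^+ 2 by rewrite ltr_wpDr// sqr_ge0.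
have : 0 <= x \/ x <= -1.
  have [k0|k0] := lerP 0 k; [left|right]; first by rewrite /x ler0z.
  have k1 : k <= -1 by lia.
  by move: k1; rewrite -(ler_int R) mulrN1z.
move: x q0 => {k} x q0 [] x0.
  rewrite (ger0_norm x0) ger0_norm; last by lra.
  rewrite (_ : _ - _ = 4 / ((1 + (x + 1)) * (1 + x))); last first.
    by field; rewrite !gt_eqF//; lra.
  rewrite ler_pdivlMr; last by apply: mulr_gt0; lra.
  rewrite mulrC ler_pdivrMr//; nra.
rewrite (ler0_norm (_ : x <= 0)); last by lra.
rewrite ler0_norm; last by lra.
rewrite (_ : _ - _ = 4 / ((1 - (x + 1)) * (1 - x))); last first.
  by field; rewrite !gt_eqF//; lra.
rewrite ler_pdivlMr; last by apply: mulr_gt0; lra.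
rewrite mulrC ler_pdivrMr//; nra.
Qed.

Lemma sum_inv_sqr_le (N n : nat) :
  \sum_(j < n) (1 + ((j%:Z - N%:Z)%:~R : R) ^+ 2)^-1 <= 8.
Proof.
have : \sum_(j < n) (1 + ((j%:Z - N%:Z)%:~R : R) ^+ 2)^-1 <= stairs (n%:Z - N%:Z) - stairs (- N%:Z).
  elim: n => [|n IH]; first by rewrite big_ord0 sub0r subrr.
  rewrite big_ord_recr/= (le_trans (lerD IH (stairs_step _)))//.
  by rewrite addrC addrA subrK (_ : n%:Z - N%:Z + 1 = n.+1%:Z - N%:Z)// -addn1 PoszD; ring.
move/le_trans; apply; have := stairs_bound (n%:Z - N%:Z); have := stairs_bound (- N%:Z).
rewrite !ler_norml => /andP[? ?] /andP[? ?]; lra.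
Qed.

(** Since (1 + |n|^2)^3 is at least the product of the 1 + n_i^2, the sum over a box containing [s]
    is bounded by the cube of a one-dimensional sum. *)
Lemma sum_freq_le (s : seq 'rV[int]_3) : uniq s ->
  \sum_(nu <- s) ((1 + freq_sqr nu : R) ^+ 3)^-1 <= 8 ^+ 3.
Proof.
move=> us.
pose w (k : int) : R := (1 + (k%:~R) ^+ 2)^-1.
have w0 k : 0 <= w k by rewrite invr_ge0 addr_ge0// sqr_ge0.
pose N : nat := (\max_(nu <- s) \max_(i < 3) absz (nu 0%R i))%N.
have Nle (nu : 'rV[int]_3) (i : 'I_3) : nu \in s -> (absz (nu 0%R i) <= N)%N.
  move=> nus; rewrite /N (big_rem _ nus)/= leq_max; apply/orP; left.
  exact: (@leq_bigmax _ (fun i => absz (nu 0%R i)) i).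
(* Shifting by [N] embeds the box [-N, N]^3 into a finite function type, over which a product of
   sums expands. *)
pose phi (nu : 'rV[int]_3) : {ffun 'I_3 -> 'I_(N + N).+1} :=
  [ffun i => inord (absz (nu 0%R i + N%:Z))].
have phiE (nu : 'rV[int]_3) (i : 'I_3) : nu \in s -> (phi nu i : nat)%:Z - N%:Z = nu 0 i.
  move=> nus; have := Nle nu i nus => h.
  rewrite ffunE inordK; lia.
pose G (f : {ffun 'I_3 -> 'I_(N + N).+1}) : R := \prod_i w ((f i : nat)%:Z - N%:Z).
have le1 nu : nu \in s -> ((1 + freq_sqr nu : R) ^+ 3)^-1 <= G (phi nu).
  move=> nus; rewrite /G (eq_bigr (fun i => w (nu 0 i))); last by move=> i _; rewrite phiE.
  rewrite /w prodfV lef_pV2 ?posrE; last 2 first.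
  - by rewrite exprn_gt0// ltr_pwDl// freq_sqr_ge0.
  - by apply: prodr_gt0 => i _; rewrite ltr_pwDl// sqr_ge0.
  rewrite -[X in _ ^+ X]card_ord -prodr_const; apply: ler_prod => i _.
  rewrite addr_ge0 ?sqr_ge0//= lerD2l /freq_sqr (bigD1 i)//= lerDl.
  by apply: sumr_ge0 => j _; exact: sqr_ge0.
rewrite big_seq (le_trans (ler_sum _ le1))// -big_seq.
have uphi : uniq (map phi s).
  rewrite map_inj_in_uniq// => x y xs ys e; apply/rowP => i.
  by rewrite -(phiE x)// -(phiE y)// e.
rewrite -(big_map phi predT G) big_uniq//= (le_trans (_ : _ <= \sum_f G f))//.
  rewrite [leRHS](bigID (mem (map phi s)))/= lerDl.
  by apply: sumr_ge0 => f _; apply: prodr_ge0.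
rewrite /G -(bigA_distr_bigA (fun (i : 'I_3) (j : 'I_(N + N).+1) => w ((j : nat)%:Z - N%:Z))).
rewrite -[X in _ <= _ ^+ X]card_ord -prodr_const; apply: ler_prod => i _.
by rewrite sumr_ge0//= sum_inv_sqr_le.
Qed.

End LatticeSums.

Section SobolevFourier.
Context {R : realType}.

Lemma freq_gt0 (nu : 'rV[int]_3) : 0 < 1 + freq_sqr nu :> R.
Proof. by rewrite ltr_pwDl// freq_sqr_ge0. Qed.

Lemma fourier_sqr_ge0 (f : 'rV[R]_3 -> R) nu : 0 <= fourier_sqr f nu.
Proof. by rewrite fourier_sqrE addr_ge0// sqr_ge0. Qed.

(** A single term of a sum of nonnegative terms is at most the sum. The Sobolev index 2s makes the
    weight the square of (1 + |n|^2)^s. *)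
Lemma sobolev_norm_fcoef m (u : 'rV[R]_3 -> 'cV[R]_m) (s : nat) (C : R) : 0 <= C ->
  (sobolev_norm (2 * s)%:R u <= C%:E)%E ->
  forall k sg nu, `|fcoef sg nu (fun x => u x k 0)| <= C * (1 + freq_sqr nu) ^- s.
Proof.
move=> C0; rewrite /sobolev_norm (_ : C%:E = sqrte (C ^+ 2)%:E); last first.
  by rewrite /sqrte/= sqrtr_sqr ger0_norm.
rewrite lee_sqrt ?lee_fin ?sqr_ge0// => H k sg nu.
have q0 := freq_gt0 nu.
rewrite ler_pdivlMr ?exprn_gt0// -ler_sqr ?nnegrE ?mulr_ge0 ?exprn_ge0 ?(ltW q0)//.
rewrite -lee_fin; apply: le_trans H; apply: esum_ge; exists [set nu].
  by split; [exact: finite_set1|exact: subsetT].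
rewrite fsbig_set1 lee_fin powR_mulrn ?(ltW q0)// exprMn real_normK ?num_real//.
rewrite -exprM mulnC mulrC ler_pM2l ?exprn_gt0// (bigD1 k)//= fourier_sqrE.
rewrite -[leLHS]addr0 lerD ?sumr_ge0//; last by move=> j _; exact: fourier_sqr_ge0.
by case: sg; [rewrite lerDl|rewrite lerDr]; exact: sqr_ge0.
Qed.

(** [M] and [A] are chosen before [u], so that applying the bound at every time tau gives constants
    uniform in tau. The margin 3 in [M] pays for summability over Z^3. *)
Lemma fcoef_sobolev_norm m (s : R) : exists (M : nat) (A : R), 0 <= A /\
  forall (u : 'rV[R]_3 -> 'cV[R]_m) (C : R), 0 <= C ->
  (forall k sg nu, `|fcoef sg nu (fun x => u x k 0)| <= C * (1 + freq_sqr nu) ^- M) ->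
  (sobolev_norm s u <= (A * C)%:E)%E.
Proof.
pose S := Num.truncn `|s|; pose M := (S.+1 + 3)%N.
pose B : R := 2 * m%:R * 8 ^+ 3.
have B0 : 0 <= B by rewrite !mulr_ge0.
exists M, (Num.sqrt B); split; first exact: sqrtr_ge0.
move=> u C C0 H.
rewrite /sobolev_norm (_ : (Num.sqrt B * C)%:E = sqrte (B * C ^+ 2)%:E); last first.
  by rewrite /sqrte/= [in RHS]sqrtrM// sqrtr_sqr ger0_norm.
rewrite lee_sqrt ?lee_fin ?mulr_ge0 ?sqr_ge0//.
apply: ge_ereal_sup => _ [X [finX _]] <-.
rewrite fsbig_finite//= sumEFin lee_fin.
pose K : R := 2 * m%:R * C ^+ 2.
have K0 : 0 <= K by rewrite !mulr_ge0.
rewrite (@le_trans _ _ (\sum_(nu <- finmap.enum_fset (fset_set X)) K * ((1 + freq_sqr nu : R) ^+ 3)^-1))//.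
  apply: ler_sum => nu _; have q0 := freq_gt0 nu.
  have q1 : 1 <= 1 + freq_sqr nu :> R by rewrite lerDl freq_sqr_ge0.
  set q : R := 1 + freq_sqr nu.
  have sl : q `^ s <= q ^+ S.+1.
    rewrite -powR_mulrn ?(ltW q0)// ler_powR// (le_trans (ler_norm _))//.
    by rewrite ltW// truncnS_gt.
  have cl k : fourier_sqr (fun x => u x k 0) nu <= 2 * C ^+ 2 * (q ^- M) ^+ 2.
    rewrite fourier_sqrE.
    have h sg : fcoef sg nu (fun x => u x k 0) ^+ 2 <= C ^+ 2 * (q ^- M) ^+ 2.
      rewrite -exprMn -real_normK ?num_real// ler_sqr ?nnegrE ?mulr_ge0 ?invr_ge0 ?exprn_ge0 ?(ltW q0)//.
    by rewrite (le_trans (lerD (h true) (h false)))//; lra.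
  rewrite (@le_trans _ _ (q ^+ S.+1 * (m%:R * (2 * C ^+ 2 * (q ^- M) ^+ 2))))//.
    apply: ler_pM => //; first exact: powR_ge0.
      by apply: sumr_ge0 => k _; exact: fourier_sqr_ge0.
    rewrite (le_trans (ler_sum _ (fun k _ => cl k)))// sumr_const card_ord -[leLHS]mulr_natl.
    by [].
  rewrite /M exprD.
  set P := q ^+ S.+1; set Q := q ^+ 3.
  have P1 : 1 <= P by rewrite exprn_ege1.
  have Q1 : 1 <= Q by rewrite exprn_ege1.
  have P0 : 0 < P by lra.
  have Q0 : 0 < Q by lra.
  rewrite (_ : P * _ = K * Q^-1 * (P * Q)^-1); last by rewrite /K; field; rewrite !gt_eqF.
  rewrite ler_piMr ?mulr_ge0 ?invr_ge0 ?(ltW Q0)//.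
  by rewrite invf_le1 ?mulr_gt0// mulr_ege1.
rewrite -mulr_sumr (_ : B * C ^+ 2 = K * 8 ^+ 3); last by rewrite /B /K; ring.
by rewrite ler_wpM2l// sum_freq_le// finmap.fset_uniq.
Qed.

End SobolevFourier.

(** * The eigenbasis of A_oo *)

Section Eigenbasis.
Context {R : realType}.
Variable p : 'I_3 -> R.
Hypothesis p4_neq0 : forall mu, p4 p mu != 0.

Local Notation K := ('I_4 * bool)%type.

Definition up (X : 'cV[R]_8) (mu : 'I_4) : R := (usubmx (X : 'cV[R]_(4 + 4))) mu 0.
Definition dn (X : 'cV[R]_8) (mu : 'I_4) : R := (dsubmx (X : 'cV[R]_(4 + 4))) mu 0.

Definition sgn (b : bool) : R := if b then 1 else -1.

(** Solution of the 2 x 2 system [up] = c_+ + c_-, [dn] = lambda_+ c_+ + lambda_- c_- attached to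
    the index mu, with lambda_+ - lambda_- = 2 p_mu in the denominator. *)
Definition ecoord (k : K) (X : 'cV[R]_8) : R :=
  sgn k.2 / (2 * p4 p k.1) * (dn X k.1 - eigval p (k.1, ~~ k.2) * up X k.1).

Lemma up_lin a X Y mu : up (a *: X + Y) mu = a * up X mu + up Y mu.
Proof. by rewrite /up linearP !mxE. Qed.

Lemma dn_lin a X Y mu : dn (a *: X + Y) mu = a * dn X mu + dn Y mu.
Proof. by rewrite /dn linearP !mxE. Qed.

Lemma eq_updn X Y : up X =1 up Y -> dn X =1 dn Y -> X = Y.
Proof.
move=> u d.
have eu : usubmx (X : 'cV[R]_(4 + 4)) = usubmx (Y : 'cV[R]_(4 + 4)) by apply/colP => i; exact: u.
have ed : dsubmx (X : 'cV[R]_(4 + 4)) = dsubmx (Y : 'cV[R]_(4 + 4)) by apply/colP => i; exact: d.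
have HX := @vsubmxK R 4 4 1 X; rewrite eu ed in HX.
exact: etrans (esym HX) (@vsubmxK R 4 4 1 Y).
Qed.

Lemma ecoord_lin k a X Y : ecoord k (a *: X + Y) = a * ecoord k X + ecoord k Y.
Proof. by rewrite /ecoord up_lin dn_lin; ring. Qed.

Lemma ecoord0 k : ecoord k 0 = 0.
Proof. by rewrite /ecoord /up /dn !linear0 !mxE mulr0 subr0 mulr0. Qed.

Lemma ecoordD k X Y : ecoord k (X + Y) = ecoord k X + ecoord k Y.
Proof. by have := ecoord_lin k 1 X Y; rewrite scale1r mul1r. Qed.

Lemma ecoordZ k a X : ecoord k (a *: X) = a * ecoord k X.
Proof. by have := ecoord_lin k a X 0; rewrite !addr0 ecoord0 addr0. Qed.

Lemma ecoordB k X Y : ecoord k (X - Y) = ecoord k X - ecoord k Y.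
Proof. by rewrite -[- Y]scaleN1r addrC ecoord_lin mulN1r addrC. Qed.

Lemma ecoord_sum k I (r : seq I) (P : pred I) F :
  ecoord k (\sum_(i <- r | P i) F i) = \sum_(i <- r | P i) ecoord k (F i).
Proof. by rewrite (big_morph _ (ecoordD k) (ecoord0 k)). Qed.

Lemma up_eigvec k mu : up (eigvec p k) mu = (mu == k.1)%:R.
Proof. by rewrite /up /eigvec col_mxKu !mxE eqxx andbT. Qed.

Lemma dn_eigvec k mu : dn (eigvec p k) mu = eigval p k * (mu == k.1)%:R.
Proof. by rewrite /dn /eigvec col_mxKd !mxE eqxx andbT. Qed.

Lemma sum_K (F : K -> R) : \sum_k F k = \sum_mu (F (mu, true) + F (mu, false)).
Proof.
rewrite (eq_bigr (fun mu => \sum_b F (mu, b))); last by move=> mu _; rewrite big_bool.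
by rewrite pair_big/=; apply: eq_bigr => -[].
Qed.

Lemma ecoord_eigvec k k' : ecoord k (eigvec p k') = (k == k')%:R.
Proof.
case: k k' => [mu b] [nu c]; rewrite /ecoord up_eigvec dn_eigvec /= xpair_eqE.
have [->|] /= := eqVneq mu nu; last by rewrite !mulr0 subr0 mulr0.
have h := p4_neq0 nu.
by case: b c => -[]; rewrite /eigval /sgn /=; field; exact: h.
Qed.

Lemma up_sum I (r : seq I) (P : pred I) (F : I -> 'cV[R]_8) mu :
  up (\sum_(i <- r | P i) F i) mu = \sum_(i <- r | P i) up (F i) mu.
Proof.
have D X Y : up (X + Y) mu = up X mu + up Y mu.
  by have := up_lin 1 X Y mu; rewrite scale1r mul1r.
by rewrite (big_morph _ D (_ : up 0 mu = 0))// /up linear0 mxE.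
Qed.

Lemma dn_sum I (r : seq I) (P : pred I) (F : I -> 'cV[R]_8) mu :
  dn (\sum_(i <- r | P i) F i) mu = \sum_(i <- r | P i) dn (F i) mu.
Proof.
have D X Y : dn (X + Y) mu = dn X mu + dn Y mu.
  by have := dn_lin 1 X Y mu; rewrite scale1r mul1r.
by rewrite (big_morph _ D (_ : dn 0 mu = 0))// /dn linear0 mxE.
Qed.

Lemma upZ a X mu : up (a *: X) mu = a * up X mu.
Proof. by rewrite /up linearZ mxE. Qed.

Lemma dnZ a X mu : dn (a *: X) mu = a * dn X mu.
Proof. by rewrite /dn linearZ mxE. Qed.

Lemma up_ecoord X mu : up X mu = ecoord (mu, true) X + ecoord (mu, false) X.
Proof.
have h := p4_neq0 mu; rewrite /ecoord /eigval /sgn /=; field; exact: h.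
Qed.

Lemma dn_ecoord X mu : dn X mu = eigval p (mu, true) * ecoord (mu, true) X +
  eigval p (mu, false) * ecoord (mu, false) X.
Proof.
have h := p4_neq0 mu; rewrite /ecoord /eigval /sgn /=; field; exact: h.
Qed.

Lemma ecoord_decomp X : X = \sum_k ecoord k X *: eigvec p k.
Proof.
apply: eq_updn => mu; rewrite ?up_sum ?dn_sum.
  rewrite sum_K (bigD1 mu)//= !upZ !up_eigvec eqxx !mulr1 big1 ?addr0 ?up_ecoord//.
  by move=> nu /negPf nm; rewrite !upZ !up_eigvec /= eq_sym nm !mulr0 addr0.
rewrite sum_K (bigD1 mu)//= !dnZ !dn_eigvec eqxx !mulr1 big1 ?addr0 ?dn_ecoord.
  by rewrite ![ecoord _ _ * _]mulrC.
by move=> nu /negPf nm; rewrite !dnZ !dn_eigvec /= eq_sym nm !mulr0 addr0.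
Qed.

Lemma A_infty_mul (X : 'cV[R]_(4 + 4)) : (A_infty p *m X : 'cV[R]_(4 + 4)) =
  col_mx (dsubmx X) (- diag_mx (\row_mu (1 - p4 p mu ^+ 2)) *m usubmx X + (- 2)%:M *m dsubmx X).
Proof.
have := @mul_block_col R 4 4 4 4 1 0 1%:M (- diag_mx (\row_mu (1 - p4 p mu ^+ 2))) (- 2)%:M
  (usubmx X) (dsubmx X).
by rewrite vsubmxK mul0mx add0r mul1mx.
Qed.

Lemma up_A X mu : up (A_infty p *m X) mu = dn X mu.
Proof. by rewrite /up A_infty_mul col_mxKu. Qed.

Lemma dn_A X mu : dn (A_infty p *m X) mu = - (1 - p4 p mu ^+ 2) * up X mu - 2 * dn X mu.
Proof.
rewrite /dn A_infty_mul col_mxKd mxE mulNmx mul_diag_mx mul_scalar_mx !mxE.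
by rewrite /up /dn !mxE mulNr; congr (_ + _); rewrite mulNr.
Qed.

Lemma ecoord_A k X : ecoord k (A_infty p *m X) = eigval p k * ecoord k X.
Proof.
have h := p4_neq0 k.1.
rewrite /ecoord up_A dn_A; case: k h => mu [] /= h; rewrite /eigval /sgn /=; field; exact: h.
Qed.

Lemma A_eigvec k : A_infty p *m eigvec p k = eigval p k *: eigvec p k.
Proof.
rewrite [LHS]ecoord_decomp [RHS]ecoord_decomp; apply: eq_bigr => k' _.
rewrite ecoord_A ecoordZ ecoord_eigvec.
by case: eqP => [->|]; rewrite ?mulr0.
Qed.

(** The dual basis as row vectors. These are left eigenvectors of [A_infty], so that vanishing of a
    coordinate on a sum of eigenspaces becomes vanishing of a matrix product. *)
Definition erow (k : K) : 'rV[R]_8 := \row_i ecoord k (delta_mx i 0).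

Lemma erowE k X : (erow k *m X) 0 0 = ecoord k X.
Proof.
have EX : X = \sum_i X i 0 *: delta_mx i 0.
  by rewrite {1}(matrix_sum_delta X); apply: eq_bigr => i _; rewrite big_ord1.
transitivity (ecoord k (\sum_i X i 0 *: delta_mx i 0)); last by rewrite -EX.
by rewrite mxE ecoord_sum; apply: eq_bigr => i _; rewrite ecoordZ !mxE mulrC.
Qed.

Lemma eigvec_erow_sum : \sum_k eigvec p k *m erow k = 1%:M.
Proof.
apply/matrixP => i j.
have := congr1 (fun X : 'cV[R]_8 => X i 0) (ecoord_decomp (delta_mx j 0)).
rewrite !mxE eqxx andbT => ->; rewrite !summxE; apply: eq_bigr => k _.
by rewrite !mxE big_ord1 !mxE mulrC.
Qed.

Lemma A_infty_pow (tau : R) n : (tau *: A_infty p) ^+ n =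
  \sum_k (tau * eigval p k) ^+ n *: (eigvec p k *m erow k).
Proof.
have E k : (tau *: A_infty p) ^+ n *m eigvec p k = (tau * eigval p k) ^+ n *: eigvec p k.
  elim: n => [|n IH]; first by rewrite !expr0 scale1r mul1mx.
  rewrite exprSr -mulmxA -scalemxAl A_eigvec scalerA -scalemxAr IH scalerA.
  by rewrite exprS.
rewrite -[LHS]mulmx1 -eigvec_erow_sum mulmx_sumr; apply: eq_bigr => k _.
by rewrite mulmxA E scalemxAl.
Qed.

(** The partial sums are diagonal in the eigenbasis, which reduces convergence to that of the scalar
    exponential series. *)
Lemma expmx_A_infty (tau : R) :
  expmx (tau *: A_infty p) = \sum_k expR (tau * eigval p k) *: (eigvec p k *m erow k).
Proof.
rewrite /expmx; apply/cvg_lim; first exact: norm_hausdorff.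
have -> : series (fun k => (k`!%:R)^-1 *: (tau *: A_infty p) ^+ k) =
   fun n => \sum_k series (exp_coeff (tau * eigval p k)) n *: (eigvec p k *m erow k).
  apply/funext => n; rewrite /series /=.
  under eq_bigr do rewrite A_infty_pow scaler_sumr.
  rewrite exchange_big/=; apply: eq_bigr => k _.
  rewrite scaler_suml; apply: eq_bigr => i _.
  by rewrite scalerA /exp_coeff mulrC.
apply: cvg_big_sum => k; apply: cvgZr_tmp.
exact: is_cvg_series_exp_coeff.
Qed.

Lemma ecoord_expmx k (tau : R) X :
  ecoord k (expmx (tau *: A_infty p) *m X) = expR (tau * eigval p k) * ecoord k X.
Proof.
rewrite expmx_A_infty mulmx_suml ecoord_sum (bigD1 k)//= big1 ?addr0.
  rewrite -scalemxAl ecoordZ -mulmxA [erow k *m X]mx11_scalar mul_mx_scalar erowE.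
  by rewrite ecoordZ ecoord_eigvec eqxx mulr1.
move=> k' kk'.
rewrite -scalemxAl ecoordZ -mulmxA [erow k' *m X]mx11_scalar mul_mx_scalar.
by rewrite ecoordZ ecoord_eigvec eq_sym (negPf kk') !mulr0.
Qed.

Definition in_window (n : nat) (k : K) : bool :=
  (- (n%:R * (1 - p ord_max)) < eigval p k) && (eigval p k <= - (n.-1%:R * (1 - p ord_max))).

(** Moving A from one side of the pairing to the other multiplies it by [a] or by [eigval p k], so
    it vanishes when these differ. *)
Lemma eigenspace_erow a k : a != eigval p k -> eigenspace (A_infty p)^T a *m (erow k)^T = 0.
Proof.
move=> ak.
have AE : (A_infty p)^T *m (erow k)^T = eigval p k *: (erow k)^T.
  rewrite -trmx_mul -linearZ /=; congr trmx; apply/rowP => i.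
  have := ecoord_A k (delta_mx i 0); rewrite -erowE mulmxA -colE !mxE => ->.
  by rewrite -erowE -colE !mxE.
have /eigenspaceP EA : (eigenspace (A_infty p)^T a <= eigenspace (A_infty p)^T a)%MS by [].
have : a *: (eigenspace (A_infty p)^T a *m (erow k)^T) =
       eigval p k *: (eigenspace (A_infty p)^T a *m (erow k)^T).
  by rewrite scalemxAl -EA -mulmxA AE scalemxAr.
move/eqP; rewrite -subr_eq0 -scalerBl scaler_eq0 subr_eq0 (negPf ak) /=.
by move/eqP.
Qed.

Lemma E_space_erow n k : ~~ in_window n k -> E_space p n *m (erow k)^T = 0.
Proof.
move=> nk; apply/sub_kermxP; apply/sumsmx_subP => k' k'n; apply/sub_kermxP.
apply: eigenspace_erow; apply: contra nk => /eqP e.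
by rewrite /in_window -e.
Qed.

Lemma ecoord_tr k (X : 'cV[R]_8) : ecoord k X = (X^T *m (erow k)^T) 0 0.
Proof. by rewrite -erowE -trmx_mul [RHS]mxE. Qed.

Lemma in_E_upto_ecoord n X k : in_E_upto p n X ->
  (forall m, (1 <= m <= n)%N -> ~~ in_window m k) -> ecoord k X = 0.
Proof.
move=> XE nk; rewrite ecoord_tr.
suff /sub_kermxP -> : (X^T <= kermx (erow k)^T)%MS by rewrite mxE.
apply: submx_trans XE _.
rewrite big_seq; apply: (big_ind (fun M : 'M[R]_8 => (M <= kermx (erow k)^T)%MS)).
- exact: sub0mx.
- by move=> M N hM hN; rewrite addsmx_sub hM.
move=> m; rewrite mem_index_iota ltnS => mn.
by apply/sub_kermxP/E_space_erow/nk.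
Qed.

(** The first two hypotheses say that the windows cover all eigenvectors and that k lies in only
    one. Hence X splits along [U] and [V], and coordinate k annihilates [V] if k is in window n, and
    [U] otherwise. *)
Lemma ecoord_E_proj calN n X k :
  (forall k', exists2 m, (1 <= m <= calN)%N & in_window m k') ->
  (forall m m', (0 < m)%N -> (0 < m')%N -> in_window m k -> in_window m' k -> m = m') ->
  (1 <= n <= calN)%N ->
  ecoord k (E_proj p calN n X) = if in_window n k then ecoord k X else 0.
Proof.
move=> cov uni nN; rewrite !ecoord_tr /E_proj trmxK.
set U := E_space p n; set V := (\sum_(1 <= m < calN.+1 | m != n) E_space p m)%MS.
have full : (X^T <= U + V)%MS.
  rewrite (ecoord_decomp X) linear_sum/=; apply: summx_sub => k' _.
  rewrite linearZ/=; apply: scalemx_sub.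
  have [m mN mk] := cov k'.
  have km : ((eigvec p k')^T <= E_space p m)%MS.
    apply: submx_trans (sumsmx_sup k' mk (submx_refl _)).
    by apply/eigenspaceP; rewrite -trmx_mul A_eigvec linearZ.
  have [mn|mn] := eqVneq m n.
    by apply: submx_trans km _; rewrite mn addsmxSl.
  apply: submx_trans km (submx_trans _ (addsmxSr _ _)).
  rewrite /V big_mkcond (bigD1_seq m) ?iota_uniq//= ?mn; first exact: addsmxSl.
  by rewrite mem_index_iota ltnS.
have aU : (X^T *m proj_mx U V <= U)%MS := proj_mx_sub _ _ _.
have bV : (X^T - X^T *m proj_mx U V <= V)%MS := proj_mx_compl_sub full.
case: ifPn => kn; last first.
  suff /sub_kermxP -> : (X^T *m proj_mx U V <= kermx (erow k)^T)%MS by rewrite mxE.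
  by apply: submx_trans aU _; apply/sub_kermxP/E_space_erow.
have : (X^T - X^T *m proj_mx U V <= kermx (erow k)^T)%MS.
  apply: submx_trans bV _; rewrite /V big_seq_cond.
  apply: (big_ind (fun M : 'M[R]_8 => (M <= kermx (erow k)^T)%MS)).
  - exact: sub0mx.
  - by move=> M N hM hN; rewrite addsmx_sub hM.
  move=> m; rewrite mem_index_iota ltnS => /andP[/andP[m0 _] mn].
  apply/sub_kermxP/E_space_erow/negP => mk.
  by move/eqP: mn; apply; apply: uni => //; case/andP: nN.
move/sub_kermxP; rewrite mulmxBl => /(congr1 (fun M : 'M[R]_(1, 1) => M 0 0)).
by rewrite [LHS]mxE [X in _ + X]mxE [RHS]mxE => /eqP; rewrite subr_eq0 => /eqP.
Qed.

End Eigenbasis.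

(** * Exponential polynomials *)

Section ExpPolynomials.
Context {R : realType}.

(* Stands for the term [xc * tau ^ xj * exp (- xe * tau) * d_xl (f xi)], where [f]
   is a family of functions on the torus. *)
Record xterm (I : Type) : Type :=
  XTerm { xe : R; xj : nat; xc : R; xi : I; xl : seq 'I_3 }.

Variable I : Type.
Implicit Types (X Y : seq (xterm I)) (Phi : I -> seq 'I_3 -> R) (t : xterm I).

Definition xcoef t (tau : R) : R := xc t * (tau ^+ xj t * expR (- xe t * tau)).

(* [Phi i l] is the value of [d_l (f i)] at a point, or its Fourier coefficient. *)
Definition xval Phi X (tau : R) : R := \sum_(t <- X) xcoef t tau * Phi (xi t) (xl t).

Lemma xval_nil Phi tau : xval Phi [::] tau = 0.
Proof. by rewrite /xval big_nil. Qed.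

Lemma xval_cons Phi t X tau :
  xval Phi (t :: X) tau = xcoef t tau * Phi (xi t) (xl t) + xval Phi X tau.
Proof. by rewrite /xval big_cons. Qed.

Lemma xval_cat Phi X Y tau : xval Phi (X ++ Y) tau = xval Phi X tau + xval Phi Y tau.
Proof. by rewrite /xval big_cat. Qed.

Lemma xval_flatten Phi (T : Type) (s : seq T) (F : T -> seq (xterm I)) tau :
  xval Phi (flatten [seq F x | x <- s]) tau = \sum_(x <- s) xval Phi (F x) tau.
Proof.
elim: s => [|x s IH] /=; first by rewrite xval_nil big_nil.
by rewrite xval_cat IH big_cons.
Qed.

Definition xscale (r : R) X := [seq XTerm (xe t) (xj t) (r * xc t) (xi t) (xl t) | t <- X].
Definition xshift (e : R) X := [seq XTerm (e + xe t) (xj t) (xc t) (xi t) (xl t) | t <- X].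
Definition xdiff (i : 'I_3) X := [seq XTerm (xe t) (xj t) (xc t) (xi t) (i :: xl t) | t <- X].

Lemma xval_scale Phi r X tau : xval Phi (xscale r X) tau = r * xval Phi X tau.
Proof.
rewrite /xval big_map mulr_sumr; apply: eq_bigr => t _.
by rewrite /xcoef /=; ring.
Qed.

Lemma xval_shift Phi e X tau : xval Phi (xshift e X) tau = expR (- e * tau) * xval Phi X tau.
Proof.
rewrite /xval big_map mulr_sumr; apply: eq_bigr => t _.
by rewrite /xcoef /= opprD mulrDl expRD; ring.
Qed.

Lemma xval_diff Phi i X tau :
  xval Phi (xdiff i X) tau = xval (fun k l => Phi k (i :: l)) X tau.
Proof. by rewrite /xval big_map. Qed.

(* The solution [h] of [h' = lam * h + c * tau ^ j * exp (- e * tau)] of the form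
   polynomial times [exp (- e * tau)]; at resonance [e = - lam] the polynomial has no
   constant term. *)
Fixpoint xsolve_poly (lam e : R) (i : I) (l : seq 'I_3) (c : R) (j : nat) : seq (xterm I) :=
  XTerm e j (- c / (e + lam)) i l ::
  if j is j'.+1 then xsolve_poly lam e i l (c * j%:R / (e + lam)) j' else [::].

Definition xsolve1 (lam : R) t : seq (xterm I) :=
  if xe t + lam == 0 then [:: XTerm (xe t) (xj t).+1 (xc t / (xj t).+1%:R) (xi t) (xl t)]
  else xsolve_poly lam (xe t) (xi t) (xl t) (xc t) (xj t).

Definition xsolve (lam : R) X := flatten [seq xsolve1 lam t | t <- X].

Lemma is_derive_xcoef t (tau : R) : is_derive tau 1 (xcoef t)
  (xc t * ((xj t)%:R * tau ^+ (xj t).-1 * expR (- xe t * tau)) - xe t * xcoef t tau).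
Proof.
rewrite /xcoef.
have D1 : is_derive tau 1 (fun s : R => s ^+ xj t) ((xj t)%:R * tau ^+ (xj t).-1).
  have -> : (fun s : R => s ^+ xj t) = (fun s : R => s) ^+ xj t by apply/funext => s; rewrite fctE.
  by apply: is_derive_eq; rewrite /GRing.scale/= mulr1 mulr_natl.
have D2 : is_derive tau 1 (fun s : R => expR (- xe t * s)) (expR (- xe t * tau) * - xe t).
  have D0 : is_derive tau 1 (fun s : R => - xe t * s) (- xe t).
    by apply: is_derive_eq; rewrite /GRing.scale/= mulr1.
  exact: (@is_derive1_comp R expR (fun s => - xe t * s)).
by apply: is_derive_eq; rewrite /GRing.scale/=; ring.
Qed.

Lemma is_derive_bigsum (T : Type) (s : seq T) (f : T -> R -> R) (df : T -> R) (tau : R) :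
  (forall x, is_derive tau 1 (f x) (df x)) ->
  is_derive tau 1 (fun r => \sum_(x <- s) f x r) (\sum_(x <- s) df x).
Proof.
move=> fdf; elim: s => [|x s IH].
  rewrite big_nil (_ : (fun _ => _) = cst 0); first exact: is_derive_cst.
  by apply/funext => r; rewrite big_nil.
rewrite big_cons (_ : (fun _ => _) = f x + (fun r => \sum_(x <- s) f x r)).
  exact: is_deriveD.
by apply/funext => r; rewrite big_cons fctE.
Qed.

Lemma is_derive_xval_ex Phi X (tau : R) : exists d, is_derive tau 1 (xval Phi X) d.
Proof.
eexists; apply: (@is_derive_bigsum _ X (fun t r => xcoef t r * Phi (xi t) (xl t))) => t.
have := is_derive_xcoef t tau => D.
rewrite (_ : (fun r => xcoef t r * _) = Phi (xi t) (xl t) \*: xcoef t).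
  exact: is_deriveZ.
by apply/funext => r; rewrite /= mulrC.
Qed.

(** Away from resonance the coefficients are found from the top power downwards: - c / (e + lam)
    tau^j reproduces the source up to a term in tau^(j-1), which is the source of the recursive
    call. At resonance the exponentials cancel and tau^j is merely integrated. *)
Lemma is_derive_xsolve1 Phi lam t (tau : R) :
  is_derive tau 1 (xval Phi (xsolve1 lam t))
    (lam * xval Phi (xsolve1 lam t) tau + xcoef t tau * Phi (xi t) (xl t)).
Proof.
have DM (u : xterm I) : is_derive tau 1 (fun r => xcoef u r * Phi (xi u) (xl u))
    ((xc u * ((xj u)%:R * tau ^+ (xj u).-1 * expR (- xe u * tau)) - xe u * xcoef u tau) *
     Phi (xi u) (xl u)).
  have D := is_derive_xcoef u tau.
  by apply: is_derive_eq; rewrite /GRing.scale/=; ring.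
case: t => e j c i l; rewrite /xsolve1 /=; have [e0|e0] := eqVneq (e + lam) 0.
  rewrite (_ : xval Phi _ = fun r => xcoef (XTerm e j.+1 (c / j.+1%:R) i l) r * Phi i l); last first.
    by apply/funext => r; rewrite /xval big_seq1.
  have D := DM (XTerm e j.+1 (c / j.+1%:R) i l).
  apply: is_derive_eq; rewrite /xcoef /= (_ : lam = - e); last by lra.
  have j0 : j.+1%:R != 0 :> R by rewrite pnatr_eq0.
  by field.
elim: j c => [|j IH] c.
  rewrite /= (_ : xval Phi _ = fun r => xcoef (XTerm e 0 (- c / (e + lam)) i l) r * Phi i l); last first.
    by apply/funext => r; rewrite /xval big_seq1.
  have D := DM (XTerm e 0 (- c / (e + lam)) i l).
  by apply: is_derive_eq; rewrite /xcoef /=; field.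
set X := xsolve_poly lam e i l (c * j.+1%:R / (e + lam)) j.
rewrite (_ : xval Phi _ = (fun r => xcoef (XTerm e j.+1 (- c / (e + lam)) i l) r * Phi i l) + xval Phi X); last first.
  by apply/funext => r; rewrite /= xval_cons fctE.
have D := DM (XTerm e j.+1 (- c / (e + lam)) i l).
have D2 := IH (c * j.+1%:R / (e + lam)).
by apply: is_derive_eq; rewrite -/X fctE /xcoef /=; field.
Qed.

Lemma is_derive_xsolve Phi lam X (tau : R) :
  is_derive tau 1 (xval Phi (xsolve lam X))
    (lam * xval Phi (xsolve lam X) tau + xval Phi X tau).
Proof.
rewrite (_ : xval Phi _ = fun r => \sum_(t <- X) xval Phi (xsolve1 lam t) r); last first.
  by apply/funext => r; rewrite /xsolve xval_flatten.
rewrite mulr_sumr {3}/xval -big_split/=.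
by apply: is_derive_bigsum => t; exact: is_derive_xsolve1.
Qed.

Lemma xsolve_all (P : R -> bool) lam X :
  all (fun t => P (xe t)) X -> all (fun t => P (xe t)) (xsolve lam X).
Proof.
rewrite /xsolve; elim: X => //= t X IH /andP[Pt /IH PX]; rewrite all_cat PX andbT.
rewrite /xsolve1; case: ifP => _ /=; first by rewrite Pt.
by elim: (xj t) (xc t) => [|j IHj] c /=; rewrite Pt ?IHj.
Qed.

Lemma xsolve_all_idx (P : I -> bool) lam X :
  all (fun t => P (xi t)) X -> all (fun t => P (xi t)) (xsolve lam X).
Proof.
rewrite /xsolve; elim: X => //= t X IH /andP[Pt /IH PX]; rewrite all_cat PX andbT.
rewrite /xsolve1; case: ifP => _ /=; first by rewrite Pt.
by elim: (xj t) (xc t) => [|j IHj] c /=; rewrite Pt ?IHj.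
Qed.

(* Minus the homogeneous solution with the value of [X] at [tau = 0]. *)
Definition xat0 (lam : R) X := [seq XTerm (- lam) 0 (- xc t) (xi t) (xl t) | t <- X & xj t == 0%N].

Lemma xval_at0 Phi lam X tau : xval Phi (xat0 lam X) tau = - expR (lam * tau) * xval Phi X 0.
Proof.
rewrite /xval big_map big_filter big_mkcond mulr_sumr; apply: eq_bigr => t _.
rewrite /xcoef /= opprK mulr0 expR0 mulr1 expr0n.
by case: (xj t == 0%N); rewrite /= ?expr0; ring.
Qed.

Lemma is_derive_xat0 Phi lam X (tau : R) :
  is_derive tau 1 (xval Phi (xat0 lam X)) (lam * xval Phi (xat0 lam X) tau).
Proof.
rewrite xval_at0 (_ : xval Phi (xat0 lam X) = (- xval Phi X 0) \*: (fun s => expR (lam * s))); last first.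
  by apply/funext => s; rewrite xval_at0 [RHS]mulNr mulNr mulrC.
have D0 : is_derive tau 1 (fun s : R => lam * s) lam.
  by apply: is_derive_eq; rewrite /GRing.scale/= mulr1.
have D2 := @is_derive1_comp R expR (fun s => lam * s) tau _ _ (is_derive_expR _) D0.
have -> : (fun s => expR (lam * s)) = expR \o (fun s => lam * s) by [].
by apply: is_derive_eq; rewrite /GRing.scale /=; ring.
Qed.

End ExpPolynomials.

(** * Kasner exponents and the windows of the eigenvalues *)

Section KasnerExponents.
Context {R : realType}.
Variable p : 'I_3 -> R.
Hypothesis p_kasner : is_kasner p.
Hypothesis p_ordered : forall i j : 'I_3, (i <= j)%N -> p i <= p j.
Hypothesis p_nonflat : p ord_max < 1.

Local Notation p3 := (p ord_max).

Lemma ord3P (P : 'I_3 -> Prop) : P ord0 -> P (inord 1) -> P ord_max -> forall i, P i.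
Proof.
move=> P0 P1 P2 [[|[|[|//]]] k].
- by rewrite (_ : Ordinal k = ord0)//; apply: val_inj.
- by rewrite (_ : Ordinal k = inord 1)//; apply: val_inj; rewrite /= inordK.
- by rewrite (_ : Ordinal k = ord_max)//; apply: val_inj.
Qed.

Lemma sum_ord3 (F : 'I_3 -> R) : \sum_i F i = F ord0 + F (inord 1) + F ord_max.
Proof.
rewrite !big_ord_recl big_ord0 addr0 addrA.
by congr (_ + _ + _); congr F; apply: val_inj; rewrite /= ?inordK.
Qed.

(** Squaring the sum gives that the pairwise products add up to 0, which excludes p_1 >= 0. Then p_2
    (1 - p_2) = - p_1 p_3 > 0 forces p_2 > 0, and the other bounds follow from the sum being 1
    together with the ordering and p_3 < 1. *)
Lemma kasner_order : [/\ p ord0 < 0, 0 < p (inord 1), 1 < p (inord 1) + p3, 1 < 2 * p3 & -1 < p ord0].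
Proof.
have [] := p_kasner; rewrite !sum_ord3.
have := @p_ordered ord0 (inord 1); rewrite inordK// => /(_ isT).
have := @p_ordered (inord 1) ord_max; rewrite inordK// => /(_ isT).
move: p_nonflat; set a := p ord0; set b := p (inord 1); set c := p ord_max.
move=> c1 bc ab s1 s2.
have c0 : 0 < c by lra.
have e : a * b + (a + b) * c = 0 by nra.
have a0 : a < 0.
  rewrite ltNge; apply/negP => a0; have b0 : 0 <= b by lra.
  have : 0 <= a * b by rewrite mulr_ge0.
  have ab1 : 0 < a + b by lra.
  have : 0 < (a + b) * c by rewrite mulr_gt0.
  lra.
have b0 : 0 < b.
  have h : b * (1 - b) = - (a * c) by nra.
  have h2 : 0 < b * (1 - b) by rewrite h -mulNr mulr_gt0// oppr_gt0.
  rewrite ltNge; apply/negP => b0; nra.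
by split => //; lra.
Qed.

Lemma kasner_pos i : i != ord0 -> 0 < p i /\ 1 < p i + p3.
Proof.
have [_ b0 bc cc _] := kasner_order.
move: i; apply: ord3P => [|_|_]; first by []; split; lra.
Qed.

Lemma kasner_lt1 i : p i < 1.
Proof. by apply: le_lt_trans p_nonflat; apply: p_ordered; rewrite -ltnS. Qed.

Lemma kasner_gtN1 i : -1 < p i.
Proof.
have [_ b0 bc cc a1] := kasner_order.
by move: i; apply: ord3P; lra.
Qed.

Definition delta : R := 1 - p3.

Lemma delta_gt0 : 0 < delta.
Proof. by rewrite subr_gt0. Qed.

Lemma delta_lt1 : delta < 1.
Proof. have [_ _ _ h _] := kasner_order; rewrite /delta; lra. Qed.

Lemma delta_le i : delta <= 1 - p i.
Proof. by rewrite lerD2l lerN2; apply: p_ordered; rewrite -ltnS. Qed.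

Lemma p4_0 : p4 p ord0 = 1.
Proof. by rewrite /p4 unlift_none. Qed.

Lemma p4_spatial i : p4 p (spatial i) = p i.
Proof. by rewrite /p4 /spatial liftK. Qed.

Lemma ord4P (P : 'I_4 -> Prop) : P ord0 -> (forall i, P (spatial i)) -> forall mu, P mu.
Proof. by move=> P0 PS mu; case: (unliftP ord0 mu) => [j ->|->]. Qed.

Lemma p4_neq0 mu : p4 p mu != 0.
Proof.
elim/ord4P: mu => [|i]; first by rewrite p4_0 oner_eq0.
rewrite p4_spatial; have [->|/kasner_pos[h _]] := eqVneq i ord0; last by rewrite gt_eqF.
by have [h _ _ _ _] := kasner_order; rewrite lt_eqF.
Qed.

Lemma p4_bound mu : -1 < p4 p mu <= 1.
Proof.
elim/ord4P: mu => [|i]; first by rewrite p4_0; apply/andP; split; lra.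
by rewrite p4_spatial kasner_gtN1 ltW// kasner_lt1.
Qed.

Lemma eigval_bound k : -2 <= eigval p k <= 0.
Proof. by case: k => mu [] ; have := p4_bound mu; rewrite /eigval /= => /andP[? ?]; apply/andP; split; lra. Qed.

(** The n for which v_k belongs to E^n: one plus the integer part of - eigval / delta. *)
Definition window_index (k : 'I_4 * bool) : nat := (Num.truncn (- eigval p k / delta)).+1.

Lemma window_index_itv k :
  (window_index k).-1%:R * delta <= - eigval p k < (window_index k)%:R * delta.
Proof.
have h : 0 <= - eigval p k / delta.
  by rewrite divr_ge0 ?(ltW delta_gt0)// oppr_ge0; case/andP: (eigval_bound k).
have := truncn_itv h; rewrite /= => /andP[h1 h2].
by rewrite -ler_pdivlMr ?delta_gt0// -ltr_pdivrMr ?delta_gt0// h1.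
Qed.

Lemma in_window_index n k : (0 < n)%N -> in_window p n k = (n == window_index k).
Proof.
move=> n0; have /andP[h1 h2] := window_index_itv k; rewrite /in_window -/delta.
have d0 := delta_gt0.
apply/idP/eqP => [/andP[w1 w2]|->]; last by apply/andP; split; lra.
have a1 : (n.-1)%:R * delta < (window_index k)%:R * delta by lra.
have a2 : (window_index k).-1%:R * delta < n%:R * delta by lra.
move: a1 a2; rewrite !ltr_pM2r// !ltr_nat; rewrite /window_index /=; lia.
Qed.

Lemma window_index_calN calN k : is_calN p calN -> (1 <= window_index k <= calN)%N.
Proof.
case=> c2 _; rewrite /= leqNgt; apply/negP => h.
have /andP[h1 _] := window_index_itv k; have /andP[h3 _] := eigval_bound k.
have : calN%:R * delta <= (window_index k).-1%:R * delta.
  by rewrite ler_pM2r ?delta_gt0// ler_nat; move: h; rewrite /window_index /=; lia.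
move: c2; rewrite -/delta; lra.
Qed.

End KasnerExponents.

(** * The formal solution and its relation to the functions F_{oo,n} *)

Section FormalRecursion.
Context {R : realType}.
Variable p : 'I_3 -> R.
Local Notation K := ('I_4 * bool)%type.
Local Notation beta i := (1 - p i).

Section generic.
Variable I : Type.
Implicit Types (G : K -> seq (xterm (R := R) I)) (Phi : I -> seq 'I_3 -> R).

Definition xpair G (mu : 'I_4) := G (mu, true) ++ G (mu, false).

Definition xD G (mu : 'I_4) : seq (xterm I) :=
  flatten [seq xshift (2 * beta i) (xdiff i (xdiff i (xpair G mu))) | i <- enum 'I_3] ++
  (if unlift ord0 mu is Some j
   then xscale (2 * p j) (xshift (beta j) (xdiff j (xpair G ord0)))
   else flatten [seq xscale (2 * p i) (xshift (beta i) (xdiff i (xpair G (spatial i))))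
                | i <- enum 'I_3]).

(** Coordinate along v_k of the vector e_{mu+4}; the source D has lower components only. *)
Definition kcoef (k : K) : R := sgn k.2 / (2 * p4 p k.1).

Definition xKD G (k : K) : seq (xterm I) := xsolve (eigval p k) (xscale (kcoef k) (xD G k.1)).

(* [W mu l] stands for the derivative [d_l] of the component [mu]. *)
Definition Dsem (tau : R) (W : 'I_4 -> seq 'I_3 -> R) (mu : 'I_4) : R :=
  \sum_i expR (- 2 * beta i * tau) * W mu [:: i; i] +
  (if unlift ord0 mu is Some j then 2 * p j * expR (- beta j * tau) * W ord0 [:: j]
   else \sum_i 2 * p i * expR (- beta i * tau) * W (spatial i) [:: i]).

Definition xcomp Phi G tau (mu : 'I_4) (l : seq 'I_3) : R :=
  xval (fun i l' => Phi i (l ++ l')) (G (mu, true)) tau +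
  xval (fun i l' => Phi i (l ++ l')) (G (mu, false)) tau.

Lemma Dsem_ext tau W W' mu : (forall nu l, W nu l = W' nu l) -> Dsem tau W mu = Dsem tau W' mu.
Proof.
move=> E; rewrite /Dsem; congr (_ + _); first by apply: eq_bigr => i _; rewrite E.
by case: unlift => [j|]; rewrite ?E//; apply: eq_bigr => i _; rewrite E.
Qed.

Lemma Dsem_lin tau a W W' mu :
  Dsem tau (fun nu l => a * W nu l + W' nu l) mu = a * Dsem tau W mu + Dsem tau W' mu.
Proof.
rewrite /Dsem mulrDr addrACA -[in RHS]addrA; rewrite addrA; congr (_ + _).
  by rewrite mulr_sumr -big_split/=; apply: eq_bigr => i _; ring.
case: unlift => [j|]; first by ring.
by rewrite mulr_sumr -big_split/=; apply: eq_bigr => i _; ring.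
Qed.

Lemma xval_xD Phi G mu tau : xval Phi (xD G mu) tau = Dsem tau (xcomp Phi G tau) mu.
Proof.
rewrite /xD xval_cat xval_flatten big_enum /=; congr (_ + _).
  by apply: eq_bigr => i _; rewrite xval_shift !xval_diff xval_cat mulNr.
case: unlift => [j|].
  by rewrite xval_scale xval_shift xval_diff xval_cat mulrA.
rewrite xval_flatten big_enum /=; apply: eq_bigr => i _.
by rewrite xval_scale xval_shift xval_diff xval_cat mulrA.
Qed.

Lemma is_derive_xKD Phi G k (tau : R) :
  is_derive tau 1 (xval Phi (xKD G k))
    (eigval p k * xval Phi (xKD G k) tau + kcoef k * Dsem tau (xcomp Phi G tau) k.1).
Proof. by rewrite -xval_xD -[kcoef k * _]xval_scale; exact: is_derive_xsolve. Qed.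

End generic.

(* The eigencomponents of F_{oo,n}, in terms of those of V_{oo,1}, ..., V_{oo,n}. *)
Fixpoint xF (n : nat) (k : K) : seq (xterm (R := R) (nat * K)) :=
  if n is m.+1 then
    XTerm (- eigval p k) 0 1 (n, k) [::] :: xat0 (eigval p k) (xKD (xF m) k) ++ xKD (xF m) k
  else [::].

(* The homogeneous part of the n-th increment: up to the window of [k] it makes the
   increment vanish at [tau = 0], except that [u k] enters in that window itself; later
   the increment has no homogeneous part. *)
Definition xnew (n : nat) (k : K) (X : seq (xterm (R := R) K)) : seq (xterm K) :=
  (if (n <= window_index p k)%N then xat0 (eigval p k) X else [::]) ++
  (if n == window_index p k then [:: XTerm (- eigval p k) 0 1 k [::]] else [::]).

Fixpoint xg (n : nat) (k : K) : seq (xterm (R := R) K) :=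
  if n is m.+1 then xnew n k (xKD (xg m) k) ++ xKD (xg m) k else [::].

Fixpoint xG (n : nat) (k : K) : seq (xterm (R := R) K) :=
  if n is m.+1 then xG m k ++ xg n k else [::].

Lemma is_derive_xterm0 (I : Type) (Phi : I -> seq 'I_3 -> R) (lam c : R) i l (tau : R) :
  is_derive tau 1 (xval Phi [:: XTerm (- lam) 0 c i l]) (lam * xval Phi [:: XTerm (- lam) 0 c i l] tau).
Proof.
rewrite (_ : [:: _] = xat0 lam [:: XTerm 0 0 (- c) i l]); first exact: is_derive_xat0.
by rewrite /xat0 /= opprK.
Qed.

Lemma is_derive_xcat (I : Type) (Phi : I -> seq 'I_3 -> R) (X Y : seq (xterm I)) (tau : R) a b :
  is_derive tau 1 (xval Phi X) a -> is_derive tau 1 (xval Phi Y) b ->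
  is_derive tau 1 (xval Phi (X ++ Y)) (a + b).
Proof.
move=> dX dY; rewrite (_ : xval Phi (X ++ Y) = xval Phi X + xval Phi Y); first exact: is_deriveD.
by apply/funext => s; rewrite xval_cat.
Qed.

Lemma is_derive_xnil (I : Type) (Phi : I -> seq 'I_3 -> R) (tau : R) :
  is_derive tau 1 (xval Phi [::]) 0.
Proof.
rewrite (_ : xval Phi [::] = cst 0); first exact: is_derive_cst.
by apply/funext => s; rewrite xval_nil.
Qed.

Lemma is_derive_xF Phi n k (tau : R) :
  is_derive tau 1 (xval Phi (xF n.+1 k))
    (eigval p k * xval Phi (xF n.+1 k) tau + kcoef k * Dsem tau (xcomp Phi (xF n) tau) k.1).
Proof.
rewrite /= -cat1s; apply: is_derive_eq.
  apply: is_derive_xcat; first exact: is_derive_xterm0.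
  apply: is_derive_xcat; [exact: is_derive_xat0|exact: is_derive_xKD].
by rewrite !xval_cat; ring.
Qed.

Lemma xval_xF0 Phi n k : xval Phi (xF n.+1 k) 0 = Phi (n.+1, k) [::].
Proof.
rewrite /= xval_cons xval_cat xval_at0 /xcoef /= !mulr0 expR0 expr0; ring.
Qed.

Lemma is_derive_xnew Phi n k X (tau : R) :
  is_derive tau 1 (xval Phi (xnew n k X)) (eigval p k * xval Phi (xnew n k X) tau).
Proof.
rewrite /xnew; apply: is_derive_eq.
  apply: (@is_derive_xcat _ _ _ _ _ (eigval p k * xval Phi (if (n <= window_index p k)%N then xat0 (eigval p k) X else [::]) tau)
    (eigval p k * xval Phi (if n == window_index p k then [:: XTerm (- eigval p k) 0 1 k [::]] else [::]) tau)).
    case: ifP => _; first exact: is_derive_xat0.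
    by rewrite xval_nil mulr0; exact: is_derive_xnil.
  case: ifP => _; first exact: is_derive_xterm0.
  by rewrite xval_nil mulr0; exact: is_derive_xnil.
by rewrite xval_cat mulrDr.
Qed.

Lemma is_derive_xg Phi n k (tau : R) :
  is_derive tau 1 (xval Phi (xg n.+1 k))
    (eigval p k * xval Phi (xg n.+1 k) tau + kcoef k * Dsem tau (xcomp Phi (xg n) tau) k.1).
Proof.
apply: is_derive_eq.
  by apply: is_derive_xcat; [exact: is_derive_xnew|exact: is_derive_xKD].
rewrite (_ : xg n.+1 k = xnew n.+1 k (xKD (xg n) k) ++ xKD (xg n) k)// xval_cat; ring.
Qed.

(** Adding up the equations of the increments shifts the order by one, since the increment of order
    m + 1 has the increment of order m as its source. *)
Lemma is_derive_xG Phi n k (tau : R) :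
  is_derive tau 1 (xval Phi (xG n.+1 k))
    (eigval p k * xval Phi (xG n.+1 k) tau + kcoef k * Dsem tau (xcomp Phi (xG n) tau) k.1).
Proof.
elim: n => [|n IH].
  apply: is_derive_eq; first exact: (is_derive_xg Phi 0).
  by congr (_ + _ * _); apply: Dsem_ext.
apply: is_derive_eq.
  by apply: is_derive_xcat; exact: is_derive_xg.
have -> : Dsem tau (xcomp Phi (xG n.+1) tau) k.1 =
    1 * Dsem tau (xcomp Phi (xG n) tau) k.1 + Dsem tau (xcomp Phi (xg n.+1) tau) k.1.
  by rewrite -Dsem_lin; apply: Dsem_ext => nu l; rewrite mul1r /xcomp !xval_cat addrACA.
rewrite (_ : xG n.+2 k = xG n.+1 k ++ xg n.+2 k)// xval_cat; ring.
Qed.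

End FormalRecursion.

Section FInfty.
Context {R : realType}.
Variable p : 'I_3 -> R.
Hypothesis p_neq0 : forall mu, p4 p mu != 0.
Local Notation K := ('I_4 * bool)%type.
Local Notation mu := (@lebesgue_measure R).

Definition Dpt (I : Type) (f : I -> 'rV[R]_3 -> R) (x : 'rV[R]_3) : I -> seq 'I_3 -> R :=
  fun i l => partials l (f i) x.

Lemma smooth_torus_xval (I : Type) (f : I -> 'rV[R]_3 -> R) X tau :
  (forall i, smooth_torus (f i)) -> smooth_torus (fun x => xval (Dpt f x) X tau).
Proof.
move=> sf; rewrite /xval /Dpt.
apply: (@smooth_torus_sum R (@xterm R I) X (fun t => xcoef t tau) (fun t => partials (xl t) (f (xi t)))) => t.
exact: smooth_torus_partials.
Qed.

Lemma partials_xval (I : Type) (f : I -> 'rV[R]_3 -> R) X tau l x :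
  (forall i, smooth_torus (f i)) ->
  partials l (fun x => xval (Dpt f x) X tau) x =
  xval (fun i l' => Dpt f x i (l ++ l')) X tau.
Proof.
move=> sf; have sF (t : @xterm R I) : smooth_on setT (partials (xl t) (f (xi t))).
  by apply: smooth_on_partials; have [] := sf (xi t).
have [_ ->] := @smooth_sum R 3 (@xterm R I) X (fun t => xcoef t tau) (fun t => partials (xl t) (f (xi t))) sF.
by rewrite /xval; apply: eq_bigr => t _; rewrite /Dpt partials_cat.
Qed.

Lemma continuous_is_derive (f : R -> R) :
  (forall t : R, exists d, is_derive t 1 f d) -> continuous f.
Proof.
move=> fd t; have [d Hd] := fd t.
by apply: differentiable_continuous; apply/derivable1_diffP; apply: ex_derive.
Qed.

Lemma continuous_xval (I : Type) (Phi : I -> seq 'I_3 -> R) X : continuous (xval Phi X).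
Proof. by apply: continuous_is_derive => t; exact: is_derive_xval_ex. Qed.

Lemma continuous_bigsum (T : topologicalType) (J : Type) (s : seq J) (f : J -> T -> R) :
  (forall j, continuous (f j)) -> continuous (fun r => \sum_(j <- s) f j r).
Proof.
move=> cf; elim: s => [|j s IH].
  by under eq_fun do rewrite big_nil; exact: continuous_cstT.
by under eq_fun do rewrite big_cons; exact: continuous_addT.
Qed.

Lemma Rintegral_sum (a b : R) (J : Type) (s : seq J) (c : J -> R) (f : J -> R -> R) :
  (forall j, continuous (f j)) ->
  \int[mu]_(r in `[a, b]) (\sum_(j <- s) c j * f j r) =
  \sum_(j <- s) c j * \int[mu]_(r in `[a, b]) f j r.
Proof.
move=> cf; elim: s => [|j s IH].
  rewrite big_nil; transitivity (\int[mu]_(r in `[a, b]) (0 : R)).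
    by apply: eq_Rintegral => r _; rewrite big_nil.
  by rewrite Rintegral_cst// mul0r.
rewrite big_cons -IH -Rintegral_lin//.
  by apply: eq_Rintegral => r _; rewrite big_cons.
by apply: continuous_bigsum => i; apply: continuous_mulT => //; exact: continuous_cstT.
Qed.

Lemma ecoord_D_op k tau (v : 'rV[R]_3 -> 'cV[R]_8) x :
  ecoord p k (D_op p tau v x) =
  kcoef p k * Dsem p tau (fun nu l => partials l (fun y => up (v y) nu) x) k.1.
Proof.
rewrite /ecoord /kcoef; congr (_ * _).
rewrite /D_op /up /dn col_mxKu col_mxKd [X in _ - _ * X]mxE mulr0 subr0.
by rewrite /D_half mxE.
Qed.

Section expansion.
Variable V : nat -> 'rV[R]_3 -> 'cV[R]_8.
Hypothesis sV : forall n i, smooth_torus (fun x => V n x i 0).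

Definition vcoord (i : nat * K) (x : 'rV[R]_3) : R := ecoord p i.2 (V i.1 x).

Lemma smooth_ecoord (v : 'rV[R]_3 -> 'cV[R]_8) k :
  (forall i, smooth_torus (fun x => v x i 0)) -> smooth_torus (fun x => ecoord p k (v x)).
Proof.
move=> sv.
rewrite (_ : (fun x => _) = fun x => \sum_i erow p k 0 i * v x i 0).
  by apply: smooth_torus_sum.
by apply/funext => x; rewrite -erowE mxE.
Qed.

Lemma smooth_vcoord i : smooth_torus (vcoord i).
Proof. exact: smooth_ecoord. Qed.

(** Along each eigenvector the Duhamel integral is elementary: e^{(tau - r) lambda} times the
    particular solution [xKD] at r is a primitive of the integrand. Its value at r = 0 is the term
    encoded by [xat0]. *)
Lemma F_inftyE n tau x : 0 <= tau -> forall k,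
  ecoord p k (F_infty p V n tau x) = xval (Dpt vcoord x) (xF p n k) tau.
Proof.
elim: n tau x => [|n IH] tau x tau0 k; first by rewrite /= ecoord0 xval_nil.
pose c k r := expR ((tau - r) * eigval p k) *
  (kcoef p k * xval (Dpt vcoord x) (xD p (xF p n) k.1) r).
have cexp (a : R) : continuous (fun r : R => expR ((tau - r) * a)).
  apply: (continuous_compT (f := fun r : R => (tau - r) * a)); last exact: continuous_expR.
  apply: continuous_mulT; last exact: continuous_cstT.
  by apply: continuous_addT; [exact: continuous_cstT|move=> r; apply: cvgN; exact: cvg_id].
have cc k' : continuous (c k').
  apply: continuous_mulT; first exact: cexp.
  by apply: continuous_mulT; [exact: continuous_cstT|exact: continuous_xval].
have ME r : 0 <= r -> expmx ((tau - r) *: A_infty p) *m D_op p r (F_infty p V n r) x =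
    \sum_k c k r *: eigvec p k.
  move=> r0; rewrite [LHS](ecoord_decomp p_neq0); apply: eq_bigr => k' _; congr (_ *: _).
  rewrite ecoord_expmx// ecoord_D_op /c xval_xD; congr (_ * (_ * _)).
  apply: Dsem_ext => nu l; rewrite /xcomp.
  have -> : (fun y => up (F_infty p V n r y) nu) =
    (fun y => 1 * xval (Dpt vcoord y) (xF p n (nu, true)) r + xval (Dpt vcoord y) (xF p n (nu, false)) r).
    by apply/funext => y; rewrite (up_ecoord p_neq0) !IH// mul1r.
  rewrite partials_lin; last 2 first.
  - by have [] := smooth_torus_xval (xF p n (nu, true)) r smooth_vcoord.
  - by have [] := smooth_torus_xval (xF p n (nu, false)) r smooth_vcoord.
  by rewrite mul1r !(partials_xval _ _ _ _ smooth_vcoord).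
have IE : \col_j \int[mu]_(r in `[0, tau])
      (expmx ((tau - r) *: A_infty p) *m D_op p r (F_infty p V n r) x) j 0 =
    \sum_k (\int[mu]_(r in `[0, tau]) c k r) *: eigvec p k.
  apply/colP => j; rewrite mxE summxE.
  transitivity (\int[mu]_(r in `[0, tau]) (\sum_k eigvec p k j 0 * c k r)).
    apply: eq_Rintegral => r; rewrite inE /= in_itv /= => /andP[r0 _].
    by rewrite ME// summxE; apply: eq_bigr => k' _; rewrite [LHS]mxE mulrC.
  by rewrite Rintegral_sum//; apply: eq_bigr => k' _; rewrite [RHS]mxE mulrC.
have CE : \int[mu]_(r in `[0, tau]) c k r =
   xval (Dpt vcoord x) (xKD p (xF p n) k) tau -
   expR (tau * eigval p k) * xval (Dpt vcoord x) (xKD p (xF p n) k) 0.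
  etransitivity.
    apply: (@Rintegral_derive R 0 tau (fun r => expR ((tau - r) * eigval p k) *
      xval (Dpt vcoord x) (xKD p (xF p n) k) r) (c k)) => // r.
    have D1 : is_derive r 1 (fun r : R => (tau - r) * eigval p k) (- eigval p k).
      by apply: is_derive_eq; rewrite /GRing.scale/=; ring.
    have D2 : is_derive r 1 (fun r : R => expR ((tau - r) * eigval p k))
        (expR ((tau - r) * eigval p k) * - eigval p k).
      exact: (@is_derive1_comp R expR (fun r => (tau - r) * eigval p k)).
    have D3 := is_derive_xKD p (Dpt vcoord x) (xF p n) k r.
    by apply: is_derive_eq; rewrite /GRing.scale/= /c xval_xD; ring.
  by rewrite /= subrr mul0r expR0 mul1r subr0.
rewrite [F_infty _ _ _ _ _]/= ecoordD ecoord_expmx// IE ecoord_sum (bigD1 k)//= big1.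
  rewrite ecoordZ ecoord_eigvec// eqxx mulr1 addr0 CE xval_cons xval_cat xval_at0.
  rewrite /xcoef /= expr0 opprK [_ * tau]mulrC /Dpt /= /vcoord /=; ring.
by move=> k' kk'; rewrite ecoordZ ecoord_eigvec// eq_sym (negPf kk') mulr0.
Qed.

End expansion.

(** The data say nothing about V outside 1..calN; this allows V to be replaced by a family that is
    smooth at every index. *)
Lemma F_infty_eq (V V' : nat -> 'rV[R]_3 -> 'cV[R]_8) n :
  (forall m, (1 <= m <= n)%N -> V m = V' m) -> F_infty p V n = F_infty p V' n.
Proof.
elim: n => [//|n IH] VV.
have E1 : V n.+1 = V' n.+1 by apply: VV; rewrite leqnn.
have E2 : F_infty p V n = F_infty p V' n.
  by apply: IH => m /andP[m0 mn]; apply: VV; rewrite m0 leqW.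
by apply/funext => tau; apply/funext => x; rewrite [LHS]/= [RHS]/= E1 E2.
Qed.

End FInfty.

(** * The equation in Fourier space *)

Lemma is_derive_val (K : numFieldType) (V W : normedModType K) (f : V -> W) x v d :
  is_derive x v f d -> 'D_v f x = d.
Proof. by move=> D; exact: derive_val. Qed.

(** * The wave operator of the Kasner metric in coordinates *)

Section KasnerBox.
Context {R : realType}.
Variable p : 'I_3 -> R.
Hypothesis p_kasner : is_kasner p.
Implicit Types (X : 'rV[R]_4) (i j : 'I_3).

Local Notation tm X := (X 0 ord0).
Local Notation T i X := (tm X `^ (2 * p i)).

Lemma kasner_domain_near X : kasner_domain X -> \near X, kasner_domain X.
Proof.
move=> X0; have := @coord_continuous R 1 4 0 ord0 X.
by move=> /(@cvgr_gt R _ (nbhs X) _ _ (tm X)); apply.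
Qed.

Lemma sum4 (F : 'I_4 -> R) : \sum_mu F mu = F ord0 + \sum_i F (spatial i).
Proof. by rewrite big_ord_recl. Qed.

Lemma is_derive_time_fun X (c : R -> R) (d : R) : is_derive (tm X) 1 c d ->
  is_derive X (delta_mx 0 ord0) (fun Y : 'rV[R]_4 => c (tm Y)) d.
Proof.
move=> cd; apply/is_derive_lineP.
rewrite (_ : (fun h : R => _) = fun h => c (h *: (1 : R^o) + tm X)).
  by apply/is_derive_lineP.
by apply/funext => h; rewrite !mxE eqxx.
Qed.

Lemma is_derive_space_fun X (c : R -> R) i :
  is_derive X (delta_mx 0 (spatial i)) (fun Y : 'rV[R]_4 => c (tm Y)) 0.
Proof.
apply/is_derive_lineP.
rewrite (_ : (fun h : R => _) = cst (c (tm X))); first exact: is_derive_cst.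
by apply/funext => h; rewrite !mxE /= mulr0 add0r.
Qed.

Lemma is_derive_powR (t a : R) : 0 < t -> is_derive t 1 (fun s : R => s `^ a) (a * (t `^ a / t)).
Proof.
move=> t0; have tI : t \in `]0, +oo[%R by rewrite in_itv/= andbT.
apply: DeriveDef; first exact: derivable_powR.
rewrite -derive1E powR_derive1// powRB ?powRr1 ?(ltW t0)//.
by rewrite (gt_eqF t0) implybT.
Qed.

Lemma kasner_metricE X mu nu : kasner_metric p X mu nu =
  (if unlift ord0 mu is Some i then T i X else -1) *+ (mu == nu).
Proof. by rewrite !mxE. Qed.

Definition ginv X (mu : 'I_4) : R := if unlift ord0 mu is Some i then (T i X)^-1 else -1.

Lemma powR_neq0 X i : kasner_domain X -> T i X != 0.
Proof. by move=> X0; rewrite gt_eqF// powR_gt0. Qed.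

Lemma invmx_kasner X mu nu : kasner_domain X ->
  invmx (kasner_metric p X) mu nu = ginv X mu *+ (mu == nu).
Proof.
move=> X0.
suff -> : invmx (kasner_metric p X) = diag_mx (\row_mu ginv X mu) by rewrite !mxE.
have E : kasner_metric p X *m diag_mx (\row_mu ginv X mu) = 1%:M.
  rewrite mulmx_diag -diag_const_mx; congr diag_mx; apply/rowP => k; rewrite !mxE /ginv.
  by case: unliftP => [i _|_]; rewrite ?mulfV ?powR_neq0// mulrNN mulr1.
have [U _] := mulmx1_unit E.
by rewrite -[RHS](mulKmx U) E mulmx1.
Qed.

Lemma partial_metric_time X mu nu : kasner_domain X ->
  partial ord0 (fun Y => kasner_metric p Y mu nu) X =
  (if unlift ord0 mu is Some i then 2 * p i * (T i X / tm X) else 0) *+ (mu == nu).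
Proof.
move=> X0; rewrite /partial.
pose c (t : R) := (if unlift ord0 mu is Some i then t `^ (2 * p i) else -1) *+ (mu == nu).
rewrite (_ : (fun Y => _) = fun Y : 'rV[R]_4 => c (tm Y)); last first.
  by apply/funext => Y; rewrite kasner_metricE.
apply/is_derive_val/is_derive_time_fun; rewrite /c.
have [_|_] := eqVneq mu nu; last first.
  rewrite (_ : (fun t : R => _) = cst 0); first exact: is_derive_cst.
  by apply/funext => t; rewrite mulr0n.
case: (unlift ord0 mu) => [i|]; last exact: is_derive_cst.
exact: is_derive_powR.
Qed.

Lemma partial_metric_space X mu nu i :
  partial (spatial i) (fun Y => kasner_metric p Y mu nu) X = 0.
Proof.
pose c (t : R) := (if unlift ord0 mu is Some i then t `^ (2 * p i) else -1) *+ (mu == nu).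
rewrite /partial (_ : (fun Y => _) = fun Y : 'rV[R]_4 => c (tm Y)); last first.
  by apply/funext => Y; rewrite kasner_metricE.
exact/is_derive_val/is_derive_space_fun.
Qed.

Lemma christoffelE X k mu nu : kasner_domain X ->
  christoffel (kasner_metric p) k mu nu X = 2^-1 * (ginv X k *
    (partial mu (fun Y => kasner_metric p Y nu k) X +
     partial nu (fun Y => kasner_metric p Y mu k) X -
     partial k (fun Y => kasner_metric p Y mu nu) X)).
Proof.
move=> X0; rewrite /christoffel (bigD1 k)//= big1 ?addr0.
  by rewrite invmx_kasner// eqxx.
by move=> l lk; rewrite invmx_kasner// eq_sym (negPf lk) mul0r.
Qed.

Lemma unlift_spatial i : unlift ord0 (spatial i) = Some i.
Proof. exact: liftK. Qed.

Lemma spatial_eq i j : (spatial i == spatial j) = (i == j).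
Proof. by rewrite (inj_eq lift_inj). Qed.

Lemma spatial_neq0 i : (spatial i == ord0) = false.
Proof. by []. Qed.

Lemma neq0_spatial i : (ord0 == spatial i) = false.
Proof. by []. Qed.

Let simp := (partial_metric_time, partial_metric_space, unlift_spatial, spatial_eq, unlift_none,
  spatial_neq0, neq0_spatial, mulr0n, mulr1n, mul0rn).

Lemma christoffel_t00 X k : kasner_domain X -> christoffel (kasner_metric p) k ord0 ord0 X = 0.
Proof.
move=> X0; rewrite christoffelE//.
by elim/ord4P: k => [|i]; rewrite !simp//; ring.
Qed.

Lemma christoffel_0ti X i : kasner_domain X ->
  christoffel (kasner_metric p) ord0 ord0 (spatial i) X = 0.
Proof. by move=> X0; rewrite christoffelE// !simp//; ring. Qed.

Lemma christoffel_0it X i : kasner_domain X ->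
  christoffel (kasner_metric p) ord0 (spatial i) ord0 X = 0.
Proof. by move=> X0; rewrite christoffelE// !simp//; ring. Qed.

Lemma christoffel_0ij X i j : kasner_domain X ->
  christoffel (kasner_metric p) ord0 (spatial i) (spatial j) X = (p i * (T i X / tm X)) *+ (i == j).
Proof.
move=> X0; rewrite christoffelE// !simp// /ginv unlift_none.
by have [_|_] := eqVneq i j; rewrite ?mulr1n ?mulr0n; field; rewrite ?gt_eqF.
Qed.

Lemma christoffel_kti X k i : kasner_domain X ->
  christoffel (kasner_metric p) (spatial k) ord0 (spatial i) X = (p i / tm X) *+ (k == i).
Proof.
move=> X0; rewrite christoffelE// !simp// /ginv unlift_spatial [i == k]eq_sym.
have t0 : tm X != 0 by rewrite gt_eqF.
have h := powR_neq0 k X0.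
have [ki|_] := eqVneq k i; rewrite ?mulr1n ?mulr0n; last by ring.
by rewrite -ki; field; rewrite h t0.
Qed.

Lemma christoffel_kit X k i : kasner_domain X ->
  christoffel (kasner_metric p) (spatial k) (spatial i) ord0 X = (p i / tm X) *+ (k == i).
Proof.
move=> X0; rewrite christoffelE// !simp// /ginv unlift_spatial [i == k]eq_sym.
have t0 : tm X != 0 by rewrite gt_eqF.
have h := powR_neq0 k X0.
have [ki|_] := eqVneq k i; rewrite ?mulr1n ?mulr0n; last by ring.
by rewrite -ki; field; rewrite h t0.
Qed.

Lemma christoffel_kij X k i j : kasner_domain X ->
  christoffel (kasner_metric p) (spatial k) (spatial i) (spatial j) X = 0.
Proof. by move=> X0; rewrite christoffelE// !partial_metric_space; ring. Qed.

Let chr := (christoffel_t00, christoffel_0ti, christoffel_0it, christoffel_0ij,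
  christoffel_kti, christoffel_kit, christoffel_kij).

Lemma sum_eq_l (F : 'I_3 -> R) (c : R) i : \sum_k (c *+ (k == i)) * F k = c * F i.
Proof.
rewrite (bigD1 i)//= eqxx mulr1n big1 ?addr0// => k /negPf ->.
by rewrite mulr0n mul0r.
Qed.

Section oneform.
Variable w : 'I_4 -> 'rV[R]_4 -> R.
Hypothesis sw : forall mu, smooth_on kasner_domain (w mu).
Local Notation g := (kasner_metric p).

Lemma nabla1_tt X : kasner_domain X -> nabla1 g w ord0 ord0 X = partial ord0 (w ord0) X.
Proof.
move=> X0; rewrite /nabla1 big1 ?subr0// => k _.
by rewrite christoffel_t00// mul0r.
Qed.

Lemma nabla1_tj X j : kasner_domain X ->
  nabla1 g w ord0 (spatial j) X = partial ord0 (w (spatial j)) X - p j / tm X * w (spatial j) X.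
Proof.
move=> X0; rewrite /nabla1 sum4 chr// mul0r add0r; congr (_ - _).
by rewrite -(sum_eq_l (fun k => w (spatial k) X)); apply: eq_bigr => k _; rewrite chr.
Qed.

Lemma nabla1_jt X j : kasner_domain X ->
  nabla1 g w (spatial j) ord0 X = partial (spatial j) (w ord0) X - p j / tm X * w (spatial j) X.
Proof.
move=> X0; rewrite /nabla1 sum4 chr// mul0r add0r; congr (_ - _).
by rewrite -(sum_eq_l (fun k => w (spatial k) X)); apply: eq_bigr => k _; rewrite chr.
Qed.

Lemma nabla1_ij X i j : kasner_domain X ->
  nabla1 g w (spatial i) (spatial j) X =
  partial (spatial i) (w (spatial j)) X - (p i * (T i X / tm X)) *+ (i == j) * w ord0 X.
Proof.
move=> X0; rewrite /nabla1 sum4 chr// big1 ?addr0// => k _.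
by rewrite chr// mul0r.
Qed.

(** The formulas for the first covariant derivative are available for t > 0 only; this set is open,
    so they may still be differentiated. *)
Lemma partial_near a (f h : 'rV[R]_4 -> R) X : kasner_domain X ->
  (forall Y, kasner_domain Y -> f Y = h Y) -> partial a f X = partial a h X.
Proof.
move=> X0 fh; apply: near_eq_derive; apply: filterS (kasner_domain_near X0).
exact: fh.
Qed.

Let dw (mu a : 'I_4) X (X0 : kasner_domain X) :
  is_derive X (delta_mx 0 a) (w mu) (partial a (w mu) X) := smooth_on_is_derive a (sw mu) X0.

Let ddw (mu a b : 'I_4) X (X0 : kasner_domain X) :
  is_derive X (delta_mx 0 a) (partial b (w mu)) (partial a (partial b (w mu)) X) :=
  smooth_on_is_derive a (smooth_on_partial b (sw mu)) X0.

Lemma partial_nabla1_tt X : kasner_domain X ->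
  partial ord0 (nabla1 g w ord0 ord0) X = partial ord0 (partial ord0 (w ord0)) X.
Proof. by move=> X0; apply: partial_near => // Y; exact: nabla1_tt. Qed.

Lemma partial_nabla1_tj X j : kasner_domain X ->
  partial ord0 (nabla1 g w ord0 (spatial j)) X =
  partial ord0 (partial ord0 (w (spatial j))) X - p j / tm X * partial ord0 (w (spatial j)) X
  + p j / tm X ^+ 2 * w (spatial j) X.
Proof.
move=> X0; have t0 : tm X != 0 by rewrite gt_eqF.
rewrite (@partial_near _ _ (fun Y => partial ord0 (w (spatial j)) Y - p j / tm Y * w (spatial j) Y))//; last first.
  by move=> Y; exact: nabla1_tj.
have D1 := dw (spatial j) ord0 X0; have D2 := ddw (spatial j) ord0 ord0 X0.
have D3 : is_derive X (delta_mx 0 ord0) (fun Y : 'rV[R]_4 => p j / tm Y) (- (p j / tm X ^+ 2)).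
  apply: (is_derive_time_fun (c := fun t => p j / t)).
  have D4 := is_deriveV t0 (is_derive_id (tm X) (1 : R)).
  by apply: is_derive_eq; rewrite /GRing.scale/=; ring.
by apply: is_derive_val; apply: is_derive_eq; rewrite /GRing.scale/=; ring.
Qed.

Lemma partial_nabla1_jt X i j : kasner_domain X ->
  partial (spatial i) (nabla1 g w (spatial j) ord0) X =
  partial (spatial i) (partial (spatial j) (w ord0)) X - p j / tm X * partial (spatial i) (w (spatial j)) X.
Proof.
move=> X0.
rewrite (@partial_near _ _ (fun Y => partial (spatial j) (w ord0) Y - p j / tm Y * w (spatial j) Y))//; last first.
  by move=> Y; exact: nabla1_jt.
have D1 := dw (spatial j) (spatial i) X0; have D2 := ddw ord0 (spatial i) (spatial j) X0.
have D3 := is_derive_space_fun X (fun t => p j / t) i.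
by apply: is_derive_val; apply: is_derive_eq; rewrite /GRing.scale/=; ring.
Qed.

Lemma partial_nabla1_ij X k i j : kasner_domain X ->
  partial (spatial k) (nabla1 g w (spatial i) (spatial j)) X =
  partial (spatial k) (partial (spatial i) (w (spatial j))) X -
  (p i * (T i X / tm X)) *+ (i == j) * partial (spatial k) (w ord0) X.
Proof.
move=> X0.
rewrite (@partial_near _ _ (fun Y => partial (spatial i) (w (spatial j)) Y -
   (p i * (T i Y / tm Y)) *+ (i == j) * w ord0 Y))//; last first.
  by move=> Y; exact: nabla1_ij.
have D1 := dw ord0 (spatial k) X0; have D2 := ddw (spatial j) (spatial k) (spatial i) X0.
have D3 := is_derive_space_fun X (fun t => (p i * (t `^ (2 * p i) / t)) *+ (i == j)) k.
by apply: is_derive_val; apply: is_derive_eq; rewrite /GRing.scale/=; ring.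
Qed.

Lemma boxE X c : kasner_domain X ->
  box g w c X = - nabla2 g w ord0 ord0 c X + \sum_i (T i X)^-1 * nabla2 g w (spatial i) (spatial i) c X.
Proof.
move=> X0; rewrite /box.
rewrite (eq_bigr (fun a => ginv X a * nabla2 g w a a c X)).
  rewrite sum4 /ginv unlift_none mulN1r; congr (_ + _); apply: eq_bigr => i _.
  by rewrite unlift_spatial.
move=> a _; rewrite (bigD1 a)//= big1 ?addr0; first by rewrite invmx_kasner// eqxx mulr1n.
by move=> b ba; rewrite invmx_kasner// eq_sym (negPf ba) mulr0n mul0r.
Qed.

(** The sum over the spatial directions is where the Kasner relations act: sum p_i = 1 fixes the
    coefficient of the first time derivative, and sum p_i^2 = 1 that of the undifferentiated
    term. *)
Lemma box_time X : kasner_domain X ->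
  box g w ord0 X = - partial ord0 (partial ord0 (w ord0)) X
   + \sum_i (T i X)^-1 * partial (spatial i) (partial (spatial i) (w ord0)) X
   - (tm X)^-1 * partial ord0 (w ord0) X
   - \sum_i 2 * p i / tm X * ((T i X)^-1 * partial (spatial i) (w (spatial i)) X)
   + (tm X) ^- 2 * w ord0 X.
Proof.
move=> X0; have t0 : tm X != 0 by rewrite gt_eqF.
have [s1 s2] := p_kasner.
rewrite boxE// {1}/nabla2 partial_nabla1_tt//.
rewrite big1 ?subr0; last by move=> k _; rewrite chr// mul0r.
rewrite big1 ?subr0; last by move=> k _; rewrite chr// mul0r.
rewrite (eq_bigr (fun i => (T i X)^-1 * partial (spatial i) (partial (spatial i) (w ord0)) X
   - (tm X)^-1 * partial ord0 (w ord0) X * p i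
   - 2 * p i / tm X * ((T i X)^-1 * partial (spatial i) (w (spatial i)) X)
   + (tm X) ^- 2 * w ord0 X * p i ^+ 2)).
  by rewrite !(big_split, sumrN)/= -!mulr_sumr s1 s2; ring.
move=> i _; rewrite /nabla2 partial_nabla1_jt// !sum4 !chr// eqxx mulr1n mul0r.
rewrite [\sum_k christoffel _ _ (spatial i) (spatial i) X * _]big1 ?addr0; last first.
  by move=> k _; rewrite chr// mul0r.
rewrite add0r (eq_bigr (fun k => ((p i / tm X) *+ (k == i)) * nabla1 g w (spatial i) (spatial k) X)); last first.
  by move=> k _; rewrite chr.
rewrite (sum_eq_l (fun k => nabla1 g w (spatial i) (spatial k) X)) nabla1_tt// nabla1_ij// eqxx mulr1n.
by field; rewrite t0 powR_neq0.
Qed.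

Lemma box_space X j : kasner_domain X ->
  box g w (spatial j) X = - partial ord0 (partial ord0 (w (spatial j))) X
   + \sum_i (T i X)^-1 * partial (spatial i) (partial (spatial i) (w (spatial j))) X
   + (2 * p j - 1) / tm X * partial ord0 (w (spatial j)) X
   - 2 * p j / tm X * partial (spatial j) (w ord0) X.
Proof.
move=> X0; have t0 : tm X != 0 by rewrite gt_eqF.
have [s1 s2] := p_kasner.
rewrite boxE// {1}/nabla2 partial_nabla1_tj//.
rewrite big1 ?subr0; last by move=> k _; rewrite chr// mul0r.
rewrite sum4 chr// mul0r add0r.
rewrite (eq_bigr (fun k => ((p j / tm X) *+ (k == j)) * nabla1 g w ord0 (spatial k) X)); last first.
  by move=> k _; rewrite chr.
rewrite (sum_eq_l (fun k => nabla1 g w ord0 (spatial k) X)) nabla1_tj//.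
rewrite (eq_bigr (fun i => (T i X)^-1 * partial (spatial i) (partial (spatial i) (w (spatial j))) X
   - (tm X)^-1 * (partial ord0 (w (spatial j)) X - p j / tm X * w (spatial j) X) * p i
   - (2 * p j / tm X * partial (spatial j) (w ord0) X - p j ^+ 2 / tm X ^+ 2 * w (spatial j) X) *+ (i == j))).
  have SC (C : R) : \sum_i C *+ (i == j) = C.
    by rewrite (bigD1 j)//= eqxx mulr1n big1 ?addr0// => i /negPf ->.
  by rewrite !(big_split, sumrN)/= SC -!mulr_sumr s1; field.
move=> i _; rewrite /nabla2 partial_nabla1_ij// !sum4 !chr// eqxx mulr1n.
rewrite big1 ?addr0; last by move=> k _; rewrite chr// mul0r.
rewrite big1 ?addr0; last by move=> k _; rewrite chr// mul0r.
rewrite nabla1_tj// nabla1_jt//.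
have h := powR_neq0 i X0.
by have [->|_] := eqVneq i j; rewrite ?mulr1n ?mulr0n; field; rewrite t0 ?powR_neq0.
Qed.

End oneform.

End KasnerBox.

(** * Restriction to the slices of constant time *)

Section Slices.
Context {R : realType}.
Implicit Types (phi : 'rV[R]_4 -> R) (x : 'rV[R]_3) (t h : R).

Definition pt4 t x : 'rV[R]_4 := (row_mx t%:M x : 'rV[R]_(1 + 3)).

Lemma pt4_time t x : pt4 t x 0 ord0 = t.
Proof.
have -> : (ord0 : 'I_4) = lshift 3 (ord0 : 'I_1) by apply: val_inj.
by apply: (etrans (@row_mxEl R 1 1 3 t%:M x 0 ord0)); rewrite mxE eqxx mulr1n.
Qed.

Lemma pt4_space t x i : pt4 t x 0 (spatial i) = x 0 i.
Proof.
have -> : spatial i = rshift 1 i :> 'I_4 by apply: val_inj.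
exact: (@row_mxEr R 1 1 3 t%:M x 0 i).
Qed.

Lemma pt4E t x : (row_mx t%:M x : 'rV[R]_(1 + 3)) = pt4 t x.
Proof. by []. Qed.

#[local] Opaque pt4.

Lemma eq_rV4 (X Y : 'rV[R]_4) : X 0 ord0 = Y 0 ord0 ->
  (forall i, X 0 (spatial i) = Y 0 (spatial i)) -> X = Y.
Proof. by move=> e0 es; apply/rowP; apply: ord4P. Qed.

Lemma pt4_addr t x h i : pt4 t (h *: delta_mx 0 i + x) = h *: delta_mx 0 (spatial i) + pt4 t x.
Proof.
apply: eq_rV4 => [|j]; rewrite !(pt4_time, pt4_space, mxE).
  by rewrite /= mulr0 add0r.
by rewrite (inj_eq lift_inj).
Qed.

Lemma pt4_addl t x h : pt4 (h + t) x = h *: delta_mx 0 ord0 + pt4 t x.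
Proof.
apply: eq_rV4 => [|j]; rewrite !(pt4_time, pt4_space, mxE) ?mulr1//.
by rewrite /= mulr0 add0r.
Qed.

Lemma pt4_sum t x : pt4 t x = t *: delta_mx 0 ord0 + \sum_i x 0 i *: delta_mx 0 (spatial i).
Proof.
apply: eq_rV4 => [|j]; rewrite !(pt4_time, pt4_space, mxE) summxE.
  by rewrite !eqxx /= ?mulr1 big1 ?addr0// => i _; rewrite !mxE /= mulr0.
rewrite andbF mulr0 add0r (bigD1 j)//= !mxE !eqxx /= ?mulr1 big1 ?addr0// => i ij.
by rewrite !mxE (inj_eq lift_inj) eq_sym (negPf ij) mulr0.
Qed.

Definition slice phi t : 'rV[R]_3 -> R := fun x => phi (pt4 t x).

Lemma kasner_domain_pt4 t x : 0 < t -> kasner_domain (pt4 t x).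
Proof. by rewrite /kasner_domain /= pt4_time. Qed.

Lemma partial_slice phi t i : partial i (slice phi t) = slice (partial (spatial i) phi) t.
Proof.
apply/funext => x; rewrite /partial /slice /derive; congr (lim _).
by under eq_fun do rewrite /= pt4_addr.
Qed.

Lemma partials_slice phi t l : partials l (slice phi t) = slice (partials (map spatial l) phi) t.
Proof. by elim: l => //= i l ->; exact: partial_slice. Qed.

Lemma differentiable_pt4 t x : differentiable (pt4 t) x.
Proof.
rewrite (_ : pt4 t = cst (t *: delta_mx 0 ord0) + \sum_(i < 3) (fun x : 'rV[R]_3 => x 0 i *: delta_mx 0 (spatial i))).
  apply: differentiableD; first exact: differentiable_cst.
  apply: differentiable_sum => i; apply: differentiableZl; exact: differentiable_coord.
by apply/funext => y; rewrite pt4_sum fctE fct_sumE.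
Qed.

Lemma smooth_slice phi t : 0 < t -> smooth_on kasner_domain phi -> smooth_on setT (slice phi t).
Proof.
move=> t0 sphi l x _; rewrite partials_slice.
apply: (@differentiable_comp _ _ _ _ (pt4 t)); first exact: differentiable_pt4.
by apply: sphi; exact: kasner_domain_pt4.
Qed.

Definition space_periodic phi := forall i X, kasner_domain X ->
  phi (X + (2 * pi) *: delta_mx 0 (spatial i)) = phi X.

Lemma space_periodic_partial a phi : space_periodic phi -> space_periodic (partial a phi).
Proof.
move=> pphi i X X0; rewrite /partial.
have E : 'D_(delta_mx 0 a) (fun Y => phi (Y + (2 * pi) *: delta_mx 0 (spatial i))) X =
         'D_(delta_mx 0 a) phi X.
  apply: near_eq_derive; apply: filterS (kasner_domain_near X0) => Y Y0.
  exact: pphi.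
rewrite -E /derive; congr (lim _).
by under eq_fun do rewrite /= addrA.
Qed.

Lemma smooth_torus_slice phi t : 0 < t -> smooth_on kasner_domain phi -> space_periodic phi ->
  smooth_torus (slice phi t).
Proof.
move=> t0 sphi pphi; split; first exact: smooth_slice.
move=> i x; rewrite /slice addrC pt4_addr addrC pphi//; exact: kasner_domain_pt4.
Qed.

Lemma is_derive_slice phi x (tau : R) : smooth_on kasner_domain phi ->
  is_derive tau 1 (fun tau => slice phi (expR (- tau)) x)
    (- expR (- tau) * slice (partial ord0 phi) (expR (- tau)) x).
Proof.
move=> sphi; rewrite /slice.
have D1 : is_derive (expR (- tau)) 1 (fun t => phi (pt4 t x)) (partial ord0 phi (pt4 (expR (- tau)) x)).
  apply: (@is_derive_along _ _ phi (fun t => pt4 t x) _ (delta_mx 0 ord0)).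
    by move=> h; rewrite pt4_addl.
  by apply: smooth_on_is_derive sphi _; apply: kasner_domain_pt4; exact: expR_gt0.
have D2 : is_derive tau 1 (fun s : R => expR (- s)) (expR (- tau) * -1).
  have D0 : is_derive tau 1 (fun s : R => - s) (-1) by apply: is_derive_eq.
  exact: (@is_derive1_comp R expR (fun s : R => - s)).
have D3 := @is_derive1_comp R (fun t => phi (pt4 t x)) (fun s => expR (- s)) tau _ _ D1 D2.
by apply: is_derive_eq; ring.
Qed.

Lemma continuous_exp_fst : continuous (fun z : R * 'rV[R]_3 => expR (- z.1)).
Proof.
apply: (continuous_compT (f := fun z : R * 'rV[R]_3 => - z.1)); last exact: continuous_expR.
by move=> y; apply: cvgN; exact: cvg_fst.
Qed.

Lemma continuous_slice_exp phi : smooth_on kasner_domain phi ->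
  continuous (fun z : R * 'rV[R]_3 => slice phi (expR (- z.1)) z.2).
Proof.
move=> sphi z; rewrite /slice.
apply: (@continuous_comp _ _ _ (fun z : R * 'rV[R]_3 => pt4 (expR (- z.1)) z.2) phi).
  rewrite (_ : (fun z => _) = fun z : R * 'rV[R]_3 => expR (- z.1) *: delta_mx 0 ord0 +
     \sum_(i < 3) z.2 0 i *: delta_mx 0 (spatial i)); last by apply/funext => y; rewrite pt4_sum.
  apply: cvgD.
    by apply: cvgZr_tmp; exact: continuous_exp_fst.
  apply: (@cvg_big_sum R 'rV[R]_4 _ _ _ (nbhs z) (nbhs_filter z)) => i.
  apply: cvgZr_tmp.
  apply: (continuous_compT (f := fun z : R * 'rV[R]_3 => z.2) (g := fun y : 'rV[R]_3 => y 0 i : R)).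
    by move=> y; exact: cvg_snd.
  by move=> y; exact: coord_continuous.
apply: differentiable_continuous; apply: (sphi [::]).
by apply: kasner_domain_pt4; exact: expR_gt0.
Qed.

Lemma is_derive_fcoef_slice sg nu phi (tau : R) : smooth_on kasner_domain phi -> space_periodic phi ->
  is_derive tau 1 (fun tau => fcoef sg nu (slice phi (expR (- tau))))
    (- expR (- tau) * fcoef sg nu (slice (partial ord0 phi) (expR (- tau)))).
Proof.
move=> sphi pphi.
have s1 := smooth_on_partial ord0 sphi.
rewrite -fcoefZ; last first.
  by apply: smooth_continuous; apply: smooth_slice => //; exact: expR_gt0.
apply: (@is_derive_fcoef _ sg nu (fun tau => slice phi (expR (- tau)))
  (fun tau x => - expR (- tau) * slice (partial ord0 phi) (expR (- tau)) x)).
- exact: continuous_slice_exp.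
- apply: continuous_mulT; last exact: continuous_slice_exp.
  by move=> z; apply: cvgN; exact: continuous_exp_fst.
- by move=> s x; exact: is_derive_slice.
Qed.

End Slices.

(** * The first-order system for the Fourier coefficients of the eigencomponents *)

Section HatEquation.
Context {R : realType}.
Variable p : 'I_3 -> R.
Hypothesis p_kasner : is_kasner p.
Variable omega : 'I_4 -> 'rV[R]_4 -> R.
Hypothesis omega_smooth : smooth_one_form omega.
Hypothesis omega_box : box_free p omega.
Implicit Types (x : 'rV[R]_3) (mu : 'I_4) (tau : R).

(** The weight e^{-(1 - p_i) tau} and the Jacobian in dt = - e^{- tau} dtau are gathered into one
    signed exponential; the weight is trivial for mu = 0, and the Jacobian for the spatial
    indices. *)
Definition hat_rate mu : R := if unlift ord0 mu is Some i then 1 - p i else 1.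
Definition hat_sign mu : R := if mu == ord0 then -1 else 1.

Let sm mu : smooth_on kasner_domain (omega mu) := (omega_smooth mu).1.
Let pm mu : space_periodic (omega mu) := (omega_smooth mu).2.

Lemma hat_compE mu tau x : hat_comp p omega mu tau x =
  hat_sign mu * expR (- hat_rate mu * tau) * slice (omega mu) (expR (- tau)) x.
Proof.
rewrite /hat_comp /tau_comp /hat_sign /hat_rate /slice pt4E.
move: mu; apply: ord4P => [|i].
  rewrite p4_0 eqxx unlift_none; set w := omega _ _; set e := expR _.
  by rewrite /e subrr oppr0 mul0r expR0 mul1r !mulNr !mul1r.
by rewrite p4_spatial spatial_neq0 unlift_spatial !mul1r.
Qed.

Lemma is_derive_hat_comp mu tau x : is_derive tau 1 (fun s => hat_comp p omega mu s x)
  (hat_sign mu * expR (- hat_rate mu * tau) *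
   (- hat_rate mu * slice (omega mu) (expR (- tau)) x -
    expR (- tau) * slice (partial ord0 (omega mu)) (expR (- tau)) x)).
Proof.
have D1 := is_derive_slice x tau (sm mu).
have D0 : is_derive tau 1 (fun s : R => - hat_rate mu * s) (- hat_rate mu).
  by apply: is_derive_eq; rewrite /GRing.scale/= mulr1.
have D2 : is_derive tau 1 (fun s : R => expR (- hat_rate mu * s))
   (expR (- hat_rate mu * tau) * - hat_rate mu).
  exact: (@is_derive1_comp R expR (fun s => - hat_rate mu * s)).
rewrite (_ : (fun s => _) = fun s =>
    hat_sign mu * expR (- hat_rate mu * s) * slice (omega mu) (expR (- s)) x); last first.
  by apply/funext => s; exact: hat_compE.
by apply: is_derive_eq; rewrite /GRing.scale/=; ring.
Qed.

Lemma up_hat_state tau x mu : up (hat_state p omega tau x) mu = hat_comp p omega mu tau x.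
Proof. by rewrite /up /hat_state col_mxKu mxE. Qed.

Lemma dn_hat_state tau x mu :
  dn (hat_state p omega tau x) mu = derive1 (fun s => hat_comp p omega mu s x) tau.
Proof. by rewrite /dn /hat_state col_mxKd mxE. Qed.

Lemma dn_hat_stateE tau x mu : dn (hat_state p omega tau x) mu =
  hat_sign mu * expR (- hat_rate mu * tau) *
   (- hat_rate mu * slice (omega mu) (expR (- tau)) x -
    expR (- tau) * slice (partial ord0 (omega mu)) (expR (- tau)) x).
Proof.
by rewrite dn_hat_state derive1E; apply: is_derive_val; exact: is_derive_hat_comp.
Qed.

Lemma smooth_omega_slice mu t : 0 < t -> smooth_torus (slice (omega mu) t).
Proof. by move=> t0; apply: smooth_torus_slice. Qed.

Lemma smooth_domega_slice a mu t : 0 < t -> smooth_torus (slice (partial a (omega mu)) t).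
Proof.
move=> t0; apply: smooth_torus_slice => //; first exact: smooth_on_partial.
exact: space_periodic_partial.
Qed.

Lemma smooth_up_hat tau mu : smooth_torus (fun x => up (hat_state p omega tau x) mu).
Proof.
rewrite (_ : (fun x => _) = fun x => hat_sign mu * expR (- hat_rate mu * tau) *
  slice (omega mu) (expR (- tau)) x); last first.
  by apply/funext => x; rewrite up_hat_state hat_compE.
by apply: smooth_torusZ; apply: smooth_omega_slice; exact: expR_gt0.
Qed.

Lemma smooth_dn_hat tau mu : smooth_torus (fun x => dn (hat_state p omega tau x) mu).
Proof.
rewrite (_ : (fun x => _) = fun x => hat_sign mu * expR (- hat_rate mu * tau) *
   (- hat_rate mu * slice (omega mu) (expR (- tau)) x -
    expR (- tau) * slice (partial ord0 (omega mu)) (expR (- tau)) x)); last first.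
  by apply/funext => x; rewrite dn_hat_stateE.
apply: smooth_torusZ; apply: smooth_torusB; apply: smooth_torusZ.
  by apply: smooth_omega_slice; exact: expR_gt0.
by apply: smooth_domega_slice; exact: expR_gt0.
Qed.

Lemma updnE (X : 'cV[R]_8) i : X i 0 =
  match fintype.split (i : 'I_(4 + 4)) with inl j => up X j | inr j => dn X j end.
Proof.
by have := congr1 (fun Y : 'cV[R]_(4 + 4) => Y i 0) (@vsubmxK R 4 4 1 X); rewrite mxE => <-.
Qed.

Lemma smooth_hat_state tau i : smooth_torus (fun x => hat_state p omega tau x i 0).
Proof.
under eq_fun do rewrite updnE.
by case: (fintype.split _) => j; [exact: smooth_up_hat|exact: smooth_dn_hat].
Qed.

Definition ycomp (k : 'I_4 * bool) tau x : R := ecoord p k (hat_state p omega tau x).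

Lemma smooth_ycomp k tau : smooth_torus (ycomp k tau).
Proof. by apply: smooth_ecoord => i; exact: smooth_hat_state. Qed.

Lemma ycompE k tau x : ycomp k tau x = kcoef p k * (hat_sign k.1 * expR (- hat_rate k.1 * tau)) *
  (- (hat_rate k.1 + eigval p (k.1, ~~ k.2)) * slice (omega k.1) (expR (- tau)) x
   - expR (- tau) * slice (partial ord0 (omega k.1)) (expR (- tau)) x).
Proof.
by rewrite /ycomp /ecoord up_hat_state dn_hat_stateE hat_compE /kcoef; ring.
Qed.

Section mode.
Variables (sg : bool) (nu : 'rV[int]_3).

Definition fom (phi : 'rV[R]_4 -> R) (t : R) : R := fcoef sg nu (slice phi t).

Lemma fcoef_lin2 (a b : R) f g : smooth_torus f -> smooth_torus g ->
  fcoef sg nu (fun x => a * f x + b * g x) = a * fcoef sg nu f + b * fcoef sg nu g.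
Proof.
move=> sf sh; apply: etrans (fcoef_lin sg nu a (smooth_torus_continuous sf)
  (smooth_torus_continuous (smooth_torusZ b sh))) _.
by congr (_ + _); exact: fcoefZ (smooth_torus_continuous sh).
Qed.

Lemma fcoef_ycomp k tau : fcoef sg nu (ycomp k tau) =
  kcoef p k * (hat_sign k.1 * expR (- hat_rate k.1 * tau)) *
  (- (hat_rate k.1 + eigval p (k.1, ~~ k.2)) * fom (omega k.1) (expR (- tau))
   - expR (- tau) * fom (partial ord0 (omega k.1)) (expR (- tau))).
Proof.
set c := kcoef p k * _; set a := - (hat_rate _ + _).
have t0 : 0 < expR (- tau) by exact: expR_gt0.
transitivity (fcoef sg nu (fun x => (c * a) * slice (omega k.1) (expR (- tau)) x +
   (- c * expR (- tau)) * slice (partial ord0 (omega k.1)) (expR (- tau)) x)).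
  by apply: eq_fcoef => x; rewrite ycompE -/c -/a; ring.
apply: etrans (fcoef_lin2 _ _ (smooth_omega_slice k.1 t0) (smooth_domega_slice ord0 k.1 t0)) _.
by rewrite /fom; ring.
Qed.

Lemma fcoef_hat mu l tau : fcoef sg nu (partials l (fun y => up (hat_state p omega tau y) mu)) =
  hat_sign mu * expR (- hat_rate mu * tau) * fom (partials (map spatial l) (omega mu)) (expR (- tau)).
Proof.
have t0 : 0 < expR (- tau) by exact: expR_gt0.
have st : smooth_torus (slice (partials (map spatial l) (omega mu)) (expR (- tau))).
  by rewrite -partials_slice; apply: smooth_torus_partials; exact: smooth_omega_slice.
rewrite /fom -fcoefZ; last exact: smooth_torus_continuous.
apply: eq_fcoef => x.
rewrite (_ : (fun y => _) = fun y => hat_sign mu * expR (- hat_rate mu * tau) *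
  slice (omega mu) (expR (- tau)) y + 0); last first.
  by apply/funext => y; rewrite up_hat_state hat_compE addr0.
rewrite (@partials_lin _ _ _ _ _ (fun=> 0)); last 2 first.
- by have [] := smooth_omega_slice mu t0.
- exact: smooth_cst0.
by rewrite partials_cst0 addr0 partials_slice.
Qed.

(** Functions bundled with their regularity, so that a linear relation between different derivatives
    of omega can be handled as a list of coefficients and functions. *)
Definition spf : Type :=
  {phi : 'rV[R]_4 -> R | smooth_on kasner_domain phi /\ space_periodic phi}.

Definition spf_omega mu : spf := exist _ (omega mu) (conj (sm mu) (pm mu)).

Definition spf_partial a (w : spf) : spf := exist _ (partial a (sval w))
  (conj (smooth_on_partial a (svalP w).1) (space_periodic_partial a (svalP w).2)).

Lemma fom_comb t (s : seq (R * spf)) : 0 < t ->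
  (forall x, \sum_(a <- s) a.1 * slice (sval a.2) t x = 0) ->
  \sum_(a <- s) a.1 * fom (sval a.2) t = 0.
Proof.
move=> t0 E; rewrite /fom -[RHS](fcoef0 sg nu).
rewrite -(@fcoef_sum R sg nu _ s (fun a => a.1) (fun a => slice (sval a.2) t)).
  by apply: eq_fcoef => x; exact: E.
by move=> a; apply: smooth_torus_continuous; apply: smooth_torus_slice => //; case: (svalP a.2).
Qed.

Lemma fom_time t : 0 < t ->
  fom (partial ord0 (partial ord0 (omega ord0))) t =
  \sum_i (t `^ (2 * p i))^-1 * fom (partial (spatial i) (partial (spatial i) (omega ord0))) t
  - t^-1 * fom (partial ord0 (omega ord0)) t
  - \sum_i 2 * p i / t * ((t `^ (2 * p i))^-1 * fom (partial (spatial i) (omega (spatial i))) t)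
  + t ^- 2 * fom (omega ord0) t.
Proof.
move=> t0; pose w := spf_omega.
pose s : seq (R * spf) := (-1, spf_partial ord0 (spf_partial ord0 (w ord0))) ::
  (- t^-1, spf_partial ord0 (w ord0)) :: (t ^- 2, w ord0) ::
  [seq ((t `^ (2 * p i))^-1, spf_partial (spatial i) (spf_partial (spatial i) (w ord0))) | i <- index_enum 'I_3] ++
  [seq (- (2 * p i / t * (t `^ (2 * p i))^-1), spf_partial (spatial i) (w (spatial i))) | i <- index_enum 'I_3].
(* The functional [G] is arbitrary: with evaluation at a point this is the wave equation, with a
   Fourier coefficient it is the claim. *)
have sE (G : ('rV[R]_4 -> R) -> R) : \sum_(a <- s) a.1 * G (sval a.2) =
  - G (partial ord0 (partial ord0 (omega ord0)))
  + \sum_i (t `^ (2 * p i))^-1 * G (partial (spatial i) (partial (spatial i) (omega ord0)))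
  - t^-1 * G (partial ord0 (omega ord0))
  - \sum_i 2 * p i / t * ((t `^ (2 * p i))^-1 * G (partial (spatial i) (omega (spatial i))))
  + t ^- 2 * G (omega ord0).
  rewrite /s !big_cons big_cat /= !big_map /=.
  have -> : \sum_i - (2 * p i / t / t `^ (2 * p i)) * G (partial (spatial i) (omega (spatial i))) =
    - \sum_i 2 * p i / t * ((t `^ (2 * p i))^-1 * G (partial (spatial i) (omega (spatial i)))).
    by rewrite -sumrN; apply: eq_bigr => i _; rewrite mulNr mulrA.
  ring.
have := @fom_comb t s t0; rewrite (sE (fun phi => fom phi t)) => H.
have {}H := H _; rewrite -[LHS]add0r -[X in X + _ = _]H; first by ring.
move=> x; rewrite (sE (fun phi => slice phi t x)).
have := omega_box ord0 (kasner_domain_pt4 x t0).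
by rewrite box_time ?pt4_time//; exact: kasner_domain_pt4.
Qed.

Lemma fom_space t j : 0 < t ->
  fom (partial ord0 (partial ord0 (omega (spatial j)))) t =
  \sum_i (t `^ (2 * p i))^-1 * fom (partial (spatial i) (partial (spatial i) (omega (spatial j)))) t
  + (2 * p j - 1) / t * fom (partial ord0 (omega (spatial j))) t
  - 2 * p j / t * fom (partial (spatial j) (omega ord0)) t.
Proof.
move=> t0; pose w := spf_omega.
pose s : seq (R * spf) := (-1, spf_partial ord0 (spf_partial ord0 (w (spatial j)))) ::
  ((2 * p j - 1) / t, spf_partial ord0 (w (spatial j))) :: (- (2 * p j / t), spf_partial (spatial j) (w ord0)) ::
  [seq ((t `^ (2 * p i))^-1, spf_partial (spatial i) (spf_partial (spatial i) (w (spatial j)))) | i <- index_enum 'I_3].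
have sE (G : ('rV[R]_4 -> R) -> R) : \sum_(a <- s) a.1 * G (sval a.2) =
  - G (partial ord0 (partial ord0 (omega (spatial j))))
  + \sum_i (t `^ (2 * p i))^-1 * G (partial (spatial i) (partial (spatial i) (omega (spatial j))))
  + (2 * p j - 1) / t * G (partial ord0 (omega (spatial j)))
  - 2 * p j / t * G (partial (spatial j) (omega ord0)).
  by rewrite /s !big_cons /= big_map /=; ring.
have := @fom_comb t s t0; rewrite (sE (fun phi => fom phi t)) => H.
have {}H := H _; rewrite -[LHS]add0r -[X in X + _ = _]H; first by ring.
move=> x; rewrite (sE (fun phi => slice phi t x)).
have := omega_box (spatial j) (kasner_domain_pt4 x t0).
by rewrite box_space ?pt4_time//; exact: kasner_domain_pt4.
Qed.

Lemma is_derive_fom phi tau : smooth_on kasner_domain phi -> space_periodic phi ->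
  is_derive tau 1 (fun tau => fom phi (expR (- tau))) (- expR (- tau) * fom (partial ord0 phi) (expR (- tau))).
Proof. exact: is_derive_fcoef_slice. Qed.

Lemma expR_beta2 i tau : expR (- 2 * (1 - p i) * tau) = expR (- tau) ^+ 2 / expR (- tau) `^ (2 * p i).
Proof.
rewrite -expRM -expRM_natl -expRN -expRD; congr expR; ring.
Qed.

Lemma expR_beta_sqr i tau : expR (- (1 - p i) * tau) * expR (- (1 - p i) * tau) =
  expR (- tau) ^+ 2 / expR (- tau) `^ (2 * p i).
Proof. by rewrite -expR_beta2 -expRD; congr expR; ring. Qed.

Lemma Dsem_laplacian mu tau :
  \sum_i expR (- 2 * (1 - p i) * tau) *
    fcoef sg nu (partials [:: i; i] (fun y => up (hat_state p omega tau y) mu)) =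
  expR (- tau) ^+ 2 * (hat_sign mu * expR (- hat_rate mu * tau)) *
  \sum_i (expR (- tau) `^ (2 * p i))^-1 *
     fom (partial (spatial i) (partial (spatial i) (omega mu))) (expR (- tau)).
Proof.
rewrite mulr_sumr; apply: eq_bigr => i _.
by rewrite expR_beta2 fcoef_hat /=; ring.
Qed.

(** The wave equation enters here: it exchanges the spatial derivatives contained in D for
    t-derivatives of the same component. After that, the first-order system is just the chain rule
    for t = e^{- tau}. *)
Lemma Dsem_hat mu tau : let t := expR (- tau) in
  Dsem p tau (fun m l => fcoef sg nu (partials l (fun y => up (hat_state p omega tau y) m))) mu =
  hat_sign mu * expR (- hat_rate mu * tau) *
  ((hat_rate mu ^+ 2 - 2 * hat_rate mu + 1 - p4 p mu ^+ 2) * fom (omega mu) t +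
   (2 * hat_rate mu - 1) * t * fom (partial ord0 (omega mu)) t +
   t ^+ 2 * fom (partial ord0 (partial ord0 (omega mu))) t).
Proof.
move=> t; have t0 : 0 < t by exact: expR_gt0.
have tn : t != 0 by rewrite gt_eqF.
have e1 : expR (- 1 * tau) = t by rewrite /t mulN1r.
rewrite /Dsem Dsem_laplacian -/t; move: mu; apply: ord4P => [|j].
  rewrite unlift_none /hat_rate unlift_none p4_0 /hat_sign eqxx e1.
  have E2 : \sum_i 2 * p i * expR (- (1 - p i) * tau) *
      fcoef sg nu (partials [:: i] (fun y => up (hat_state p omega tau y) (spatial i))) =
    t ^+ 3 * \sum_i 2 * p i / t * ((t `^ (2 * p i))^-1 * fom (partial (spatial i) (omega (spatial i))) t).
    rewrite mulr_sumr; apply: eq_bigr => i _.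
    rewrite fcoef_hat /hat_rate unlift_spatial /hat_sign spatial_neq0 mul1r.
    rewrite mulrA -[2 * p i * _ * _]mulrA expR_beta_sqr -/t.
    by field; rewrite tn gt_eqF// powR_gt0.
  have H := fom_time t0; revert E2 H.
  generalize (fom (partial ord0 (partial ord0 (omega ord0))) t).
  generalize (fom (partial ord0 (omega ord0)) t).
  generalize (fom (omega ord0) t) => o0 o1 o2 -> ->.
  set S1 := \sum_i _; set S2 := \sum_i _.
  by field.
rewrite unlift_spatial fcoef_hat /hat_rate unlift_spatial unlift_none p4_spatial.
rewrite /hat_sign spatial_neq0 eqxx !mul1r e1 mulN1r.
have /= H := fom_space j t0; revert H.
generalize (fom (partial ord0 (partial ord0 (omega (spatial j)))) t).
generalize (fom (partial ord0 (omega (spatial j))) t).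
generalize (fom (omega (spatial j)) t) => o0 o1 o2 ->.
rewrite -/t; set S1 := \sum_i _.
generalize (fom (partial (spatial j) (omega ord0)) t) => o3.
by field.
Qed.

Lemma is_derive_ycomp k tau : is_derive tau 1 (fun tau => fcoef sg nu (ycomp k tau))
  (eigval p k * fcoef sg nu (ycomp k tau) +
   kcoef p k * Dsem p tau (fun m l => fcoef sg nu (partials l (fun y => up (hat_state p omega tau y) m))) k.1).
Proof.
pose F (s : R) := kcoef p k * (hat_sign k.1 * expR (- hat_rate k.1 * s)) *
  (- (hat_rate k.1 + eigval p (k.1, ~~ k.2)) * fom (omega k.1) (expR (- s))
   - expR (- s) * fom (partial ord0 (omega k.1)) (expR (- s))).
have E : (fun tau => fcoef sg nu (ycomp k tau)) = F by apply/funext => s; exact: fcoef_ycomp.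
have D0 : is_derive tau 1 (fun s : R => - hat_rate k.1 * s) (- hat_rate k.1).
  by apply: is_derive_eq; rewrite /GRing.scale/= mulr1.
have D3 : is_derive tau 1 (fun s : R => expR (- hat_rate k.1 * s))
   (expR (- hat_rate k.1 * tau) * - hat_rate k.1).
  exact: (@is_derive1_comp R expR (fun s => - hat_rate k.1 * s)).
have D4 : is_derive tau 1 (fun s : R => expR (- s)) (expR (- tau) * -1).
  have D5 : is_derive tau 1 (fun s : R => - s) (-1) by apply: is_derive_eq.
  exact: (@is_derive1_comp R expR (fun s : R => - s)).
(* The two eigenvalues at mu are the roots of x^2 + 2 x + 1 - p_mu^2. Eliminating one of them and
   p_mu^2 leaves a ring identity valid for both signs. *)
have [e1 e2] : eigval p k + eigval p (k.1, ~~ k.2) = -2 /\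
   eigval p k * eigval p (k.1, ~~ k.2) = 1 - p4 p k.1 ^+ 2.
  by case: (k) => m []; rewrite /eigval /=; split; ring.
have el : eigval p (k.1, ~~ k.2) = -2 - eigval p k by rewrite -e1; ring.
have ep : p4 p k.1 ^+ 2 = 1 - eigval p k * (-2 - eigval p k) by rewrite -el e2; ring.
have D1 := is_derive_fom tau (sm k.1) (pm k.1).
have D2 := is_derive_fom tau (smooth_on_partial ord0 (sm k.1)) (space_periodic_partial ord0 (pm k.1)).
have -> : eigval p k * fcoef sg nu (ycomp k tau) = eigval p k * F tau.
  by congr (_ * _); exact: fcoef_ycomp.
apply: (eq_ind_r (fun f : R -> R => is_derive tau 1 f _) _ E).
apply: is_derive_eq.
apply: etrans (congr1 (fun z => eigval p k * F tau + kcoef p k * z) (esym (Dsem_hat k.1 tau))).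
rewrite /F el ep /GRing.scale /=.
generalize (fom (partial ord0 (partial ord0 (omega k.1))) (expR (- tau))).
generalize (fom (partial ord0 (omega k.1)) (expR (- tau))).
generalize (fom (omega k.1) (expR (- tau))) => o0 o1 o2.
ring.
Qed.

End mode.

End HatEquation.

(** * Decay of Fourier coefficients *)

Section ScalarEstimates.
Context {R : realType}.

(** The inequality 1 + e' tau <= e^{e' tau} raised to the power N. Taking e' = e / (N + 1) rather
    than e / N covers N = 0. *)
Lemma poly_le_expR (N : nat) (e : R) : 0 < e ->
  exists2 C, 0 <= C & forall tau : R, 0 <= tau -> (1 + tau) ^+ N <= C * expR (e * tau).
Proof.
move=> e0; pose e' := e / N.+1%:R.
have e'0 : 0 < e' by rewrite divr_gt0.
exists ((1 + e'^-1) ^+ N) => [|tau tau0]; first by rewrite exprn_ge0// addr_ge0// invr_ge0 ltW.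
have h1 : 1 + tau <= (1 + e'^-1) * expR (e' * tau).
  have h2 : 1 + e' * tau <= expR (e' * tau) by exact: expR_ge1Dx.
  have h3 : 1 + tau <= (1 + e'^-1) * (1 + e' * tau).
    rewrite mulrDl mul1r mulrDr mulr1 mulrA mulVf ?gt_eqF// mul1r.
    have : 0 <= e' * tau by rewrite mulr_ge0// ltW.
    have : 0 <= e'^-1 by rewrite invr_ge0 ltW.
    lra.
  by rewrite (le_trans h3)// ler_wpM2l// addr_ge0// invr_ge0 ltW.
have h4 : (1 + tau) ^+ N <= ((1 + e'^-1) * expR (e' * tau)) ^+ N.
  by rewrite lerXn2r// nnegrE ?addr_ge0// mulr_ge0 ?expR_ge0// addr_ge0// invr_ge0 ltW.
rewrite (le_trans h4)// exprMn ler_wpM2l ?exprn_ge0 ?addr_ge0 ?invr_ge0 ?(ltW e'0)//.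
rewrite -expRM_natl ler_expR mulrA ler_wpM2r// /e'.
by rewrite mulrCA ler_piMr ?(ltW e0)// ler_pdivrMr// mul1r ler_nat.
Qed.

Lemma expR_decay_le0 (x C c t0 : R) : 0 < c ->
  (forall t, t0 <= t -> x <= C * expR (- c * t)) -> x <= 0.
Proof.
move=> c0 H; rewrite leNgt; apply/negP => x0.
(* At this time |C| <= c t x, so by e^{c t} >= 1 + c t the right-hand side is at most |C| / (1 + c
   t) < x. *)
pose t := Num.max (Num.max t0 0) (`|C| / (c * x)).
have t00 : t0 <= t by rewrite !le_max lexx.
have tp : 0 <= t by rewrite !le_max lexx orbT.
have tC : `|C| / (c * x) <= t by rewrite le_max lexx orbT.
have := H _ t00; apply/negP; rewrite -ltNge.
have e1 : 1 + c * t <= expR (c * t) by exact: expR_ge1Dx.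
rewrite mulNr expRN (le_lt_trans (ler_wpM2r _ (ler_norm C)))// ?invr_ge0 ?expR_ge0//.
rewrite ltr_pdivrMr ?expR_gt0// mulrC (lt_le_trans (_ : `|C| < (1 + c * t) * x))//; last first.
  by rewrite ler_wpM2r// ltW.
move: tC; rewrite ler_pdivrMr ?mulr_gt0// => tC.
by rewrite mulrDl mul1r (le_lt_trans tC)// mulrCA mulrA ltrDr.
Qed.

(** Integration from infinity. The function [phi] is nondecreasing by the bound on the source, and
    lies below a decaying exponential at large times, hence phi <= 0. The a priori bound at rate b
    excludes a multiple of e^{lam t}; its constant [C1] does not reach the conclusion. *)
Lemma ode_decay_half (z dz : R -> R) (lam a b C C1 tau : R) :
  0 < a + lam -> 0 < b + lam -> 0 <= C ->
  (forall t : R, is_derive t 1 z (lam * z t + dz t)) ->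
  (forall t, 0 <= t -> - (C * expR (- a * t)) <= dz t) ->
  (forall t, 0 <= t -> z t <= C1 * expR (- b * t)) ->
  0 <= tau -> z tau <= C / (a + lam) * expR (- a * tau).
Proof.
move=> al bl C0 zd dzb zb tau0.
pose phi t := expR (- lam * t) * z t - C / (a + lam) * expR (- (a + lam) * t).
have ed (c t : R) : is_derive t 1 (fun s : R => expR (c * s)) (expR (c * t) * c).
  have D0 : is_derive t 1 (fun s : R => c * s) c by apply: is_derive_eq; rewrite /GRing.scale/= mulr1.
  exact: (@is_derive1_comp R expR (fun s => c * s)).
have phid (t : R) : is_derive t 1 phi (expR (- lam * t) * dz t + C * expR (- (a + lam) * t)).
  have D1 := ed (- lam) t; have D2 := ed (- (a + lam)) t; have D3 := zd t.
  by apply: is_derive_eq; rewrite /GRing.scale/=; field; rewrite gt_eqF.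
have phi_le t : tau <= t -> phi tau <= phi t.
  move=> taut.
  have cphi : continuous phi.
    by apply: continuous_is_derive => s; eexists; exact: phid.
  apply: (@ger0_derive1_le_cc R phi tau t) => //.
  - move=> s; rewrite in_itv/= => /andP[ts _]; rewrite derive1E (is_derive_val (phid s)).
    have s0 : 0 <= s by rewrite (le_trans tau0)// ltW.
    have h := dzb s s0.
    have -> : - (a + lam) * s = - lam * s + - a * s by ring.
    rewrite expRD mulrCA -mulrDr mulr_ge0 ?expR_ge0//; lra.
  - exact: continuous_subspaceT.
  - by rewrite in_itv/= lexx.
  - by rewrite in_itv/= lexx taut.
have : phi tau <= 0.
  apply: (@expR_decay_le0 _ C1 (b + lam) tau) => // t taut.
  have t0 : 0 <= t by rewrite (le_trans tau0).
  rewrite (le_trans (phi_le _ taut))// /phi.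
  rewrite (@le_trans _ _ (expR (- lam * t) * z t))//.
    by rewrite gerBl mulr_ge0 ?expR_ge0// divr_ge0// ltW.
  have -> : - (b + lam) * t = - lam * t + - b * t by ring.
  by rewrite expRD mulrCA ler_wpM2l ?expR_ge0//; exact: zb.
rewrite /phi subr_le0.
have -> : - (a + lam) * tau = - lam * tau + - a * tau by ring.
by rewrite expRD mulrCA ler_pM2l ?expR_gt0.
Qed.

Lemma ode_decay (z dz : R -> R) (lam a b C C1 tau : R) :
  0 < a + lam -> 0 < b + lam -> 0 <= C ->
  (forall t : R, is_derive t 1 z (lam * z t + dz t)) ->
  (forall t, 0 <= t -> `|dz t| <= C * expR (- a * t)) ->
  (forall t, 0 <= t -> `|z t| <= C1 * expR (- b * t)) ->
  0 <= tau -> `|z tau| <= C / (a + lam) * expR (- a * tau).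
Proof.
move=> al bl C0 zd dzb zb tau0; rewrite ler_norml; apply/andP; split; last first.
  apply: (@ode_decay_half z dz lam a b C C1 tau) => // t t0.
    by have := dzb t t0; rewrite ler_norml => /andP[].
  by rewrite (le_trans (ler_norm _))// zb.
rewrite lerNl.
apply: (@ode_decay_half (fun t => - z t) (fun t => - dz t) lam a b C C1 tau) => //.
- move=> t; have D := zd t.
  by apply: is_derive_eq; rewrite mulrN opprD.
- by move=> t t0; rewrite lerN2 (le_trans (ler_norm _))// dzb.
- by move=> t t0; rewrite (le_trans (ler_norm _))// normrN zb.
Qed.

Lemma homogeneous_ode (z : R -> R) (lam tau : R) :
  (forall t : R, is_derive t 1 z (lam * z t)) -> z tau = expR (lam * tau) * z 0.
Proof.
move=> zd.
have ed (c t : R) : is_derive t 1 (fun s : R => expR (c * s)) (expR (c * t) * c).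
  have D0 : is_derive t 1 (fun s : R => c * s) c by apply: is_derive_eq; rewrite /GRing.scale/= mulr1.
  exact: (@is_derive1_comp R expR (fun s => c * s)).
have H : expR (- lam * tau) * z tau = expR (- lam * 0) * z 0.
  apply: (@is_derive_0_is_cst R (fun t => expR (- lam * t) * z t)) => t.
  have D1 := ed (- lam) t; have D2 := zd t.
  by apply: is_derive_eq; rewrite /GRing.scale/=; ring.
rewrite mulr0 expR0 mul1r in H.
by rewrite -H mulrA -expRD mulNr subrr expR0 mul1r.
Qed.

End ScalarEstimates.

Section ModeMultiplier.
Context {R : realType}.
Variable p : 'I_3 -> R.
Local Notation K := ('I_4 * bool)%type.

(** The symbol of d_l on real coefficients: [mode_mult] is the signed monomial in the frequencies,
    and [mode_flip] tells whether the cosine or the sine coefficient is left. *)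
Fixpoint mode_mult (sg : bool) (nu : 'rV[int]_3) (l : seq 'I_3) : R :=
  if l is i :: l' then (if sg then 1 else -1) * (nu 0 i)%:~R * mode_mult (~~ sg) nu l' else 1.

Fixpoint mode_flip (sg : bool) (l : seq 'I_3) : bool :=
  if l is i :: l' then mode_flip (~~ sg) l' else sg.

Lemma fcoef_partials sg nu l (f : 'rV[R]_3 -> R) : smooth_torus f ->
  fcoef sg nu (partials l f) = mode_mult sg nu l * fcoef (mode_flip sg l) nu f.
Proof.
move=> sf; elim: l sg => [|i l IH] sg /=; first by rewrite mul1r.
rewrite [LHS](@fcoef_partial _ sg nu i (partials l f) (smooth_torus_partials l sf)).
by rewrite (IH (~~ sg)) mulrA.
Qed.

(* From the Fourier coefficients [Y sg k] of the components along the eigenvectors to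
   those of the derivatives of the components [up]. *)
Definition mode_comp (Y : bool -> K -> R) sg nu (mu : 'I_4) (l : seq 'I_3) : R :=
  mode_mult sg nu l * (Y (mode_flip sg l) (mu, true) + Y (mode_flip sg l) (mu, false)).

Definition fval (I : Type) (f : I -> 'rV[R]_3 -> R) sg nu : I -> seq 'I_3 -> R :=
  fun i l => fcoef sg nu (partials l (f i)).

Lemma xval_fval_cat (I : Type) (f : I -> 'rV[R]_3 -> R) sg nu l X tau :
  (forall i, smooth_torus (f i)) ->
  xval (fun i l' => fval f sg nu i (l ++ l')) X tau =
  mode_mult sg nu l * xval (fval f (mode_flip sg l) nu) X tau.
Proof.
move=> sf; rewrite /xval mulr_sumr; apply: eq_bigr => t _.
rewrite /fval partials_cat mulrCA; congr (_ * _); apply: fcoef_partials.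
exact: smooth_torus_partials.
Qed.

Lemma xcomp_fval (I : Type) (f : I -> 'rV[R]_3 -> R) sg nu G tau mu l :
  (forall i, smooth_torus (f i)) ->
  xcomp (fval f sg nu) G tau mu l =
  mode_comp (fun sg k => xval (fval f sg nu) (G k) tau) sg nu mu l.
Proof. by move=> sf; rewrite /xcomp /mode_comp !xval_fval_cat// mulrDr. Qed.

Lemma fcoef_xval (I : Type) (f : I -> 'rV[R]_3 -> R) sg nu X tau :
  (forall i, smooth_torus (f i)) ->
  fcoef sg nu (fun x => xval (Dpt f x) X tau) = xval (fval f sg nu) X tau.
Proof.
move=> sf; apply: (@fcoef_sum R sg nu _ X (fun t => xcoef t tau) (fun t => partials (xl t) (f (xi t)))).
by move=> t; apply: smooth_torus_continuous; exact: smooth_torus_partials.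
Qed.

Lemma freq_le (nu : 'rV[int]_3) i : `|(nu 0 i)%:~R| <= 1 + freq_sqr nu :> R.
Proof.
have : (nu 0 i)%:~R ^+ 2 <= freq_sqr nu :> R.
  by rewrite /freq_sqr (bigD1 i)//= lerDl; apply: sumr_ge0 => j _; exact: sqr_ge0.
rewrite -[X in X <= _]real_normK ?num_real//; set x := `|_| => h.
have : 0 <= (x - 1) ^+ 2 by exact: sqr_ge0.
have : 0 <= x by rewrite /x.
rewrite sqrrB expr1n mulr1; nra.
Qed.

Hypothesis p_bound : forall i, `|p i| <= 1.
Hypothesis p_ordered : forall i, p i <= p ord_max.
Hypothesis p_lt1 : p ord_max < 1.

(** Every exponential in D decays at least like e^{- delta tau}, and its derivatives cost at most (1
    + |n|^2)^2. The constant is 18 = 2 (3 + 6): three second-order terms, at most three first-order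
    terms with |2 p_i| <= 2, and two eigencomponents in each. *)
Lemma Dsem_mode_bound (Y : bool -> K -> R) (B tau : R) sg nu mu : 0 <= B -> 0 <= tau ->
  (forall sg k, `|Y sg k| <= B) ->
  `|Dsem p tau (mode_comp Y sg nu) mu| <= 18 * (1 + freq_sqr nu) ^+ 2 * expR (- delta p * tau) * B.
Proof.
move=> B0 tau0 YB.
have q1 : 1 <= 1 + freq_sqr nu :> R by rewrite lerDl freq_sqr_ge0.
set q : R := 1 + freq_sqr nu.
have d0 : 0 < delta p by rewrite subr_gt0.
have e0 : 0 <= expR (- delta p * tau) by exact: expR_ge0.
have be i : delta p <= 1 - p i by rewrite lerD2l lerN2.
have e1 i : expR (- 2 * (1 - p i) * tau) <= expR (- delta p * tau).
  rewrite ler_expR ler_wpM2r// mulNr lerN2 (le_trans (be i))// ler_peMl ?ler1n//.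
  by have := be i; lra.
have e2 i : expR (- (1 - p i) * tau) <= expR (- delta p * tau).
  by rewrite ler_expR ler_wpM2r// lerN2.
have Y2 s m : `|Y s (m, true) + Y s (m, false)| <= 2 * B.
  by rewrite (le_trans (ler_normD _ _))//; have := YB s (m, true); have := YB s (m, false); lra.
have nsg s : `|(if s then 1 else -1 : R)| = 1 by case: s; rewrite ?normrN normr1.
have W1 s m i : `|mode_comp Y s nu m [:: i]| <= q ^+ 2 * (2 * B).
  rewrite /mode_comp /= mulr1 normrM normrM nsg mul1r ler_pM//.
  by rewrite (le_trans (freq_le nu i))// expr2 ler_peMl// (le_trans _ q1).
have W2 s m i : `|mode_comp Y s nu m [:: i; i]| <= q ^+ 2 * (2 * B).
  rewrite /mode_comp /= mulr1 normrM !normrM !nsg !mul1r ler_pM//.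
  by rewrite expr2 ler_pM// freq_le.
set E := expR (- delta p * tau).
have S1 : `|\sum_i expR (- 2 * (1 - p i) * tau) * mode_comp Y sg nu mu [:: i; i]| <= 3 * (E * (q ^+ 2 * (2 * B))).
  rewrite (le_trans (ler_norm_sum _ _ _))//.
  rewrite (le_trans (ler_sum _ (_ : forall i _, _ <= E * (q ^+ 2 * (2 * B)))))//.
    by move=> i _; rewrite normrM (ger0_norm (expR_ge0 _)); apply: ler_pM; [exact: expR_ge0|by []|exact: e1|exact: W2].
  by rewrite sumr_const card_ord -[leLHS]mulr_natl.
have T i m : `|2 * p i * expR (- (1 - p i) * tau) * mode_comp Y sg nu m [:: i]| <= 2 * (E * (q ^+ 2 * (2 * B))).
  rewrite (normrM (2 * p i * _)) (normrM (2 * p i)) (normrM 2) normr_nat -!mulrA ler_pM2l//.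
  rewrite (le_trans (ler_piMl _ (p_bound i)))// ?mulr_ge0//.
  rewrite (ger0_norm (expR_ge0 _)).
  by apply: ler_pM; [exact: expR_ge0|by []|exact: e2|rewrite mulrA -expr2; exact: W1].
have S2 : `|if unlift ord0 mu is Some j then 2 * p j * expR (- (1 - p j) * tau) * mode_comp Y sg nu ord0 [:: j]
   else \sum_i 2 * p i * expR (- (1 - p i) * tau) * mode_comp Y sg nu (spatial i) [:: i]| <= 6 * (E * (q ^+ 2 * (2 * B))).
  have P0 : 0 <= E * (q ^+ 2 * (2 * B)) by rewrite mulr_ge0// mulr_ge0 ?sqr_ge0// mulr_ge0.
  case: unlift => [j|]; first by rewrite (le_trans (T _ _))// ler_wpM2r// ler_nat.
  rewrite (le_trans (ler_norm_sum _ _ _))//.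
  rewrite (le_trans (ler_sum _ (fun i _ => T i (spatial i))))//.
  rewrite sumr_const card_ord -[leLHS]mulr_natl; lra.
rewrite /Dsem (le_trans (ler_normD _ _))// (le_trans (lerD S1 S2))//.
by rewrite le_eqVlt; apply/orP; left; apply/eqP; ring.
Qed.

End ModeMultiplier.

Section RapidDecay.
Context {R : realType}.
Implicit Types (Z : R -> bool -> 'rV[int]_3 -> R) (a e : R).

(* [Z tau sg nu] are Fourier coefficients of a function of size
   [exp (- (a - e) * tau)] in every Sobolev norm, for every [e > 0]. *)
Definition rapid_decay a Z := forall (s : nat) e, 0 < e ->
  exists2 C, 0 <= C & forall tau sg nu, 0 <= tau ->
    `|Z tau sg nu| <= C * (1 + freq_sqr nu) ^- s * expR (- (a - e) * tau).

Lemma rapid_decay_ext a Z1 Z2 : (forall tau sg nu, 0 <= tau -> Z1 tau sg nu = Z2 tau sg nu) ->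
  rapid_decay a Z1 -> rapid_decay a Z2.
Proof.
move=> E H s e e0; have [C C0 HC] := H s e e0; exists C => // tau sg nu tau0.
by rewrite -E// HC.
Qed.

Lemma rapid_decay_weaken a b Z : b <= a -> rapid_decay a Z -> rapid_decay b Z.
Proof.
move=> ba H s e e0; have [C C0 HC] := H s e e0; exists C => // tau sg nu tau0.
rewrite (le_trans (HC _ _ _ tau0))// ler_wpM2l//.
  by rewrite mulr_ge0// invr_ge0 exprn_ge0// ltW// freq_gt0.
by rewrite ler_expR ler_wpM2r// lerN2 lerD2r.
Qed.

Lemma rapid_decay_lin a (c : R) Z1 Z2 : rapid_decay a Z1 -> rapid_decay a Z2 ->
  rapid_decay a (fun tau sg nu => c * Z1 tau sg nu + Z2 tau sg nu).
Proof.
move=> H1 H2 s e e0; have [C1 C10 HC1] := H1 s e e0; have [C2 C20 HC2] := H2 s e e0.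
exists (`|c| * C1 + C2) => [|tau sg nu tau0]; first by rewrite addr_ge0// mulr_ge0.
rewrite (le_trans (ler_normD _ _))// normrM !mulrDl -!mulrA lerD//.
  by rewrite ler_wpM2l// mulrA HC1.
by rewrite mulrA HC2.
Qed.

Lemma rapid_decay0 a : rapid_decay a (fun _ _ _ => 0).
Proof.
move=> s e e0; exists 0 => // tau sg nu _; by rewrite normr0 mul0r mul0r.
Qed.

Lemma xcoef_le (I : Type) (t : @xterm R I) a e : a <= xe t -> 0 < e ->
  exists2 C, 0 <= C & forall tau, 0 <= tau -> `|xcoef t tau| <= C * expR (- (a - e) * tau).
Proof.
move=> at_ e0; have [C C0 HC] := poly_le_expR (xj t) e0.
exists (`|xc t| * C) => [|tau tau0]; first by rewrite mulr_ge0.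
rewrite /xcoef normrM -mulrA ler_wpM2l// normrM (ger0_norm (expR_ge0 _)).
rewrite ger0_norm ?exprn_ge0//.
have h : tau ^+ xj t <= C * expR (e * tau).
  by rewrite (le_trans _ (HC _ tau0))// lerXn2r// ?nnegrE ?addr_ge0// lerDr.
rewrite (le_trans (ler_wpM2r (expR_ge0 _) h))// -mulrA -expRD ler_wpM2l// ler_expR.
rewrite -mulrDl ler_wpM2r//; lra.
Qed.

Lemma rapid_decay_xval (I : Type) (f : I -> 'rV[R]_3 -> R) (X : seq (xterm I)) a :
  (forall i, smooth_torus (f i)) -> all (fun t => a <= xe t) X ->
  rapid_decay a (fun tau sg nu => xval (fval f sg nu) X tau).
Proof.
move=> sf; elim: X => [|t X IH] /=.
  by move=> _; apply: rapid_decay_ext (rapid_decay0 a) => *; rewrite xval_nil.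
case/andP => at_ /IH HX s e e0.
have [C1 C10 H1] := HX s e e0; have [C2 C20 H2] := xcoef_le at_ e0.
have [C3 C30 H3] := fcoef_rapid s (smooth_torus_partials (xl t) (sf (xi t))).
exists (C2 * C3 + C1) => [|tau sg nu tau0]; first by rewrite addr_ge0// mulr_ge0.
rewrite xval_cons (le_trans (ler_normD _ _))// !mulrDl lerD ?H1// normrM.
rewrite (_ : _ * _ * _ * _ = (C2 * expR (- (a - e) * tau)) * (C3 * (1 + freq_sqr nu) ^- s)).
  by rewrite ler_pM// ?H2// H3.
by rewrite mulrACA -mulrA; ring.
Qed.

Lemma japanese_le (tau : R) : 0 <= tau -> japanese tau <= 1 + tau.
Proof.
move=> tau0; rewrite /japanese -[leRHS]ger0_norm ?addr_ge0// -sqrtr_sqr ler_wsqrtr//.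
by rewrite sqrrD expr1n mul1r addrAC lerDl mulrn_wge0.
Qed.

Lemma japanese_ge1 (tau : R) : 1 <= japanese tau.
Proof. by rewrite /japanese -[leLHS]sqrtr1 ler_wsqrtr// lerDl sqr_ge0. Qed.

(** The epsilon in [rapid_decay] absorbs the power of <tau>, which may change with the Sobolev
    index. *)
Lemma rapid_decay_sobolev m (v : R -> 'rV[R]_3 -> 'cV[R]_m) a k :
  (forall s : R, exists (C : R) (N : nat), forall tau : R, 0 <= tau ->
     (sobolev_norm s (v tau) <= (C * japanese tau ^+ N * expR (- (a * tau)))%:E)%E) ->
  rapid_decay a (fun tau sg nu => fcoef sg nu (fun x => v tau x k 0)).
Proof.
move=> H s e e0; have [C [N HC]] := H (2 * s)%:R.
have [D D0 HD] := poly_le_expR N e0.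
exists (`|C| * D) => [|tau sg nu tau0]; first by rewrite mulr_ge0.
have q0 : 0 <= (1 + freq_sqr nu) ^- s :> R.
  by rewrite invr_ge0 exprn_ge0// ltW// freq_gt0.
have B0 : 0 <= `|C| * D * expR (- (a - e) * tau) by rewrite !mulr_ge0// expR_ge0.
rewrite mulrAC; apply: sobolev_norm_fcoef => //.
apply: le_trans (HC tau tau0) _; rewrite lee_fin.
have j0 : 0 <= japanese tau ^+ N * expR (- (a * tau)).
  by rewrite mulr_ge0 ?expR_ge0// exprn_ge0// (le_trans _ (japanese_ge1 tau)).
rewrite -mulrA (le_trans (ler_wpM2r j0 (ler_norm C)))// -mulrA ler_wpM2l//.
have h : japanese tau ^+ N <= D * expR (e * tau).
  rewrite (le_trans _ (HD _ tau0))// lerXn2r// ?nnegrE ?addr_ge0//.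
    by rewrite (le_trans _ (japanese_ge1 tau)).
  exact: japanese_le.
rewrite (le_trans (ler_wpM2r (expR_ge0 _) h))// -mulrA -expRD.
by rewrite (_ : e * tau + - (a * tau) = - (a - e) * tau)//; ring.
Qed.

Lemma rapid_decay_sum (I : Type) (r : seq I) a (c : I -> R) (Z : I -> R -> bool -> 'rV[int]_3 -> R) :
  (forall i, rapid_decay a (Z i)) ->
  rapid_decay a (fun tau sg nu => \sum_(i <- r) c i * Z i tau sg nu).
Proof.
move=> H; elim: r => [|i r IH].
  by apply: rapid_decay_ext (rapid_decay0 a) => *; rewrite big_nil.
by apply: rapid_decay_ext (rapid_decay_lin (c i) (H i) IH) => *; rewrite big_cons.
Qed.

End RapidDecay.

(** * Exponents of the formal solution *)

Section FormalExponents.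
Context {R : realType}.
Variable p : 'I_3 -> R.
Hypothesis p_kasner : is_kasner p.
Hypothesis p_ordered : forall i j : 'I_3, (i <= j)%N -> p i <= p j.
Hypothesis p_nonflat : p ord_max < 1.
Local Notation K := ('I_4 * bool)%type.

Lemma all_flatten (T J : Type) (a : pred T) (F : J -> seq T) (s : seq J) :
  (forall j, all a (F j)) -> all a (flatten [seq F j | j <- s]).
Proof. by move=> H; elim: s => //= j s IH; rewrite all_cat H. Qed.

Lemma xD_all (I : Type) (P : R -> bool) (G : K -> seq (@xterm R I)) mu :
  (forall i b, all (fun t => P (2 * (1 - p i) + xe t)) (G (mu, b))) ->
  (forall j b, mu = spatial j -> all (fun t => P (1 - p j + xe t)) (G (ord0, b))) ->
  (forall j b, mu = ord0 -> all (fun t => P (1 - p j + xe t)) (G (spatial j, b))) ->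
  all (fun t => P (xe t)) (xD p G mu).
Proof.
move=> H1 H2 H3; rewrite /xD all_cat; apply/andP; split.
  by apply: all_flatten => i; rewrite !all_map all_cat !H1.
case: unliftP => [j|] muE; first by rewrite !all_map all_cat !H2.
by apply: all_flatten => i; rewrite !all_map all_cat !H3.
Qed.

Lemma xD_all_idx (I : Type) (P : I -> bool) (G : K -> seq (@xterm R I)) mu :
  (forall k, all (fun t => P (xi t)) (G k)) -> all (fun t => P (xi t)) (xD p G mu).
Proof.
move=> H; rewrite /xD all_cat; apply/andP; split.
  by apply: all_flatten => i; rewrite !all_map all_cat !H.
case: unlift => [j|]; first by rewrite !all_map all_cat !H.
by apply: all_flatten => i; rewrite !all_map all_cat !H.
Qed.

Lemma xKD_all (I : Type) (P : R -> bool) (G : K -> seq (@xterm R I)) k :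
  all (fun t => P (xe t)) (xD p G k.1) -> all (fun t => P (xe t)) (xKD p G k).
Proof. by move=> H; apply: xsolve_all; rewrite all_map. Qed.

Lemma xat0_all (I : Type) (P : R -> bool) lam (X : seq (@xterm R I)) :
  P (- lam) -> all (fun t => P (xe t)) (xat0 lam X).
Proof. by move=> H; rewrite all_map; apply/allT => t /=. Qed.

Lemma xnew_all (P : R -> bool) n k (X : seq (@xterm R K)) :
  ((n <= window_index p k)%N -> P (- eigval p k)) ->
  all (fun t => P (xe t)) (xnew p n k X).
Proof.
rewrite /xnew all_cat => H; apply/andP; split; case: ifP => //= h.
  by apply: xat0_all; exact: H.
by rewrite H// (eqP h).
Qed.

(** The operator D raises exponents by at least delta and solving the equation preserves them. A
    homogeneous term is kept only for n up to the window of k, and there - eigval is at least (n -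
    1) delta. *)
Lemma xg_ge n k : all (fun t => n.-1%:R * delta p <= xe t) (xg p n k).
Proof.
have d0 := delta_gt0 p_nonflat.
elim: n k => [//|n IH] k; rewrite [xg _ _ _]/= all_cat; apply/andP; split.
  apply: (@xnew_all (fun e => n%:R * delta p <= e)) => h.
  have /andP[w _] := window_index_itv p_kasner p_ordered p_nonflat k.
  rewrite (le_trans _ w)// ler_wpM2r ?(ltW d0)// ler_nat.
  by move: h; rewrite /window_index /=; lia.
case: n IH => [_|n IH].
  by apply: (@xKD_all _ (fun e => _ <= e)); apply: (@xD_all _ (fun e => _ <= e)).
have sh i (e : R) : delta p <= e -> all (fun t => n.+1%:R * delta p <= e + xe t) (xg p n.+1 i).
  move=> de; apply: sub_all (IH i) => t /=; rewrite -[in n.+1]addn1 natrD mulrDl mul1r; lra.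
have dl i := delta_le p_ordered i.
apply: (@xKD_all _ (fun e => n.+1%:R * delta p <= e)).
apply: (@xD_all _ (fun e => n.+1%:R * delta p <= e)) => [i b|j b _|j b _]; apply: sh => //.
by have := dl i; lra.
Qed.

End FormalExponents.

(** * Approximation of the solution by the formal solution *)

Section FormalApproximation.
Context {R : realType}.
Variable p : 'I_3 -> R.
Hypothesis p_kasner : is_kasner p.
Hypothesis p_ordered : forall i j : 'I_3, (i <= j)%N -> p i <= p j.
Hypothesis p_nonflat : p ord_max < 1.
Local Notation K := ('I_4 * bool)%type.
Local Notation w := (window_index p).

Let p_neq0 := p4_neq0 p_kasner p_ordered p_nonflat.
Let d0 := delta_gt0 p_nonflat.

Lemma rapid_decay_ecoord (v : R -> 'rV[R]_3 -> 'cV[R]_8) a k :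
  (forall tau i, 0 <= tau -> smooth_torus (fun x => v tau x i 0)) ->
  (forall s : R, exists (C : R) (N : nat), forall tau : R, 0 <= tau ->
     (sobolev_norm s (v tau) <= (C * japanese tau ^+ N * expR (- (a * tau)))%:E)%E) ->
  rapid_decay a (fun tau sg nu => fcoef sg nu (fun x => ecoord p k (v tau x))).
Proof.
move=> sv H.
have Hs := rapid_decay_sum (index_enum 'I_8) (erow p k 0) (fun i => rapid_decay_sobolev i H).
apply: rapid_decay_ext Hs => tau sg nu tau0.
apply: esym; apply: etrans (fcoef_sum sg nu (index_enum 'I_8) (erow p k 0) (F := fun i x => v tau x i 0) _).
  by apply: eq_fcoef => x; rewrite -erowE mxE.
by move=> i; apply: smooth_torus_continuous; exact: sv.
Qed.

Lemma xg_at0 (Phi : K -> seq 'I_3 -> R) n k : (n < w k)%N -> xval Phi (xg p n k) 0 = 0.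
Proof.
case: n => [|n] nk; first by rewrite xval_nil.
rewrite [xg _ _ _]/= /xnew (ltnW nk) (ltn_eqF nk) !xval_cat xval_at0 mulr0 expR0 xval_nil; ring.
Qed.

(** Counterpart of [V_window] for the formal solution: before its window is reached, an
    eigencomponent starts from zero. *)
Lemma xG_at0 (Phi : K -> seq 'I_3 -> R) n k : (n < w k)%N -> xval Phi (xG p n k) 0 = 0.
Proof.
elim: n => [|n IH] nk; first by rewrite xval_nil.
rewrite (_ : xG p n.+1 k = xG p n k ++ xg p n.+1 k)// xval_cat IH ?xg_at0 ?addr0//.
exact: ltnW.
Qed.

Lemma xG_at0_window (Phi : K -> seq 'I_3 -> R) k : xval Phi (xG p (w k) k) 0 = Phi k [::].
Proof.
have -> : w k = (w k).-1.+1 by [].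
rewrite (_ : xG p (w k).-1.+1 k = xG p (w k).-1 k ++ xg p (w k).-1.+1 k)// xval_cat xG_at0 ?add0r//.
rewrite [xg _ _ _]/= /xnew; have -> : (w k).-1.+1 = w k by [].
rewrite leqnn eqxx !xval_cat xval_at0 mulr0 expR0 xval_cons xval_nil /xcoef /= mulr0 expR0 expr0; ring.
Qed.

Variable omega : 'I_4 -> 'rV[R]_4 -> R.
Hypothesis omega_smooth : smooth_one_form omega.
Hypothesis omega_box : box_free p omega.
Variable u : K -> 'rV[R]_3 -> R.
Hypothesis u_smooth : forall k, smooth_torus (u k).

Local Notation Y tau sg nu k := (fcoef sg nu (ycomp p omega k tau)).
Local Notation b n tau sg nu k := (xval (fval u sg nu) (xG p n k) tau).

Lemma is_derive_mode (sg : bool) (nu : 'rV[int]_3) k (tau : R) : is_derive tau 1 (fun tau => Y tau sg nu k)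
  (eigval p k * Y tau sg nu k +
   kcoef p k * Dsem p tau (mode_comp (fun sg k => Y tau sg nu k) sg nu) k.1).
Proof.
have D := is_derive_ycomp p_kasner omega_smooth omega_box sg nu k tau.
apply: (is_derive_eq D); congr (_ + _ * _); apply: Dsem_ext => m l.
rewrite fcoef_partials; last exact: smooth_up_hat.
rewrite /mode_comp; congr (_ * _).
rewrite -fcoefD; last 2 first.
- by apply: smooth_torus_continuous; exact: smooth_ycomp.
- by apply: smooth_torus_continuous; exact: smooth_ycomp.
by apply: eq_fcoef => x; rewrite /ycomp -up_ecoord.
Qed.

Lemma is_derive_mode_formal (sg : bool) (nu : 'rV[int]_3) n k (tau : R) :
  is_derive tau 1 (fun tau => b n.+1 tau sg nu k)
  (eigval p k * b n.+1 tau sg nu k +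
   kcoef p k * Dsem p tau (mode_comp (fun sg k => b n tau sg nu k) sg nu) k.1).
Proof.
have D := is_derive_xG p (fval u sg nu) n k tau.
apply: (is_derive_eq D); congr (_ + _ * _); apply: Dsem_ext => m l.
exact: xcomp_fval.
Qed.

Section data.
Variables (calN : nat) (V : nat -> 'rV[R]_3 -> 'cV[R]_8).
Hypothesis calNP : is_calN p calN.
Hypothesis V_smooth : forall n, (1 <= n <= calN)%N -> forall i, smooth_torus (fun x => V n x i 0).
Hypothesis V_E : forall n, (1 <= n <= calN)%N -> forall x, in_E_upto p n (V n x).
Hypothesis V_approx : forall n, (1 <= n <= calN)%N ->
  forall s : R, exists (C : R) (N : nat), forall tau : R, 0 <= tau ->
    (sobolev_norm s (fun x => hat_state p omega tau x - F_infty p V n tau x)%R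
      <= (C * japanese tau ^+ N * expR (- (n%:R * (1 - p ord_max) * tau)))%:E)%E.
Hypothesis V_u : forall x, V 1%N x + \sum_(2 <= n < calN.+1) E_proj p calN n (V n x) =
  \sum_k u k x *: eigvec p k.

Lemma V_window k n x : (1 <= n <= calN)%N -> (n < w k)%N -> ecoord p k (V n x) = 0.
Proof.
move=> nN nk; apply: (in_E_upto_ecoord p_neq0 (V_E nN x)) => m /andP[m0 mn].
by rewrite in_window_index//; apply/eqP => e; move: nk; rewrite -e; lia.
Qed.

(** The projection pi_n discards every window but the n-th, so only the V_{oo,n} with v_k in E^n
    contributes to u_k. *)
Lemma u_window k x : u k x = ecoord p k (V (w k) x).
Proof.
have cov k' : exists2 m, (1 <= m <= calN)%N & in_window p m k'.
  exists (w k'); first exact: window_index_calN.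
  by rewrite in_window_index.
have uni (m m' : nat) : (0 < m)%N -> (0 < m')%N -> in_window p m k -> in_window p m' k -> m = m'.
  by move=> m0 m'0; rewrite !in_window_index// => /eqP -> /eqP ->.
have /andP[w1 wN] := window_index_calN p_kasner p_ordered p_nonflat k calNP.
have := congr1 (ecoord p k) (V_u x); rewrite ecoordD !ecoord_sum.
rewrite [in RHS](bigD1 k)//= ecoordZ ecoord_eigvec// eqxx mulr1 [in RHS]big1 ?addr0; last first.
  by move=> k' k'k; rewrite ecoordZ ecoord_eigvec// eq_sym (negPf k'k) mulr0.
move=> <-.
have E : \sum_(2 <= n < calN.+1) ecoord p k (E_proj p calN n (V n x)) =
   \sum_(2 <= n < calN.+1) (if n == w k then ecoord p k (V n x) else 0).
  rewrite big_nat_cond [RHS]big_nat_cond; apply: eq_bigr => n; rewrite andbT => /andP[n2 nN].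
  rewrite ecoord_E_proj//; last by apply/andP; split; lia.
  by rewrite in_window_index//; lia.
(* V_{oo,1} enters the data without a projection; its coordinate vanishes unless k belongs to the
   first window. *)
rewrite E -big_mkcond /=; have [wk1|wk1] := eqVneq (w k) 1%N.
  rewrite wk1 big_nat_cond big1 ?addr0// => n /andP[h /eqP e].
  by move: h; rewrite e.
rewrite V_window ?add0r//; last by move: w1 wk1; lia.
  rewrite big_nat1_eq; case: ifP => // /negP; case; apply/andP; split; move: w1 wN wk1; lia.
by rewrite leqnn; move: w1 wN; lia.
Qed.

Let V' n : 'rV[R]_3 -> 'cV[R]_8 := if (1 <= n <= calN)%N then V n else fun=> 0.

Let V'_smooth n i : smooth_torus (fun x => V' n x i 0).
Proof.
rewrite /V'; case: ifP => h; first exact: V_smooth.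
by under eq_fun do rewrite mxE; exact: smooth_torus_cst0.
Qed.

Let V'E n : (1 <= n <= calN)%N -> V' n = V n.
Proof. by rewrite /V' => ->. Qed.

Local Notation a n tau sg nu k := (xval (fval (vcoord p V') sg nu) (xF p n k) tau).

Lemma sub_F_infty_decay n k : (1 <= n <= calN)%N ->
  rapid_decay (n%:R * delta p) (fun tau sg nu => Y tau sg nu k - a n tau sg nu k).
Proof.
move=> nN.
have FE tau x k' : 0 <= tau -> ecoord p k' (F_infty p V n tau x) = xval (Dpt (vcoord p V') x) (xF p n k') tau.
  move=> tau0; rewrite (@F_infty_eq R p V V' n); first exact: F_inftyE.
  by move=> m /andP[m1 mn]; rewrite V'E// m1 (leq_trans mn)//; case/andP: nN.
have sv i : smooth_torus (vcoord p V' i) by exact: smooth_vcoord.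
have sF tau i : 0 <= tau -> smooth_torus (fun x => F_infty p V n tau x i 0).
  move=> tau0; rewrite (_ : (fun x => _) =
     fun x => \sum_k eigvec p k i 0 * xval (Dpt (vcoord p V') x) (xF p n k) tau).
    apply: (@smooth_torus_sum R _ _ (fun k => eigvec p k i 0) (fun k x => xval (Dpt (vcoord p V') x) (xF p n k) tau)) => k'.
    exact: smooth_torus_xval.
  apply/funext => x; rewrite [in LHS](ecoord_decomp p_neq0 (F_infty p V n tau x)) summxE.
  by apply: eq_bigr => k' _; rewrite mxE FE// mulrC.
have sv8 tau i : 0 <= tau -> smooth_torus (fun x => (hat_state p omega tau x - F_infty p V n tau x) i 0).
  move=> tau0; rewrite (_ : (fun x => _) = fun x => hat_state p omega tau x i 0 - F_infty p V n tau x i 0).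
    by apply: smooth_torusB; [exact: smooth_hat_state|exact: sF].
  by apply/funext => x; rewrite !mxE.
apply: rapid_decay_ext (rapid_decay_ecoord k sv8 (V_approx nN)) => tau sg nu tau0.
rewrite -fcoef_xval// -fcoefB; last 2 first.
- by apply: smooth_torus_continuous; exact: smooth_ycomp.
- by apply: smooth_torus_continuous; exact: smooth_torus_xval.
by apply: eq_fcoef => x; rewrite ecoordB FE.
Qed.

Lemma rapid_decay_xg n k : rapid_decay (n%:R * delta p)
  (fun tau sg nu => xval (fval u sg nu) (xg p n.+1 k) tau).
Proof. by apply: rapid_decay_xval => //; exact: xg_ge. Qed.

Lemma xval_xGS (Phi : K -> seq 'I_3 -> R) n k tau :
  xval Phi (xG p n.+1 k) tau = xval Phi (xG p n k) tau + xval Phi (xg p n.+1 k) tau.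
Proof. exact: xval_cat. Qed.

Lemma homogeneous_eq0 (z : R -> bool -> 'rV[int]_3 -> R) lam c sg nu :
  rapid_decay c z -> 0 < c + lam ->
  (forall t : R, is_derive t 1 (fun t => z t sg nu) (lam * z t sg nu)) -> z 0 sg nu = 0.
Proof.
move=> zc cl zd.
(* Half of the gap c + lam is given up as the epsilon of [rapid_decay]; the other half still
   outweighs e^{lam t}. *)
have e0 : 0 < (c + lam) / 2 by rewrite divr_gt0.
have [C C0 HC] := zc 0%N _ e0.
apply/eqP; rewrite -normr_le0; apply: (@expR_decay_le0 R _ C ((c + lam) / 2) 0) => // t t0.
have := HC t sg nu t0; rewrite expr0 invr1 mulr1.
rewrite (homogeneous_ode (z := fun t => z t sg nu) t zd) normrM (ger0_norm (expR_ge0 _)) => h.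
have e1 : - ((c + lam) / 2) * t = - (lam * t) + - (c - (c + lam) / 2) * t by field.
by rewrite e1 expRD mulrCA [expR (- (lam * t))]expRN ler_pdivlMl ?expR_gt0.
Qed.

Lemma mode_F_inftyE n k tau sg nu : (n <= calN)%N -> a n tau sg nu k = b n tau sg nu k.
Proof.
elim: n k tau sg nu => [|n IH] k tau sg nu nN; first by rewrite !xval_nil.
have nN' := ltnW nN; have n1N : (1 <= n.+1 <= calN)%N by [].
pose z tau sg nu := a n.+1 tau sg nu k - b n.+1 tau sg nu k.
have zd sg' nu' (t : R) : is_derive t 1 (fun t => z t sg' nu') (eigval p k * z t sg' nu').
  have D1 := is_derive_xF p (fval (vcoord p V') sg' nu') n k t.
  have D2 := is_derive_mode_formal sg' nu' n k t.
  apply: (is_derive_eq (is_deriveB D1 D2)).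
  have -> : Dsem p t (xcomp (fval (vcoord p V') sg' nu') (xF p n) t) k.1 =
            Dsem p t (mode_comp (fun sg k => b n t sg nu' k) sg' nu') k.1.
    apply: Dsem_ext => m l; rewrite xcomp_fval; last exact: smooth_vcoord.
    by rewrite /mode_comp !IH.
  by rewrite /z; ring.
suff z0 : z 0 sg nu = 0.
  by apply/eqP; rewrite -subr_eq0 -[_ - _]/(z tau sg nu) (homogeneous_ode tau (zd sg nu)) z0 mulr0.
have a0 : a n.+1 0 sg nu k = fcoef sg nu (fun x => ecoord p k (V n.+1 x)).
  by rewrite xval_xF0 /fval /= /vcoord V'E.
have [nw|nw|nw] := ltngtP n.+1 (w k).
- rewrite /z a0 xG_at0// subr0; apply: etrans (fcoef0 sg nu).
  by apply: eq_fcoef => x; rewrite V_window.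
(* Past the window, the difference is (Y - a_n) - (Y - a_{n+1}) minus the new increment, as a_n =
   b_n by induction. All three decay at rate n delta, up to epsilon, and n delta > - eigval, so no
   multiple of e^{lambda tau} survives. *)
- have nw' : (0 < n)%N by move: nw; rewrite /window_index; lia.
  apply: (@homogeneous_eq0 z (eigval p k) (n%:R * delta p)) => //; last first.
    have /andP[_ wk] := window_index_itv p_kasner p_ordered p_nonflat k.
    suff : (w k)%:R * delta p <= n%:R * delta p by lra.
    by rewrite ler_pM2r// ler_nat.
  have n0N : (1 <= n <= calN)%N by rewrite nw'.
  have H1 := sub_F_infty_decay k n1N.
  have H2 := rapid_decay_lin 1 (sub_F_infty_decay k n0N) (rapid_decay_lin (-1) (rapid_decay_xg n k) (rapid_decay0 (n%:R * delta p))).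
  have := rapid_decay_lin (-1) (rapid_decay_weaken (_ : n%:R * delta p <= n.+1%:R * delta p) H1) H2.
  rewrite ler_pM2r// ler_nat leqnSn => /(_ isT).
  apply: rapid_decay_ext => t sg' nu' t0; rewrite /z xval_xGS IH//; ring.
(* In the window itself both solutions start from the coefficient of u_k. *)
- rewrite /z a0 [in xG _ _ _]nw xG_at0_window nw; apply/eqP; rewrite subr_eq0; apply/eqP.
  by rewrite /fval; apply: eq_fcoef => x; rewrite -u_window.
Qed.

Lemma formal_approximation n k : (0 < n)%N ->
  rapid_decay (n%:R * delta p) (fun tau sg nu => Y tau sg nu k - b n tau sg nu k).
Proof.
case: n => // n _; elim: n k => [|n IH] k.
  have N1 : (1 <= 1 <= calN)%N.
    by have := window_index_calN p_kasner p_ordered p_nonflat k calNP; lia.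
  by apply: rapid_decay_ext (sub_F_infty_decay k N1) => tau sg nu _; rewrite mode_F_inftyE; case/andP: N1.
have [nN|nN] := leqP n.+2 calN.
  have n1N : (1 <= n.+2 <= calN)%N by [].
  by apply: rapid_decay_ext (sub_F_infty_decay k n1N) => tau sg nu _; rewrite mode_F_inftyE.
have n2 : 2 < n.+1%:R * delta p.
  have [c2 _] := calNP; rewrite (lt_le_trans c2)// ler_wpM2r ?(ltW d0)// ler_nat; lia.
have /andP[l2 l0] := eigval_bound p_kasner p_ordered p_nonflat k.
move=> s e e0.
(* At most half of the gap (n + 1) delta - 2 is lost, so that even the lossy rate of the previous
   order beats every homogeneous solution. *)
pose e' := Num.min e ((n.+1%:R * delta p - 2) / 2).
have e'0 : 0 < e' by rewrite lt_min e0 divr_gt0// subr_gt0.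
have e'e : e' <= e by rewrite ge_min lexx.
have e'2 : e' <= (n.+1%:R * delta p - 2) / 2 by rewrite ge_min lexx orbT.
(* One constant for all k, since D couples the components; the two extra powers of 1 + |n|^2 are
   those that [Dsem_mode_bound] costs. *)
have [C C0 HC] : exists2 C, 0 <= C & forall k tau sg nu, 0 <= tau ->
    `|Y tau sg nu k - b n.+1 tau sg nu k| <=
    C * (1 + freq_sqr nu) ^- (s + 2) * expR (- (n.+1%:R * delta p - e') * tau).
  have H k' := IH k' (s + 2)%N e' e'0.
  pose C k' := s2val (cid2 (H k')).
  exists (\sum_k' C k') => [|k' tau sg nu tau0]; first by apply: sumr_ge0 => k' _; exact: (s2valP (cid2 (H k'))).
  apply: le_trans (s2valP' (cid2 (H k')) tau sg nu tau0) _; rewrite -!mulrA ler_wpM2r//.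
    by rewrite mulr_ge0 ?expR_ge0// invr_ge0 exprn_ge0// ltW// freq_gt0.
  rewrite (bigD1 k')//= lerDl; apply: sumr_ge0 => k'' _; exact: (s2valP (cid2 (H k''))).
have [C1 C10 HC1] := rapid_decay_xg n.+1 k s e'0.
pose A := (n.+2%:R * delta p - e').
have n2E : n.+2%:R * delta p = n.+1%:R * delta p + delta p :> R by rewrite -[in LHS]addn1 natrD mulrDl mul1r.
have Al : 0 < A + eigval p k.
  by rewrite /A n2E; move: d0; lra.
pose C2 := `|kcoef p k| * (18 * C).
have C20 : 0 <= C2 by rewrite !mulr_ge0.
exists (C2 / (A + eigval p k)) => [|tau sg nu tau0]; first by rewrite divr_ge0// ltW.
have q0 : 0 < 1 + freq_sqr nu :> R by exact: freq_gt0.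
have qs : 0 <= (1 + freq_sqr nu) ^- s :> R by rewrite invr_ge0 exprn_ge0// ltW.
pose z tau := Y tau sg nu k - b n.+2 tau sg nu k.
pose E t sg k := Y t sg nu k - b n.+1 t sg nu k.
pose dz t := kcoef p k * Dsem p t (mode_comp (E t) sg nu) k.1.
have zd (t : R) : is_derive t 1 z (eigval p k * z t + dz t).
  have D1 := is_derive_mode sg nu k t.
  have D2 := is_derive_mode_formal sg nu n.+1 k t.
  apply: (is_derive_eq (is_deriveB D1 D2)).
  have -> : dz t = kcoef p k * (-1 * Dsem p t (mode_comp (fun sg k => b n.+1 t sg nu k) sg nu) k.1 +
       Dsem p t (mode_comp (fun sg k => Y t sg nu k) sg nu) k.1).
    by rewrite /dz -Dsem_lin; congr (_ * _); apply: Dsem_ext => m l; rewrite /mode_comp /E; ring.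
  by rewrite /z; ring.
have pb i : `|p i| <= 1.
  by rewrite ler_norml ltW ?(kasner_gtN1 p_kasner)// ltW// (kasner_lt1 p_ordered).
have po i : p i <= p ord_max by apply: p_ordered; rewrite -ltnS.
have dzb t : 0 <= t -> `|dz t| <= C2 * (1 + freq_sqr nu) ^- s * expR (- A * t).
  move=> t0; rewrite /dz normrM /C2 -!mulrA ler_wpM2l//.
  pose B := C * (1 + freq_sqr nu) ^- (s + 2) * expR (- (n.+1%:R * delta p - e') * t).
  have B0 : 0 <= B by rewrite mulr_ge0 ?expR_ge0// mulr_ge0// invr_ge0 exprn_ge0// ltW.
  have := Dsem_mode_bound pb po p_nonflat sg nu k.1 B0 t0 (fun sg k => HC k t sg nu t0).
  move/le_trans; apply; rewrite le_eqVlt; apply/orP; left; apply/eqP.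
  rewrite /B /A n2E exprD.
  have -> : - (n.+1%:R * delta p + delta p - e') * t = - delta p * t + - (n.+1%:R * delta p - e') * t by ring.
  rewrite expRD; generalize (expR (- delta p * t)) (expR (- (n.+1%:R * delta p - e') * t)) => x y.
  by field; rewrite expf_neq0 gt_eqF.
(* A priori bound at the old rate, from the previous order and the new increment; [ode_decay]
   improves it to the rate [A] of the source. *)
have zb t : 0 <= t -> `|z t| <= (C + C1) * (1 + freq_sqr nu) ^- s * expR (- (n.+1%:R * delta p - e') * t).
  move=> t0; rewrite (_ : z t = (Y t sg nu k - b n.+1 t sg nu k) - xval (fval u sg nu) (xg p n.+2 k) t); last first.
    by rewrite /z xval_xGS; ring.
  rewrite (le_trans (ler_normB _ _))// !mulrDl lerD ?HC1// (le_trans (HC _ _ _ _ t0))//.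
  rewrite ler_wpM2r ?expR_ge0// ler_wpM2l// exprD invfM ler_piMr// invf_le1 ?exprn_gt0//.
  by rewrite exprn_ege1// lerDl freq_sqr_ge0.
have := @ode_decay R z dz (eigval p k) A (n.+1%:R * delta p - e') _ _ tau Al _ _ zd dzb zb tau0.
move=> /(_ _ _)/le_trans; apply.
- by move: d0; lra.
- by rewrite mulr_ge0.
rewrite [C2 * _ / _]mulrAC ler_wpM2l//.
  by rewrite mulr_ge0// divr_ge0// ltW.
by rewrite ler_expR ler_wpM2r// /A; lra.
Qed.

End data.
End FormalApproximation.

(** * Leading terms *)

Section LeadingTerms.
Context {R : realType}.
Variable p : 'I_3 -> R.
Hypothesis p_kasner : is_kasner p.
Hypothesis p_ordered : forall i j : 'I_3, (i <= j)%N -> p i <= p j.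
Hypothesis p_nonflat : p ord_max < 1.
Local Notation K := ('I_4 * bool)%type.
Local Notation w := (window_index p).

Let d0 := delta_gt0 p_nonflat.
Let d1 := delta_lt1 p_kasner p_ordered p_nonflat.

Lemma spatial_inj : injective spatial.
Proof. by move=> i j /eqP; rewrite spatial_eq => /eqP. Qed.

Definition beta4 (mu : 'I_4) : R := 1 - p4 p mu.

(* The exponent a_{mu 1} of the first correction, and the corresponding exponent of
   omega^_mu. *)
Definition first_exponent (mu : 'I_4) : R :=
  if mu == spatial ord0 then Num.min (2 * p ord0 + 2 * (1 - p ord_max)) 0 else 2 * (1 - p ord_max).

Definition hat_first (mu : 'I_4) : R := first_exponent mu + beta4 mu.

Lemma hat_first0 : hat_first ord0 = 2 * delta p.
Proof. by rewrite /hat_first /first_exponent neq0_spatial /beta4 p4_0 subrr addr0. Qed.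

Lemma hat_first1 : hat_first (spatial ord0) = Num.min (1 + p ord0 + 2 * delta p) (1 - p ord0).
Proof.
rewrite /hat_first /first_exponent eqxx /beta4 p4_spatial addr_minl add0r; congr (Num.min _ _).
rewrite /delta; ring.
Qed.

Lemma hat_first_spatial i : i != ord0 -> hat_first (spatial i) = 1 - p i + 2 * delta p.
Proof.
by move=> i0; rewrite /hat_first /first_exponent spatial_eq (negPf i0) /beta4 p4_spatial addrC.
Qed.

Lemma eigval0p : eigval p (ord0, true) = 0.
Proof. by rewrite /eigval /= p4_0 addNr. Qed.

Lemma eigval0m : eigval p (ord0, false) = - 2.
Proof. rewrite /eigval /= p4_0; ring. Qed.

Lemma eigvalp i : eigval p (spatial i, true) = - (1 - p i).
Proof. by rewrite /eigval /= p4_spatial; ring. Qed.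

Lemma eigvalm i : eigval p (spatial i, false) = - (1 + p i).
Proof. by rewrite /eigval /= p4_spatial; ring. Qed.

Lemma window_index0p : w (ord0, true) = 1%N.
Proof. by rewrite /window_index eigval0p oppr0 mul0r truncn0. Qed.

(** All eigenvalues but the zero one lie below - delta or at it. The tight case is 1 + p_1 = 2 - p_2
    - p_3 >= 2 (1 - p_3). *)
Lemma window_index_gt1 k : k != (ord0, true) -> (1 < w k)%N.
Proof.
move=> k0; have /andP[_ h] := window_index_itv p_kasner p_ordered p_nonflat k.
suff : delta p <= - eigval p k.
  rewrite ltnNge; case: (w k) h => [|[|m]] //= h h2; move: h h2; rewrite ?mul0r ?mul1r; move: d0; lra.
have [h0 h1 h2 h3 h4] := kasner_order p_kasner p_ordered p_nonflat.
case: k k0 {h} => mu b; elim/ord4P: mu => [|i]; case: b => //= _.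
- by rewrite eigval0m; move: d1; lra.
- rewrite eigvalp opprK; exact: delta_le.
- rewrite eigvalm opprK; have := kasner_gtN1 p_kasner p_ordered p_nonflat i.
  have : p ord0 <= p i by exact: p_ordered.
  by have := p_kasner.1; have := @p_ordered (inord 1) ord_max; rewrite sum_ord3 inordK// => /(_ isT); rewrite /delta; lra.
Qed.

(** The smaller value of - eigval among the two eigenvectors of index mu; by the signs of the p_i it
    is attained by the sign - for i = 1 and by + otherwise. *)
Definition hat_min (mu : 'I_4) : R :=
  if unlift ord0 mu is Some i then (if i == ord0 then 1 + p i else 1 - p i) else 0.

(** Component 0 receives itself with gain 2 (1 - p_i) >= 2 delta, and component j with gain 1 - p_j
    on top of [hat_min], which is 2 (1 - p_j), or 2 for j = 1. For component 1 the minimum in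
    [hat_first] comes from its own second derivatives, 1 + p_1 + 2 delta, and from component 0, 1 -
    p_1. The other components need component 0 to start at 2 delta, which u_{0,+} violates in the
    increment n = 1. *)
Lemma xKD_ge n : (forall mu b, all (fun t => hat_min mu <= xe t) (xg p n (mu, b))) ->
  (n != 1%N -> forall b, all (fun t => 2 * delta p <= xe t) (xg p n (ord0, b))) ->
  (forall mu b, n != 1%N \/ mu = ord0 \/ mu = spatial ord0 ->
     all (fun t => hat_first mu <= xe t) (xKD p (xg p n) (mu, b))) /\
  (forall mu b, all (fun t => hat_min mu <= xe t) (xKD p (xg p n) (mu, b))).
Proof.
move=> H0 H1.
have [k0 k1 k2 k3 k4] := kasner_order p_kasner p_ordered p_nonflat.
have dl i : delta p <= 1 - p i := delta_le p_ordered i.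
have m0 : hat_min ord0 = 0 by rewrite /hat_min unlift_none.
have m1 : hat_min (spatial ord0) = 1 + p ord0 by rewrite /hat_min unlift_spatial eqxx.
have mi i : i != ord0 -> hat_min (spatial i) = 1 - p i.
  by move=> i0; rewrite /hat_min unlift_spatial (negPf i0).
have G0 b : all (fun t => hat_first ord0 <= xe t) (xKD p (xg p n) (ord0, b)).
  apply: (@xKD_all _ _ _ (fun e => hat_first ord0 <= e)); rewrite hat_first0.
  apply: (@xD_all _ _ _ (fun e => 2 * delta p <= e)) => [i b'|j b' /eqP|j b' _].
  - by apply: sub_all (H0 ord0 b') => t; rewrite m0 /= => h; have := dl i; lra.
  - by rewrite neq0_spatial.
  - apply: sub_all (H0 (spatial j) b') => t; have [->|j0] := eqVneq j ord0.
      by rewrite m1 => h; move: d1; lra.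
    by rewrite mi// => h; have := dl j; lra.
have G1 b : all (fun t => hat_first (spatial ord0) <= xe t) (xKD p (xg p n) (spatial ord0, b)).
  apply: (@xKD_all _ _ _ (fun e => hat_first (spatial ord0) <= e)); rewrite hat_first1.
  apply: (@xD_all _ _ _ (fun e => _ <= e)) => [i b'|j b' /= e|j b' /eqP].
  - apply: sub_all (H0 (spatial ord0) b') => t; rewrite m1 /= => h.
    by rewrite ge_min; apply/orP; left; have := dl i; lra.
  - have {e} <- : ord0 = j by apply: spatial_inj.
    apply: sub_all (H0 ord0 b') => t; rewrite m0 => h.
    by rewrite ge_min; apply/orP; right; lra.
  - by rewrite spatial_neq0.
split => mu b; last first.
  elim/ord4P: mu => [|i].
    by apply: sub_all (G0 b) => t; rewrite hat_first0 m0 => h; move: d0; lra.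
  have [->|i0] := eqVneq i ord0.
    apply: sub_all (G1 b) => t; rewrite hat_first1 m1 ge_min => /orP[|] h; move: d0; lra.
  apply: (@xKD_all _ _ _ (fun e => _ <= e)).
  apply: (@xD_all _ _ _ (fun e => _ <= e)) => [j b'|j b' /= e|j b' /eqP].
  - apply: sub_all (H0 (spatial i) b') => t /= h; have := dl j; move: d0; lra.
  - have {e} <- : i = j by apply: spatial_inj.
    by apply: sub_all (H0 ord0 b') => t; rewrite m0 mi// => h; lra.
  - by rewrite spatial_neq0.
have [->|mu0] := eqVneq mu ord0; first by move=> _; exact: G0.
have [->|mu1] := eqVneq mu (spatial ord0); first by move=> _; exact: G1.
move=> [n1|[/eqP|/eqP]]; rewrite ?(negPf mu0) ?(negPf mu1)//.
move: mu0 mu1; elim/ord4P: mu => // i _; rewrite spatial_eq => i0.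
apply: (@xKD_all _ _ _ (fun e => _ <= e)); rewrite hat_first_spatial//.
apply: (@xD_all _ _ _ (fun e => _ <= e)) => [j b'|j b' /= e|j b' /eqP].
- by apply: sub_all (H0 (spatial i) b') => t; rewrite mi//= => h; have := dl j; lra.
- have {e} <- : i = j by apply: spatial_inj.
  by apply: sub_all (H1 n1 b') => t h; lra.
- by rewrite spatial_neq0.
Qed.

Lemma xg_ge_min n : (forall mu b, all (fun t => hat_min mu <= xe t) (xg p n (mu, b))) /\
  (n != 1%N -> forall b, all (fun t => 2 * delta p <= xe t) (xg p n (ord0, b))).
Proof.
elim: n => [//|n [IH1 IH2]].
have [K1 K2] := xKD_ge IH1 IH2.
have [k0 k1 k2 k3 k4] := kasner_order p_kasner p_ordered p_nonflat.
split => [mu b|n1 b]; rewrite [xg _ _ _]/= all_cat; apply/andP; split => //.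
- apply: (@xnew_all _ _ (fun e => _ <= e)) => _.
  elim/ord4P: mu => [|i]; rewrite /hat_min.
    by rewrite unlift_none; have /andP[_] := eigval_bound p_kasner p_ordered p_nonflat (ord0, b); rewrite oppr_ge0.
  rewrite unlift_spatial; case: eqVneq => [->|i0]; case: b; rewrite ?eigvalp ?eigvalm ?opprK//.
    by lra.
  by have [] := kasner_pos p_kasner p_ordered p_nonflat i0; lra.
(* The homogeneous terms of component 0 have exponent 0, in order 1 only, or exponent 2 > 2
   delta. *)
- apply: (@xnew_all _ _ (fun e => _ <= e)); case: b.
    by rewrite window_index0p ltnS leqn0 => /eqP e; move: n1; rewrite e.
  by rewrite eigval0m opprK => _; move: d1; lra.
- by have := K1 ord0 b (or_intror (or_introl erefl)); rewrite hat_first0.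
Qed.

(** Increment n involves only those u_k whose window is at most n. This triangularity makes the
    elimination of u_{1,-}, u_{2,+}, u_{3,+} terminate. *)
Lemma xg_idx n k : all (fun t => w (xi t) <= n)%N (xg p n k).
Proof.
elim: n k => [//|n IH] k.
have KI : all (fun t => w (xi t) <= n)%N (xKD p (xg p n) k).
  apply: (@xsolve_all_idx _ _ (fun i => w i <= n)%N); rewrite all_map.
  exact: (@xD_all_idx _ _ _ (fun i => w i <= n)%N).
have KI' : all (fun t => w (xi t) <= n.+1)%N (xKD p (xg p n) k).
  by apply: sub_all KI => t /leqW.
rewrite [xg _ _ _]/= all_cat KI' andbT /xnew all_cat; apply/andP; split.
  case: ifP => // _; rewrite /xat0 all_map all_filter; apply: sub_all KI' => t /= ->.
  by rewrite implybT.
by case: ifP => //= /eqP ->; rewrite leqnn.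
Qed.

Lemma xg1 k : xg p 1 k = if k == (ord0, true) then [:: XTerm 0 0 1 (ord0, true) [::]] else [::].
Proof.
rewrite [xg _ _ _]/=; have -> : xKD p (fun=> [::]) k = [::] :> seq (@xterm R K).
  have : all (fun t => false) (xKD p (fun=> [::] : seq (@xterm R K)) k).
    by apply: (@xKD_all _ _ _ (fun=> false)); apply: (@xD_all _ _ _ (fun=> false)).
  by case: xKD.
rewrite /xnew /= cats0; have [->|k0] := eqVneq k (ord0, true).
  by rewrite window_index0p eigval0p oppr0.
by rewrite ltn_eqF// window_index_gt1.
Qed.

(* The contribution of the leading term [u_{0,+}] of [omega_tau] to the equation of
   [omega_i]: resonant for the eigenvalue [-1 + p_i]. *)
Lemma xKD1_small i b : i != ord0 ->
  [seq t <- xKD p (xg p 1) (spatial i, b) | xe t < hat_first (spatial i)] =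
  [:: XTerm (1 - p i) b (if b then 1 else - (2 * p i)^-1) (ord0, true) [:: i]].
Proof.
move=> i0; rewrite /xKD /xD [(spatial i, b).1]/= unlift_spatial.
have pi0 : p i != 0 by have [h _] := kasner_pos p_kasner p_ordered p_nonflat i0; rewrite gt_eqF.
set A := flatten _.
have A0 : A = [::].
  have : all (fun t => false) A.
    apply: all_flatten => j; rewrite /xshift /xdiff !all_map /xpair !xg1.
    by rewrite !xpair_eqE !spatial_neq0.
  by case: (A).
rewrite A0 cat0s /xpair !xg1 /= /xsolve /= cats0 /xsolve1 /= addr0 mulr1.
rewrite /kcoef /= p4_spatial /eigval /= p4_spatial.
have d2 : 1 - p i < 1 - p i + 2 * delta p by move: d0; lra.
case: b.
  rewrite (_ : 1 - p i + (-1 + p i) == 0); last by apply/eqP; ring.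
  rewrite /= hat_first_spatial// d2 /sgn; congr [:: XTerm _ _ _ _ _].
  by field.
rewrite (_ : (1 - p i + (-1 - p i) == 0) = false); last first.
  by apply/negP => /eqP h; move/eqP: pi0; apply; lra.
rewrite /= hat_first_spatial// d2 /sgn; congr [:: XTerm _ _ _ _ _].
field; rewrite ?pi0 ?andbT; apply/eqP; move/eqP: pi0; lra.
Qed.

End LeadingTerms.

(** * Elimination of the data in favour of the leading coefficients *)

Section Substitution.
Context {R : realType}.
Local Notation K := ('I_4 * bool)%type.
Implicit Types (L : @ldo R) (f g : K -> 'rV[R]_3 -> R).

Definition ldo_bind L (S : K -> @ldo R) : @ldo R :=
  flatten [seq [seq (m.1.1 * s.1.1, s.1.2, m.2 ++ s.2) | s <- S m.1.2] | m <- L].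

Lemma ldo_eval_cat L L' f x : ldo_eval (L ++ L') f x = ldo_eval L f x + ldo_eval L' f x.
Proof. exact: big_cat. Qed.

Lemma smooth_ldo_eval L f : (forall k, smooth_torus (f k)) -> smooth_torus (ldo_eval L f).
Proof.
move=> sf; apply: (@smooth_torus_sum R _ L (fun m => m.1.1) (fun m x => partials m.2 (f m.1.2) x)) => m.
exact: smooth_torus_partials.
Qed.

(** The hypothesis on f concerns only the indices occurring in L, because the recursion of
    [lead_substP] knows the substitution for earlier windows only. *)
Lemma ldo_eval_bind L S f g x : (forall k, smooth_torus (g k)) ->
  (forall m, m \in L -> f m.1.2 =1 ldo_eval (S m.1.2) g) ->
  ldo_eval L f x = ldo_eval (ldo_bind L S) g x.
Proof.
move=> sg; elim: L => [|m L IH] E; first by rewrite /ldo_eval /ldo_bind /= !big_nil.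
rewrite /ldo_bind /= ldo_eval_cat -[flatten _]/(ldo_bind L S) -IH; last first.
  by move=> m' m'L; apply: E; rewrite inE m'L orbT.
rewrite {1}/ldo_eval big_cons; congr (_ + _).
have -> : f m.1.2 = ldo_eval (S m.1.2) g by apply/funext; apply: E; rewrite inE eqxx.
have sG (s : R * K * seq 'I_3) : smooth_on setT (partials s.2 (g s.1.2)).
  by apply: smooth_on_partials; have [] := sg s.1.2.
have [_ ->] := @smooth_sum R 3 _ (S m.1.2) (fun s => s.1.1) (fun s => partials s.2 (g s.1.2)) sG.
rewrite /ldo_eval big_map mulr_sumr; apply: eq_bigr => s _ /=.
by rewrite partials_cat mulrA.
Qed.

Definition ldo_of (X : seq (@xterm R K)) : @ldo R := [seq (xc t, xi t, xl t) | t <- X].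

Lemma ldo_eval_of X f x : ldo_eval (ldo_of X) f x = \sum_(t <- X) xc t * partials (xl t) (f (xi t)) x.
Proof. exact: big_map. Qed.

Variable p : 'I_3 -> R.
Hypothesis p_kasner : is_kasner p.
Hypothesis p_ordered : forall i j : 'I_3, (i <= j)%N -> p i <= p j.
Hypothesis p_nonflat : p ord_max < 1.
Local Notation w := (window_index p).

(* What the coefficient of [exp (eigval k * tau)] in component [k] adds to [u k]. *)
Definition rest_terms (k : K) : seq (@xterm R K) :=
  flatten [seq xat0 (eigval p k) (xKD p (xg p n) k) | n <- iota 0 (w k)].

Lemma rest_terms_idx k : all (fun t => w (xi t) < w k)%N (rest_terms k).
Proof.
rewrite /rest_terms; have : all (fun n => n < w k)%N (iota 0 (w k)).
  by apply/allP => n; rewrite mem_iota.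
elim: iota => //= n s IH /andP[nk /IH sk]; rewrite all_cat sk andbT.
rewrite /xat0 all_map all_filter.
have : all (fun t => w (xi t) <= n)%N (xKD p (xg p n) k).
  apply: (@xsolve_all_idx _ _ (fun i => w i <= n)%N); rewrite all_map.
  apply: (@xD_all_idx _ _ _ (fun i => w i <= n)%N) => k'; exact: xg_idx.
by apply: sub_all => t /= h; apply/implyP => _; exact: leq_ltn_trans h nk.
Qed.

Definition lead_index (i : 'I_3) : K := (spatial i, i != ord0).

(** [rest_terms] already holds everything that is added to u_k in front of e^{eigval tau}, whereas
    [leading_coef] writes (2 p_1)^{-1} d_1 u_{0,+} separately; for i = 1 that term is subtracted
    again. *)
Definition alpha_ldo (i : 'I_3) : @ldo R := ldo_of (rest_terms (lead_index i)) ++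
  (if i == ord0 then [:: (- (2 * p i)^-1, (ord0, true), [:: i])] else [::]).

(** The leading coefficient without u_k itself. For i = 2, 3 the term in d_i u_{0,+} balances the
    particular solution of the - eigencomponent, as seen in [leading_jet_spatial]. *)
Definition lead_rest (i : 'I_3) : @ldo R := ldo_of (rest_terms (lead_index i)) ++
  (if i == ord0 then [::] else [:: (- (2 * p i)^-1, (ord0, true), [:: i])]).

Lemma leading_coefE (u : K -> 'rV[R]_3 -> R) i x :
  leading_coef p u (fun i => ldo_eval (alpha_ldo i) u) i x =
  u (lead_index i) x + ldo_eval (lead_rest i) u x.
Proof.
rewrite /leading_coef /alpha_ldo /lead_rest !ldo_eval_cat /lead_index.
by case: (eqVneq i ord0) => _ /=; rewrite /ldo_eval big_seq1 big_nil /=; ring.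
Qed.

Lemma lead_rest_idx i m : m \in lead_rest i -> (w m.1.2 < w (lead_index i))%N.
Proof.
rewrite mem_cat => /orP[|].
  case/(nthP (0, (ord0, true), [::])) => j; rewrite size_map => jn <-.
  have t0 : @xterm R K := XTerm 0 0 0 (ord0, true) [::].
  rewrite (nth_map t0)//=.
  by have /all_nthP -/(_ t0 j jn) := rest_terms_idx (lead_index i).
case: eqP => // _; rewrite inE => /eqP -> /=.
by rewrite window_index0p; exact: window_index_gt1.
Qed.

Definition ldo_opp L : @ldo R := [seq (- m.1.1, m.1.2, m.2) | m <- L].

Lemma ldo_eval_opp L f x : ldo_eval (ldo_opp L) f x = - ldo_eval L f x.
Proof. by rewrite /ldo_eval big_map -sumrN; apply: eq_bigr => m _; rewrite mulNr. Qed.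

(* Expresses [u k] through the leading family, by recursion on the window of [k]. *)
Fixpoint lead_subst (m : nat) (k : K) : @ldo R :=
  (1, k, [::]) ::
  if m is m'.+1 then
    if unlift ord0 k.1 is Some i then
      if k.2 == (i != ord0) then ldo_bind (ldo_opp (lead_rest i)) (lead_subst m') else [::]
    else [::]
  else [::].

Variable u : K -> 'rV[R]_3 -> R.
Hypothesis u_smooth : forall k, smooth_torus (u k).

Let alpha i := ldo_eval (alpha_ldo i) u.

Lemma smooth_leading_family k : smooth_torus (leading_family p u alpha k).
Proof.
rewrite /leading_family; case: unlift => [i|//]; case: ifP => // _.
rewrite (_ : leading_coef _ _ _ _ = fun x => u (lead_index i) x + ldo_eval (lead_rest i) u x).
  by apply: smooth_torusD => //; exact: smooth_ldo_eval.
by apply/funext => x; rewrite leading_coefE.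
Qed.

(** Writing u_k as the leading coefficient minus [lead_rest] leaves only data from strictly earlier
    windows, so w k steps suffice. *)
Lemma lead_substP m k x : (w k <= m)%N ->
  u k x = ldo_eval (lead_subst m k) (leading_family p u alpha) x.
Proof.
elim: m k x => [//|m IH] k x wk.
rewrite /= {1}/ldo_eval big_cons /= mul1r -/(ldo_eval _ _ _) {1}/leading_family.
have E0 f : ldo_eval (R := R) [::] f x = 0 by rewrite /ldo_eval big_nil.
case: (unliftP ord0 k.1) => [i|_]; last by rewrite E0 addr0.
case: eqP => [k2 k1|_ _]; last by rewrite E0 addr0.
have kE : k = lead_index i by case: (k) k1 k2 => ? ? /= -> ->.
rewrite -(@ldo_eval_bind _ _ u); last 2 first.
- exact: smooth_leading_family.
- move=> _ /mapP[m' m'L ->] y /=; apply: IH.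
  by rewrite -ltnS (leq_trans _ wk)// kE; exact: lead_rest_idx.
by rewrite ldo_eval_opp leading_coefE kE addrK.
Qed.

End Substitution.

Section SmallTerms.
Context {R : realType}.
Variable p : 'I_3 -> R.
Hypothesis p_kasner : is_kasner p.
Hypothesis p_ordered : forall i j : 'I_3, (i <= j)%N -> p i <= p j.
Hypothesis p_nonflat : p ord_max < 1.
Local Notation K := ('I_4 * bool)%type.
Local Notation w := (window_index p).

Let d0 := delta_gt0 p_nonflat.
Let d1 := delta_lt1 p_kasner p_ordered p_nonflat.

Lemma xKD0 k : xKD p (xg p 0) k = [::].
Proof.
have : all (fun t => false) (xKD p (xg p 0) k).
  by apply: (@xKD_all _ _ _ (fun=> false)); apply: (@xD_all _ _ _ (fun=> false)).
by case: xKD.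
Qed.

Lemma xval_rest (Phi : K -> seq 'I_3 -> R) k tau :
  xval Phi (rest_terms p k) tau = expR (eigval p k * tau) * \sum_(t <- rest_terms p k) xc t * Phi (xi t) (xl t).
Proof.
rewrite /rest_terms; elim: iota => [|n s IH] /=; first by rewrite xval_nil big_nil mulr0.
rewrite xval_cat big_cat /= mulrDr IH; congr (_ + _).
rewrite /xval /xat0 !big_map mulr_sumr; apply: eq_bigr => t _.
by rewrite /xcoef /= expr0 mul1r opprK; ring.
Qed.

(** Homogeneous terms stop at the window of k, so from there on their total is independent of M: it
    is u_k plus the corrections in [rest_terms]. *)
Lemma xval_xnew_sum (Phi : K -> seq 'I_3 -> R) k M tau : (w k <= M)%N ->
  \sum_(n <- iota 0 M) xval Phi (xnew p n.+1 k (xKD p (xg p n) k)) tau =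
  expR (eigval p k * tau) *
    (Phi k [::] + \sum_(t <- rest_terms p k) xc t * Phi (xi t) (xl t)).
Proof.
move=> wM; rewrite mulrDr -xval_rest.
have split (F : nat -> R) : \sum_(n <- iota 0 M) F n =
    \sum_(n <- iota 0 (w k)) F n + \sum_(n <- iota (w k) (M - w k)) F n.
  by rewrite -{1}(subnKC wM) iotaD big_cat.
rewrite split [X in _ + X]big1_seq ?addr0; last first.
  move=> n; rewrite mem_iota => /andP[_ /andP[wn _]].
  have nw : (n < w k)%N = false by apply/negbTE; rewrite -leqNgt.
  have nw' : (n.+1 == w k) = false by apply/negbTE; apply/eqP => e; move: wn; rewrite -e ltnn.
  by rewrite /xnew nw nw' /= xval_nil.
rewrite /rest_terms xval_flatten.
have E : expR (eigval p k * tau) * Phi k [::] =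
   \sum_(n <- iota 0 (w k)) xval Phi (if n.+1 == w k then [:: XTerm (- eigval p k) 0 1 k [::]] else [::]) tau.
  have -> : w k = (w k).-1.+1 by [].
  rewrite -[(w k).-1.+1]addn1 iotaD big_cat /= big_seq1 add0n addn1 eqxx big1_seq ?add0r; last first.
    by move=> n; rewrite mem_iota add0n => /andP[_ nw]; rewrite eqSS ltn_eqF// xval_nil.
  by rewrite xval_cons xval_nil /xcoef /= expr0 opprK; ring.
have sP n : n \in iota 0 (w k) -> (n < w k)%N by rewrite mem_iota.
rewrite E; move: (iota 0 (w k)) sP => s sP.
rewrite -big_split /=. apply: eq_big_seq => n /sP nw.
by rewrite /xnew nw xval_cat addrC.
Qed.

Lemma filter_none (T : Type) (P : pred T) s : all (fun t => ~~ P t) s -> seq.filter P s = [::].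
Proof. by elim: s => //= t s IH /andP[/negPf -> /IH]. Qed.

(** All homogeneous terms of component k share the exponent - eigval, so the cut-off keeps either
    all or none of them. *)
Lemma xval_filter_xG (Phi : K -> seq 'I_3 -> R) k (e : R) M tau : (w k <= M)%N ->
  xval Phi [seq t <- xG p M k | xe t < e] tau =
  (if - eigval p k < e then expR (eigval p k * tau) *
     (Phi k [::] + \sum_(t <- rest_terms p k) xc t * Phi (xi t) (xl t)) else 0) +
  \sum_(n <- iota 0 M) xval Phi [seq t <- xKD p (xg p n) k | xe t < e] tau.
Proof.
move=> wM.
have xG_flatten m : xval Phi [seq t <- xG p m k | xe t < e] tau =
    \sum_(n <- iota 0 m) (xval Phi [seq t <- xnew p n.+1 k (xKD p (xg p n) k) | xe t < e] tau +
      xval Phi [seq t <- xKD p (xg p n) k | xe t < e] tau).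
  elim: m => [|m IH]; first by rewrite xval_nil big_nil.
  rewrite (_ : xG p m.+1 k = xG p m k ++ (xnew p m.+1 k (xKD p (xg p m) k) ++ xKD p (xg p m) k))//.
  have -> : iota 0 m.+1 = iota 0 m ++ [:: m] by rewrite -[m.+1]addn1 iotaD add0n.
  rewrite big_cat /= big_seq1 -IH; move: (xnew p m.+1 k _) => X.
  by rewrite !seq.filter_cat !xval_cat.
rewrite xG_flatten big_split /=; congr (_ + _).
case: ifP => h.
  rewrite -(xval_xnew_sum Phi tau wM); apply: eq_bigr => n _; congr (xval _ _ _).
  by apply/all_filterP; apply: (@xnew_all _ _ (fun x => x < e)) => _.
apply: big1 => n _; rewrite filter_none ?xval_nil//.
by apply: (@xnew_all _ _ (fun x => ~~ (x < e))) => _; rewrite h.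
Qed.

Lemma xKD_none n mu (b : bool) : n != 1%N \/ mu = ord0 \/ mu = spatial ord0 ->
  [seq t <- xKD p (xg p n) (mu, b) | xe t < hat_first p mu] = [::].
Proof.
move=> h; have [H1 H2] := xg_ge_min p_kasner p_ordered p_nonflat n.
have [K1 _] := xKD_ge p_kasner p_ordered p_nonflat H1 H2.
by apply: filter_none; apply: sub_all (K1 mu b h) => t; rewrite -leNgt.
Qed.

Lemma small_time (Phi : K -> seq 'I_3 -> R) (b : bool) M tau : (w (ord0, b) <= M)%N ->
  xval Phi [seq t <- xG p M (ord0, b) | xe t < hat_first p ord0] tau =
  if b then Phi (ord0, true) [::] else 0.
Proof.
move=> wM; rewrite xval_filter_xG// [X in _ + X]big1 ?addr0; last first.
  by move=> n _; rewrite xKD_none ?xval_nil//; right; left.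
rewrite hat_first0; case: b {wM}; last first.
  by rewrite eigval0m opprK ltNge (_ : 2 * delta p <= 2)//; move: d1; lra.
rewrite eigval0p oppr0 mul0r expR0 mul1r mulr_gt0// /rest_terms window_index0p /= xKD0 /=.
by rewrite big_nil addr0.
Qed.

Lemma small_first (Phi : K -> seq 'I_3 -> R) (b : bool) M tau : (w (spatial ord0, b) <= M)%N ->
  xval Phi [seq t <- xG p M (spatial ord0, b) | xe t < hat_first p (spatial ord0)] tau =
  if b then 0 else expR (- (1 + p ord0) * tau) *
    (Phi (lead_index ord0) [::] +
     \sum_(t <- rest_terms p (lead_index ord0)) xc t * Phi (xi t) (xl t)).
Proof.
move=> wM; rewrite xval_filter_xG// [X in _ + X]big1 ?addr0; last first.
  by move=> n _; rewrite xKD_none ?xval_nil//; right; right.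
have [k0 k1 k2 k3 k4] := kasner_order p_kasner p_ordered p_nonflat.
rewrite hat_first1; case: b {wM}.
  by rewrite eigvalp opprK lt_min ltxx andbF.
rewrite /lead_index eqxx eigvalm opprK lt_min.
have -> : 1 + p ord0 < 1 + p ord0 + 2 * delta p by move: d0; lra.
by have -> : 1 + p ord0 < 1 - p ord0 by lra.
Qed.

(** The source d_i u_{0,+} has exponent 1 - p_i: it resonates with the + eigenvalue, whence the
    factor tau, and drives the - component without resonance. Both effects first appear in the
    increment of order 2, hence 1 < M. *)
Lemma small_spatial (Phi : K -> seq 'I_3 -> R) i (b : bool) M tau : i != ord0 ->
  (1 < M)%N -> (w (spatial i, b) <= M)%N ->
  xval Phi [seq t <- xG p M (spatial i, b) | xe t < hat_first p (spatial i)] tau =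
  expR (- (1 - p i) * tau) *
  if b then Phi (lead_index i) [::] +
     \sum_(t <- rest_terms p (lead_index i)) xc t * Phi (xi t) (xl t) + tau * Phi (ord0, true) [:: i]
  else - (2 * p i)^-1 * Phi (ord0, true) [:: i].
Proof.
move=> i0 M1 wM; rewrite xval_filter_xG//.
have [pi1 pi2] := kasner_pos p_kasner p_ordered p_nonflat i0.
have -> : \sum_(n <- iota 0 M) xval Phi [seq t <- xKD p (xg p n) (spatial i, b) | xe t < hat_first p (spatial i)] tau =
    expR (- (1 - p i) * tau) * ((if b then tau else - (2 * p i)^-1) * Phi (ord0, true) [:: i]).
  rewrite (bigD1_seq 1%N) ?iota_uniq ?mem_iota//= big1 ?addr0; last first.
    by move=> n n1; rewrite xKD_none ?xval_nil//; left.
  rewrite [in LHS]xKD1_small// xval_cons xval_nil /xcoef /=; case: b {wM} => /=; rewrite ?expr0 ?expr1; ring.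
rewrite hat_first_spatial// /lead_index i0; case: b {wM}.
  rewrite eigvalp opprK (_ : 1 - p i < 1 - p i + 2 * delta p); last by move: d0; lra.
  by ring.
(* The homogeneous exponent 1 + p_i is not below the threshold, because p_i + p_3 > 1 for i = 2,
   3. *)
rewrite eigvalm opprK ltNge (_ : 1 - p i + 2 * delta p <= 1 + p i) ?add0r//.
by rewrite /delta; lra.
Qed.

End SmallTerms.

(** * Sorting the exponents *)

Section Enumeration.
Context {R : realType}.

Lemma next_in_seq (E : R -> Prop) (y g : R) (l : seq R) : y < g -> E g ->
  exists z, [/\ y < z, E z, z <= g & forall x, x \in l -> E x -> y < x -> z <= x].
Proof.
move=> yg Eg; elim: l => [|a l [z [yz Ez zg zl]]]; first by exists g; split.
have [[[Ea ya] az]|h] := pselect ((E a /\ y < a) /\ a < z).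
  exists a; split => //; first exact: le_trans (ltW az) zg.
  move=> x; rewrite inE => /orP[/eqP -> //|xl Ex yx].
  by rewrite (le_trans (ltW az))// zl.
exists z; split => // x; rewrite inE => /orP[/eqP -> Ea ya|]; last exact: zl.
by rewrite leNgt; apply/negP => az; apply: h.
Qed.

Lemma le_step (e : nat -> R) : (forall k, e k < e k.+1) -> {mono e : j k / (j <= k)%N >-> j <= k}.
Proof. by move=> eS; apply: le_mono; apply: homo_ltn => //; exact: lt_trans. Qed.

(** The statement asks for strictly increasing a_{mu k} at every k > 0, however many exponents
    occur; a value that is no exponent receives zero coefficients. Starting at [thr] makes the first
    exponent explicit even if its coefficient vanishes. *)
Lemma enum_discrete (E : R -> Prop) (thr : R) :
  (forall B, exists l : seq R, forall x, E x -> x < B -> x \in l) ->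
  exists e : nat -> R, [/\ e 0%N = thr, forall k, e k < e k.+1,
    forall x, E x -> thr <= x -> exists k, x = e k & forall B, exists k, B <= e k].
Proof.
(* The grid [thr + nat] makes the enumerated set infinite. *)
move=> fin; pose E' x := E x \/ exists m : nat, x = thr + m%:R.
have fin' B : exists l : seq R, forall x, E' x -> x < B -> x \in l.
  have [l lP] := fin B.
  exists (l ++ [seq thr + m%:R | m <- iota 0 (Num.truncn (B - thr)).+1]) => x [Ex|[m ->]] xB.
    by rewrite mem_cat lP.
  rewrite mem_cat; apply/orP; right; apply: (map_f (fun m : nat => thr + m%:R)); rewrite mem_iota /=.
  have Bt : 0 <= B - thr by rewrite subr_ge0 (le_trans _ (ltW xB))// lerDl.
  have /andP[_ h] := truncn_itv Bt.
  rewrite -(ltr_nat R) (lt_trans _ h)//; lra.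
have nextP y : exists z, thr <= y -> [/\ y < z, E' z & forall x, E' x -> y < x -> z <= x].
  have [ty|] := boolP (thr <= y); last by exists 0.
  pose g : R := thr + (Num.truncn (y - thr)).+1%:R.
  have yt : 0 <= y - thr by rewrite subr_ge0.
  have yg : y < g by have /andP[_] := truncn_itv yt; rewrite /g; lra.
  have Eg : E' g by right; eexists.
  have [l lP] := fin' g.
  have [z [yz Ez zg zl]] := @next_in_seq E' y g l yg Eg.
  exists z => _; split => // x Ex yx; have [xg|gx] := ltP x g; first by apply: zl => //; exact: lP.
  exact: le_trans zg gx.
have [next nP] := choice nextP.
pose e k := iter k next thr.
have eP k : thr <= e k /\ E' (e k).
  elim: k => [|k [tk Ek]]; first by split => //; right; exists 0%N; rewrite addr0.
  by have [h1 h2 _] := nP _ tk; split => //; exact: le_trans tk (ltW h1).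
have eS k : e k < e k.+1 by have [] := nP _ (eP k).1.
(* Otherwise all values e k would lie below B, hence in a finite list, which is too short for so
   many distinct elements. *)
have unb B : exists k, B <= e k.
  apply: contrapT => /forallNP H.
  have [l lP] := fin' B.
  have sub : {subset [seq e k | k <- iota 0 (size l).+1] <= l}.
    move=> _ /mapP[k _ ->]; apply: lP; first exact: (eP k).2.
    by rewrite ltNge; apply/negP; exact: H.
  have u : uniq [seq e k | k <- iota 0 (size l).+1].
    by rewrite map_inj_uniq ?iota_uniq//; exact/inc_inj/le_step.
  by have := uniq_leq_size u sub; rewrite size_map size_iota ltnn.
exists e; split => // x Ex tx.
have ex : exists k, x <= e k by exact: unb.
case: (ex_minnP ex) => -[|k] xk kmin.
  by exists 0%N; apply/eqP; rewrite eq_le xk tx.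
exists k.+1; apply/eqP; rewrite eq_le xk /=.
have [_ _ nx] := nP _ (eP k).1; apply: nx; first by left.
by rewrite ltNge; apply/negP => /kmin; rewrite ltnn.
Qed.

End Enumeration.

Section CollectExponents.
Context {R : realType}.
Variable p : 'I_3 -> R.
Hypothesis p_kasner : is_kasner p.
Hypothesis p_ordered : forall i j : 'I_3, (i <= j)%N -> p i <= p j.
Hypothesis p_nonflat : p ord_max < 1.
Local Notation K := ('I_4 * bool)%type.
Local Notation w := (window_index p).

Let d0 := delta_gt0 p_nonflat.

(** Increments of order beyond L only have exponents at least L delta. Hence the coefficient at a
    given exponent is the same in all high orders, which makes the P_{mu k} independent of n. *)
Lemma xG_stable (P : R -> bool) L M k : (L <= M)%N -> (forall x, P x -> x < L%:R * delta p) ->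
  [seq t <- xG p M k | P (xe t)] = [seq t <- xG p L k | P (xe t)].
Proof.
move=> LM PL; rewrite -(subnKC LM); elim: (M - L)%N => [|m IH]; first by rewrite addn0.
rewrite addnS (_ : xG p (L + m).+1 k = xG p (L + m) k ++ xg p (L + m).+1 k)// seq.filter_cat IH.
rewrite [X in _ ++ X]filter_none ?cats0//.
have H := xg_ge p_kasner p_ordered p_nonflat (L + m).+1 k.
apply: sub_all H => t /= h; apply/negP => /PL; rewrite ltNge => /negP; apply.
by apply: le_trans h; rewrite ler_wpM2r ?(ltW d0)// ler_nat leq_addr.
Qed.

Lemma xG_stable_eq (e : R) L M k : e < L%:R * delta p -> e < M%:R * delta p ->
  [seq t <- xG p M k | xe t == e] = [seq t <- xG p L k | xe t == e].
Proof.
wlog LM : L M / (L <= M)%N.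
  move=> H eL eM; have [LM|/ltnW ML] := leqP L M; first exact: H.
  by apply: esym; apply: H.
move=> eL _; apply: (@xG_stable (fun x => x == e)) => // x /eqP -> //.
Qed.

Definition hat_exponent (mu : 'I_4) (x : R) : Prop :=
  exists M (b : bool), x \in [seq xe t | t <- xG p M (mu, b)].

Lemma hat_exponent_fin mu B : exists l : seq R, forall x, hat_exponent mu x -> x < B -> x \in l.
Proof.
pose L := (Num.truncn (Num.max B 0 / delta p)).+1.
have BL : B <= L%:R * delta p.
  have B0 : 0 <= Num.max B 0 / delta p by rewrite divr_ge0 ?(ltW d0)// le_max lexx orbT.
  have /andP[_] := truncn_itv B0; rewrite -/L ltr_pdivrMr// => h.
  by rewrite (le_trans _ (ltW h))// le_max lexx.
exists ([seq xe t | t <- xG p L (mu, true)] ++ [seq xe t | t <- xG p L (mu, false)]).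
move=> x [M [b xM]] xB.
suff : x \in [seq xe t | t <- xG p L (mu, b)] by rewrite mem_cat; case: (b) => ->; rewrite ?orbT.
have filt (m : nat) : (x \in [seq xe t | t <- xG p m (mu, b)]) =
    (x \in [seq xe t | t <- [seq t <- xG p m (mu, b) | xe t < B]]).
  by elim: (xG p m (mu, b)) => //= t s IH; case: ifP => h; rewrite !inE IH//=;
     case: eqP => // e; rewrite -e xB in h.
have [LM|/ltnW ML] := leqP L M.
  rewrite filt -(@xG_stable (fun x => x < B) L M) -?filt// => y yB; exact: lt_le_trans yB BL.
rewrite -(subnKC ML); elim: (L - M)%N => [|m IH]; first by rewrite addn0.
rewrite addnS (_ : xG p (M + m).+1 (mu, b) = xG p (M + m) (mu, b) ++ xg p (M + m).+1 (mu, b))//.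
by rewrite map_cat mem_cat IH.
Qed.

Lemma xval_by_exponent (I : Type) (Phi : I -> seq 'I_3 -> R) (e : nat -> R) q B
    (X : seq (@xterm R I)) tau :
  (forall k, e k < e k.+1) -> (forall k, (k < q)%N = (e k < B)) ->
  (forall x, x \in [seq xe t | t <- X] -> e 0%N <= x -> exists k, x = e k) ->
  \sum_(k <- iota 0 q) xval Phi [seq t <- X | xe t == e k] tau =
  xval Phi [seq t <- X | (e 0%N <= xe t) && (xe t < B)] tau.
Proof.
move=> eS qB; elim: X => [|t X IH] XE.
  by rewrite /= xval_nil big1.
have {}IH := IH _; rewrite [RHS](_ : _ = (if (e 0%N <= xe t) && (xe t < B) then xcoef t tau * Phi (xi t) (xl t) else 0)
   + xval Phi [seq t <- X | (e 0%N <= xe t) && (xe t < B)] tau); last first.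
  by rewrite /=; case: ifP => _; rewrite ?xval_cons ?add0r.
rewrite -IH; last by move=> x xX; apply: XE; rewrite /= inE xX orbT.
rewrite (eq_bigr (fun k => (if xe t == e k then xcoef t tau * Phi (xi t) (xl t) else 0) +
   xval Phi [seq t <- X | xe t == e k] tau)); last first.
  by move=> k _ /=; case: ifP => _; rewrite ?xval_cons ?add0r.
rewrite big_split /=; congr (_ + _).
case: ifPn => [/andP[te tB]|nt].
  have [k0 tk0] := XE (xe t) (mem_head _ _) te.
  have k0q : (k0 < q)%N by rewrite qB -tk0.
  rewrite (bigD1_seq k0) ?iota_uniq ?mem_iota//= -tk0 eqxx big1 ?addr0// => k kk0.
  case: eqP => //; rewrite tk0 => /(inc_inj (le_step eS)) ek.
  by rewrite ek eqxx in kk0.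
rewrite big_seq; apply: big1 => k; rewrite mem_iota add0n /= => kq; case: eqP => // tk.
by move: nt; rewrite tk (le_step eS) -qB kq.
Qed.

(** omega_mu is e^{beta tau} times the sum of its two eigencomponents, and its tau-derivative
    carries the extra factors eigval + beta, because the lower half of the state is the sum of the
    eigencomponents times their eigenvalues. So remainders never have to be differentiated in
    tau. *)
Definition jet_weight mu (b : bool) (r : 'I_2) : R :=
  if r == 0 then 1 else eigval p (mu, b) + beta4 p mu.

Definition poly_ldo (e : R) (M : nat) mu (j : nat) (r : 'I_2) : @ldo R :=
  ldo_bind (flatten [seq ldo_of (xscale (jet_weight mu b r)
      [seq t <- xG p M (mu, b) | (xj t == j) && (xe t == e)]) | b <- [:: true; false]])
    (fun k => lead_subst p (w k) k).

Definition power_bound (M : nat) mu : nat :=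
  \max_(t <- xG p M (mu, true) ++ xG p M (mu, false)) xj t.

Lemma power_boundP M mu (b : bool) : all (fun t => xj t <= power_bound M mu)%N (xG p M (mu, b)).
Proof.
have H (X : seq (@xterm R K)) : all (fun t => xj t <= \max_(t <- X) xj t)%N X.
  elim: X => //= t X IH; rewrite big_cons leq_maxl /=; apply: sub_all IH => t' h.
  by rewrite leq_max h orbT.
have := H (xG p M (mu, true) ++ xG p M (mu, false)).
by rewrite all_cat => /andP[]; case: b.
Qed.

Variable u : K -> 'rV[R]_3 -> R.
Hypothesis u_smooth : forall k, smooth_torus (u k).
Let alpha i := ldo_eval (alpha_ldo p i) u.
Local Notation LF := (leading_family p u alpha).

Lemma poly_ldoE e M mu j r x : ldo_eval (poly_ldo e M mu j r) LF x =
  \sum_(b <- [:: true; false]) jet_weight mu b r *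
    \sum_(t <- xG p M (mu, b) | (xj t == j) && (xe t == e)) xc t * Dpt u x (xi t) (xl t).
Proof.
rewrite /poly_ldo -(@ldo_eval_bind _ _ _ u); last 2 first.
- exact: smooth_leading_family.
- by move=> m _ y; apply: lead_substP.
elim: [:: true; false] => [|b s IH] /=; first by rewrite /ldo_eval !big_nil.
rewrite ldo_eval_cat IH big_cons; congr (_ + _).
rewrite ldo_eval_of /xscale big_map big_filter mulr_sumr; apply: eq_bigr => t _.
by rewrite /= mulrA.
Qed.

Lemma sum_powers (M : nat) mu (b : bool) e (tau : R) x :
  \sum_(j < (power_bound M mu).+1) tau ^+ j *
    \sum_(t <- xG p M (mu, b) | (xj t == j) && (xe t == e)) xc t * Dpt u x (xi t) (xl t) =
  expR (e * tau) * xval (Dpt u x) [seq t <- xG p M (mu, b) | xe t == e] tau.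
Proof.
rewrite /xval big_filter mulr_sumr.
elim: (xG p M (mu, b)) (power_boundP M mu b) => [_|t X IH /= /andP[tb /IH XE]].
  by rewrite big_nil; apply: big1 => j _; rewrite big_nil mulr0.
rewrite big_cons -XE.
transitivity (\sum_(j < (power_bound M mu).+1)
  ((if nat_of_ord j == xj t then (if xe t == e then tau ^+ j * (xc t * Dpt u x (xi t) (xl t)) else 0) else 0) +
   tau ^+ j * \sum_(t <- X | (xj t == j) && (xe t == e)) xc t * Dpt u x (xi t) (xl t))).
  apply: eq_bigr => j _; rewrite big_cons [xj t == j]eq_sym.
  by case: ifP => h; move: h; case: (nat_of_ord j == xj t); case: (xe t == e) => //= _; rewrite ?mulrDr ?add0r.
rewrite big_split /=; rewrite -big_mkcond /= (big_pred1 (Ordinal (tb : (xj t < (power_bound M mu).+1)%N))) /=; last first.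
  by move=> j; rewrite /= -val_eqE.
case: eqP => [te|_]; last by rewrite add0r.
congr (_ + _); rewrite /xcoef te [e * _]mulrC mulNr expRN [e * _]mulrC; field.
by rewrite gt_eqF// expR_gt0.
Qed.

(** The shift by one in [a], [deg] and [c] reflects that the statement counts from 1 and [e] from 0.
    The coefficient at [e k] is defined in the order [lev k]; by stability all of them may be read
    off in the single order M. *)
Lemma exp_poly_sumE mu (e : nat -> R) (lev : nat -> nat) q n M (a : nat -> R) deg
   (c : nat -> nat -> 'I_2 -> 'rV[R]_3 -> R) (tau : R) x r :
  (forall k, e k < e k.+1) -> (forall k, e k < (lev k)%:R * delta p) ->
  (forall k, (k < q)%N = (e k < n%:R * delta p)) ->
  (forall x, hat_exponent mu x -> e 0%N <= x -> exists k, x = e k) ->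
  (forall k, a k.+1 = e k - beta4 p mu) ->
  (forall k, deg k.+1 = power_bound (lev k) mu) ->
  (forall k j r, c k.+1 j r = ldo_eval (poly_ldo (e k) (lev k) mu j r) LF) ->
  (n <= M)%N ->
  exp_poly_sum q a deg c tau x r 0 = expR (beta4 p mu * tau) *
   \sum_(b <- [:: true; false]) jet_weight mu b r *
     xval (Dpt u x) [seq t <- xG p M (mu, b) | (e 0%N <= xe t) && (xe t < n%:R * delta p)] tau.
Proof.
move=> eS elev qn eE aE degE cE nM; rewrite /exp_poly_sum summxE.
rewrite big_add1 /= /index_iota subn0.
transitivity (\sum_(k <- iota 0 q) expR (beta4 p mu * tau) *
   \sum_(b <- [:: true; false]) jet_weight mu b r *
     xval (Dpt u x) [seq t <- xG p M (mu, b) | xe t == e k] tau).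
  apply: eq_big_seq => k; rewrite mem_iota add0n /= => kq.
  have eM : e k < M%:R * delta p.
    rewrite (lt_le_trans (_ : e k < n%:R * delta p)) -?qn//.
    by rewrite ler_wpM2r ?(ltW d0)// ler_nat.
  rewrite mxE /tau_poly summxE degE aE.
  transitivity (expR (- ((e k - beta4 p mu) * tau)) *
     \sum_(b <- [:: true; false]) jet_weight mu b r *
      (expR (e k * tau) * xval (Dpt u x) [seq t <- xG p (lev k) (mu, b) | xe t == e k] tau)).
    congr (_ * _).
    transitivity (\sum_(b <- [:: true; false]) jet_weight mu b r * \sum_(j < (power_bound (lev k) mu).+1) tau ^+ j *
      \sum_(t <- xG p (lev k) (mu, b) | (xj t == j) && (xe t == e k)) xc t * Dpt u x (xi t) (xl t)); last first.
      by apply: eq_bigr => b _; rewrite sum_powers.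
    under [RHS]eq_bigr do rewrite mulr_sumr.
    rewrite exchange_big /=; apply: eq_bigr => j _; rewrite !mxE cE poly_ldoE mulr_sumr.
    by apply: eq_bigr => b _; rewrite mulrCA.
  rewrite !mulr_sumr; apply: eq_bigr => b _; rewrite (xG_stable_eq (mu, b) eM (elev k)).
  rewrite mulrBl opprB addrC expRD [expR (- _)]expRN; field.
  by rewrite gt_eqF// expR_gt0.
rewrite -mulr_sumr exchange_big /=; congr (_ * _); apply: eq_bigr => b _; rewrite -mulr_sumr.
congr (_ * _); apply: xval_by_exponent => // y yM ey; apply: eE => //; by exists M, b.
Qed.

End CollectExponents.

(** * The remainder *)

Section Remainder.
Context {R : realType}.

Lemma is_bigO_le m (v : R -> 'rV[R]_3 -> 'cV[R]_m) (f g : R -> R) :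
  (forall tau, 0 <= tau -> `|f tau| <= `|g tau|) -> is_bigO v f -> is_bigO v g.
Proof.
move=> fg H s; have [C HC] := H s; exists `|C| => tau tau0.
apply: le_trans (HC tau tau0) _; rewrite lee_fin.
by rewrite (le_trans (ler_wpM2r _ (ler_norm C)))// ler_wpM2l// fg.
Qed.

(** Unlike in [rapid_decay_xval] no epsilon is lost: the power of <tau> is a bound for the
    degrees. *)
Lemma xval_fval_bound (I : Type) (f : I -> 'rV[R]_3 -> R) (X : seq (@xterm R I)) a N s :
  (forall i, smooth_torus (f i)) -> all (fun t => (a <= xe t) && (xj t <= N)%N) X ->
  exists2 C, 0 <= C & forall tau sg nu, 0 <= tau ->
    `|xval (fval f sg nu) X tau| <= C * (1 + freq_sqr nu) ^- s * (japanese tau ^+ N * expR (- a * tau)).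
Proof.
move=> sf; elim: X => [|t X IH] /=.
  by exists 0 => // tau sg nu _; rewrite xval_nil normr0 !mul0r.
case/andP => /andP[at_ tN] /IH[C C0 HC].
have [D D0 HD] := fcoef_rapid s (smooth_torus_partials (xl t) (sf (xi t))).
exists (`|xc t| * D + C) => [|tau sg nu tau0]; first by rewrite addr_ge0// mulr_ge0.
rewrite xval_cons (le_trans (ler_normD _ _))// !mulrDl lerD ?HC// normrM /xcoef normrM.
have e0 : 0 <= expR (- xe t * tau) by exact: expR_ge0.
rewrite normrM (ger0_norm e0).
set y := `|tau ^+ _|; set z := `|fval _ _ _ _ _|.
rewrite (_ : _ * _ * z = `|xc t| * (z * (y * expR (- xe t * tau)))); last by ring.
rewrite -!mulrA ler_wpM2l// [D * _]mulrA ler_pM ?mulr_ge0 ?normr_ge0//; first exact: HD.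
rewrite ler_pM ?normr_ge0//; last by rewrite ler_expR ler_wpM2r// lerN2.
have j1 := japanese_ge1 tau.
rewrite /y ger0_norm ?exprn_ge0// (@le_trans _ _ (japanese tau ^+ xj t))//; last exact: ler_weXn2l.
rewrite lerXn2r// ?nnegrE//; first exact: le_trans j1.
by rewrite /japanese -[leLHS]ger0_norm// -sqrtr_sqr ler_wsqrtr// lerDr.
Qed.

Variable p : 'I_3 -> R.
Hypothesis p_kasner : is_kasner p.
Hypothesis p_ordered : forall i j : 'I_3, (i <= j)%N -> p i <= p j.
Hypothesis p_nonflat : p ord_max < 1.
Local Notation K := ('I_4 * bool)%type.

Let p_neq0 := p4_neq0 p_kasner p_ordered p_nonflat.
Let d0 := delta_gt0 p_nonflat.

Variable omega : 'I_4 -> 'rV[R]_4 -> R.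
Hypothesis omega_smooth : smooth_one_form omega.

Lemma comp_jetE mu tau x r : comp_jet omega mu tau x r 0 = expR (beta4 p mu * tau) *
  \sum_(b <- [:: true; false]) jet_weight p mu b r * ycomp p omega (mu, b) tau x.
Proof.
have E s : tau_comp omega mu s x = expR (beta4 p mu * s) * hat_comp p omega mu s x.
  by rewrite /hat_comp -/(beta4 p mu) mulrA -expRD mulNr subrr expR0 mul1r.
have Y : hat_comp p omega mu tau x = ycomp p omega (mu, true) tau x + ycomp p omega (mu, false) tau x.
  by rewrite -up_hat_state (up_ecoord p_neq0).
have Y' : derive1 (fun s => hat_comp p omega mu s x) tau =
   eigval p (mu, true) * ycomp p omega (mu, true) tau x + eigval p (mu, false) * ycomp p omega (mu, false) tau x.
  by rewrite -dn_hat_state (dn_ecoord p_neq0).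
rewrite !big_cons big_nil addr0 mxE /=.
have [->|r0] := eqVneq r 0; first by rewrite /jet_weight eqxx !mul1r /= E Y.
have -> : nat_of_ord r = 1%N by case: r r0 => -[|[|]].
rewrite /jet_weight (negPf r0) /=.
have D1 := is_derive_hat_comp p omega_smooth mu tau x.
have D2 : is_derive tau 1 (fun s : R => expR (beta4 p mu * s)) (expR (beta4 p mu * tau) * beta4 p mu).
  have D0 : is_derive tau 1 (fun s : R => beta4 p mu * s) (beta4 p mu).
    by apply: is_derive_eq; rewrite /GRing.scale/= mulr1.
  exact: (@is_derive1_comp R expR (fun s => beta4 p mu * s)).
rewrite derive1E in Y'; rewrite (is_derive_val D1) in Y'.
have -> : derive1 (fun s => tau_comp omega mu s x) tau =
   expR (beta4 p mu * tau) * beta4 p mu * hat_comp p omega mu tau x + expR (beta4 p mu * tau) *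
     (eigval p (mu, true) * ycomp p omega (mu, true) tau x + eigval p (mu, false) * ycomp p omega (mu, false) tau x).
  rewrite derive1E (_ : (fun s => _) = fun s => expR (beta4 p mu * s) * hat_comp p omega mu s x); last first.
    by apply/funext => s; exact: E.
  rewrite -Y'; apply: is_derive_val.
  by apply: (is_derive_eq (is_deriveM D2 D1)); rewrite /GRing.scale/=; ring.
rewrite Y; ring.
Qed.

Variable u : K -> 'rV[R]_3 -> R.
Hypothesis u_smooth : forall k, smooth_torus (u k).
Hypothesis approx : forall n k, (0 < n)%N -> rapid_decay (n%:R * delta p) (fun tau sg nu =>
  fcoef sg nu (ycomp p omega k tau) - xval (fval u sg nu) (xG p n k) tau).

(** The expansion of order M > n has an error below e^{- n delta tau}, and its terms at exponents >=
    n delta that are left out are explicit. The power of <tau> is thus their degree, the same for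
    all Sobolev indices. Terms below [thr] are subtracted whatever their exponent, since they form
    the leading part. *)
Lemma remainder_bigO mu n M (thr : R) (rem : R -> 'rV[R]_3 -> 'cV[R]_2) : (n < M)%N ->
  (forall tau x r, 0 <= tau -> rem tau x r 0 = expR (beta4 p mu * tau) *
     \sum_(b <- [:: true; false]) jet_weight p mu b r * (ycomp p omega (mu, b) tau x -
        xval (Dpt u x) [seq t <- xG p M (mu, b) | ~~ ((thr <= xe t) && (n%:R * delta p <= xe t))] tau)) ->
  is_bigO rem (fun tau => japanese tau ^+ power_bound p M mu * expR ((beta4 p mu - n%:R * delta p) * tau)).
Proof.
move=> nM remE s; have [Q [A [A0 HA]]] := fcoef_sobolev_norm 2 s.
set N := power_bound p M mu.
pose low b := [seq t <- xG p M (mu, b) | ~~ ((thr <= xe t) && (n%:R * delta p <= xe t))].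
pose high b := [seq t <- xG p M (mu, b) | (thr <= xe t) && (n%:R * delta p <= xe t)].
have lowhigh (b : bool) Phi tau : xval Phi (xG p M (mu, b)) tau = xval Phi (low b) tau + xval Phi (high b) tau.
  rewrite /low /high; elim: (xG p M (mu, b)) => [|t X IH] /=; first by rewrite xval_nil addr0.
  by case: (_ && _); rewrite /= !xval_cons IH; ring.
have M0 : (0 < M)%N by exact: leq_ltn_trans nM.
have b1 (b : bool) : exists2 C, 0 <= C & forall tau sg nu, 0 <= tau ->
    `|fcoef sg nu (ycomp p omega (mu, b) tau) - xval (fval u sg nu) (low b) tau| <=
    C * (1 + freq_sqr nu) ^- Q * (japanese tau ^+ N * expR (- (n%:R * delta p) * tau)).
  (* Here epsilon = delta: the surplus order of M over n is spent on the loss. *)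
  have [C1 C10 H1] := approx (mu, b) M0 Q d0.
  have [|C2 C20 H2] := @xval_fval_bound K u (high b) (n%:R * delta p) N Q u_smooth.
    rewrite /high all_filter; apply: sub_all (power_boundP p M mu b) => t /= ->.
    by apply/implyP => /andP[_ ->].
  exists (C1 + C2) => [|tau sg nu tau0]; first by rewrite addr_ge0.
  have q0 : 0 <= (1 + freq_sqr nu) ^- Q :> R by rewrite invr_ge0 exprn_ge0// ltW// freq_gt0.
  rewrite (_ : _ - _ = (fcoef sg nu (ycomp p omega (mu, b) tau) - xval (fval u sg nu) (xG p M (mu, b)) tau)
      + xval (fval u sg nu) (high b) tau); last by rewrite lowhigh; ring.
  rewrite (le_trans (ler_normD _ _))// !mulrDl lerD ?H2// (le_trans (H1 _ _ _ tau0))//.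
  rewrite ler_wpM2l ?mulr_ge0// (@le_trans _ _ (expR (- (n%:R * delta p) * tau)))//.
    rewrite ler_expR ler_wpM2r// lerN2.
    have : n.+1%:R * delta p <= M%:R * delta p by rewrite ler_wpM2r ?(ltW d0)// ler_nat.
    by rewrite -addn1 natrD mulrDl mul1r; lra.
  by rewrite ler_peMl ?expR_ge0// exprn_ege1// japanese_ge1.
have [Ct Ct0 Ht] := b1 true; have [Cf Cf0 Hf] := b1 false.
pose W r := `|jet_weight p mu true r| * Ct + `|jet_weight p mu false r| * Cf.
have W0 r : 0 <= W r by rewrite addr_ge0// mulr_ge0.
exists (A * \sum_r W r) => tau tau0.
have f0 : 0 <= japanese tau ^+ N * expR ((beta4 p mu - n%:R * delta p) * tau).
  by rewrite mulr_ge0 ?expR_ge0// exprn_ge0// (le_trans _ (japanese_ge1 tau)).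
rewrite (ger0_norm f0) -mulrA; apply: HA => [|r sg nu].
  by rewrite mulr_ge0// sumr_ge0.
have sl (b : bool) : smooth_torus (fun x => ycomp p omega (mu, b) tau x - xval (Dpt u x) (low b) tau).
  by apply: smooth_torusB; [exact: smooth_ycomp|exact: smooth_torus_xval].
have -> : fcoef sg nu (fun x => rem tau x r 0) = expR (beta4 p mu * tau) *
   \sum_(b <- [:: true; false]) jet_weight p mu b r *
     (fcoef sg nu (ycomp p omega (mu, b) tau) - xval (fval u sg nu) (low b) tau).
  transitivity (fcoef sg nu (fun x => \sum_(b <- [:: true; false]) (expR (beta4 p mu * tau) * jet_weight p mu b r) *
     (ycomp p omega (mu, b) tau x - xval (Dpt u x) (low b) tau))).
    apply: eq_fcoef => x; rewrite remE// mulr_sumr; apply: eq_bigr => b _; exact: mulrA.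
  apply: etrans (fcoef_sum sg nu [:: true; false] (fun b => expR (beta4 p mu * tau) * jet_weight p mu b r)
    (F := fun b x => ycomp p omega (mu, b) tau x - xval (Dpt u x) (low b) tau) _) _.
    by move=> b; exact: smooth_torus_continuous.
  rewrite mulr_sumr; apply: eq_bigr => b _; rewrite -mulrA; congr (_ * (_ * _)).
  apply: etrans (fcoefB _ _ _ _) _.
  - by apply: smooth_torus_continuous; exact: smooth_ycomp.
  - by apply: smooth_torus_continuous; exact: smooth_torus_xval.
  by congr (_ - _); exact: fcoef_xval.
rewrite !big_cons big_nil addr0 normrM (ger0_norm (expR_ge0 _)).
set F := japanese tau ^+ N * expR (- (n%:R * delta p) * tau).
have q0 : 0 <= (1 + freq_sqr nu) ^- Q :> R by rewrite invr_ge0 exprn_ge0// ltW// freq_gt0.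
have F0 : 0 <= F by rewrite mulr_ge0 ?expR_ge0// exprn_ge0// (le_trans _ (japanese_ge1 tau)).
apply: (@le_trans _ _ (expR (beta4 p mu * tau) * (W r * (1 + freq_sqr nu) ^- Q * F))).
  rewrite ler_wpM2l ?expR_ge0// (le_trans (ler_normD _ _))// !normrM /W !mulrDl.
  by apply: lerD; rewrite -2!mulrA ler_wpM2l// mulrA; [exact: Ht|exact: Hf].
have -> : (beta4 p mu - n%:R * delta p) * tau = beta4 p mu * tau + - (n%:R * delta p) * tau by ring.
rewrite expRD (_ : expR (beta4 p mu * tau) * (W r * (1 + freq_sqr nu) ^- Q * F) =
  W r * (japanese tau ^+ N * (expR (beta4 p mu * tau) * expR (- (n%:R * delta p) * tau))) * (1 + freq_sqr nu) ^- Q); last first.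
  by rewrite /F; ring.
rewrite ler_wpM2r// ler_wpM2r//.
  by rewrite !mulr_ge0 ?expR_ge0// exprn_ge0// (le_trans _ (japanese_ge1 tau)).
by rewrite (bigD1 r)//= lerDl sumr_ge0.
Qed.

End Remainder.

(** * Expansion of each component with its leading part *)

Section ComponentExpansion.
Context {R : realType}.
Variable p : 'I_3 -> R.
Hypothesis p_kasner : is_kasner p.
Hypothesis p_ordered : forall i j : 'I_3, (i <= j)%N -> p i <= p j.
Hypothesis p_nonflat : p ord_max < 1.
Local Notation K := ('I_4 * bool)%type.
Local Notation w := (window_index p).

Let d0 := delta_gt0 p_nonflat.

(** Since the enumeration starts at [hat_first], no enumerated exponent is below delta; this gives
    q_{mu 1} = 0. *)
Lemma hat_first_ge mu : delta p <= hat_first p mu.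
Proof.
have [k0 k1 k2 k3 k4] := kasner_order p_kasner p_ordered p_nonflat.
elim/ord4P: mu => [|i]; first by rewrite hat_first0; move: d0; lra.
have [->|i0] := eqVneq i ord0.
  rewrite hat_first1 le_min; apply/andP; split; first by move: d0; lra.
  exact: delta_le.
by rewrite hat_first_spatial//; have := delta_le p_ordered i; move: d0; lra.
Qed.

Lemma jet_weight_plus mu r : jet_weight p mu true r = (r == 0)%:R.
Proof.
rewrite /jet_weight; case: eqP => // _; rewrite /eigval /beta4 /=; ring.
Qed.

Lemma jet_weight_minus mu r : jet_weight p mu false r = if r == 0 then 1 else - (2 * p4 p mu).
Proof.
rewrite /jet_weight; case: eqP => // _; rewrite /eigval /beta4 /=; ring.
Qed.

Lemma vec2E (y z : R) r : vec2 y z r 0 = if r == 0 then y else z.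
Proof. by rewrite mxE; case: r => -[|[|]]. Qed.

Variable omega : 'I_4 -> 'rV[R]_4 -> R.
Hypothesis omega_smooth : smooth_one_form omega.
Variable u : K -> 'rV[R]_3 -> R.
Hypothesis u_smooth : forall k, smooth_torus (u k).
Hypothesis approx : forall n k, (0 < n)%N -> rapid_decay (n%:R * delta p) (fun tau sg nu =>
  fcoef sg nu (ycomp p omega k tau) - xval (fval u sg nu) (xG p n k) tau).

Let alpha i := ldo_eval (alpha_ldo p i) u.
Local Notation LF := (leading_family p u alpha).

Definition leading_jet (M : nat) (mu : 'I_4) (tau : R) x r : R :=
  expR (beta4 p mu * tau) * \sum_(b <- [:: true; false]) jet_weight p mu b r *
    xval (Dpt u x) [seq t <- xG p M (mu, b) | xe t < hat_first p mu] tau.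

Lemma component_bigO mu (e : nat -> R) (lev : nat -> nat) q n M N (rate : R) (a : nat -> R) deg
   (c : nat -> nat -> 'I_2 -> 'rV[R]_3 -> R) (lead : R -> 'rV[R]_3 -> 'cV[R]_2) :
  (forall k, e k < e k.+1) -> e 0%N = hat_first p mu ->
  (forall k, e k < (lev k)%:R * delta p) ->
  (forall k, (k < q)%N = (e k < n%:R * delta p)) ->
  (forall x, hat_exponent p mu x -> e 0%N <= x -> exists k, x = e k) ->
  (forall k, a k.+1 = e k - beta4 p mu) ->
  (forall k, deg k.+1 = power_bound p (lev k) mu) ->
  (forall k j r, c k.+1 j r = ldo_eval (poly_ldo p (e k) (lev k) mu j r) LF) ->
  (n < M)%N -> (power_bound p M mu <= N)%N -> rate = beta4 p mu - n%:R * delta p ->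
  (forall tau x r, lead tau x r 0 = leading_jet M mu tau x r) ->
  is_bigO (fun tau x => comp_jet omega mu tau x - (lead tau x + exp_poly_sum q a deg c tau x))
    (fun tau => japanese tau ^+ N * expR (rate * tau)).
Proof.
move=> eS e0 elev qn eE aE degE cE nM MN -> leadE.
apply: (@is_bigO_le _ _ _ (fun tau => japanese tau ^+ power_bound p M mu * expR ((beta4 p mu - n%:R * delta p) * tau))).
  move=> tau tau0; have j1 := japanese_ge1 tau; have j0 := le_trans ler01 j1.
  by rewrite !ger0_norm ?mulr_ge0 ?expR_ge0 ?exprn_ge0// ler_wpM2r ?expR_ge0// ler_weXn2l.
apply: (remainder_bigO (thr := hat_first p mu) p_nonflat omega_smooth u_smooth approx nM) => tau x r tau0.
 rewrite [LHS]mxE [X in _ + X]mxE [X in _ - X]mxE leadE.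
rewrite (exp_poly_sumE p_kasner p_ordered p_nonflat u_smooth tau x r eS elev qn eE aE degE cE (ltnW nM)).
rewrite (comp_jetE p_kasner p_ordered p_nonflat omega_smooth) /leading_jet -mulrDr -mulrBr -big_split -sumrB /=; congr (_ * _).
apply: eq_bigr => b _; rewrite -mulrDr -mulrBr e0; congr (_ * (_ - _)).
(* The terms to subtract split into those below [hat_first], which form the leading jet, and those
   between [hat_first] and n delta, which the sum over k collects. *)
elim: (xG p M (mu, b)) => [|t X IH] /=; first by rewrite xval_nil addr0.
case: (ltP (xe t) (hat_first p mu)) => h1; case: (ltP (xe t) (n%:R * delta p)) => h2 /=;
  rewrite ?xval_cons -IH; ring.
Qed.

Variable M : nat.
Hypothesis M_window : forall k, (w k <= M)%N.
Hypothesis M_gt1 : (1 < M)%N.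

Lemma leading_jet_time tau x r :
  (u (ord0, true) x *: vec2 1 0 : 'cV[R]_2) r 0 = leading_jet M ord0 tau x r.
Proof.
rewrite mxE vec2E /leading_jet !big_cons big_nil !small_time// jet_weight_plus /beta4 p4_0 subrr mul0r expR0.
rewrite /Dpt /=; have [r0|/negPf r0] := eqVneq r 0; rewrite ?r0 ?eqxx /=; ring.
Qed.

Lemma leading_coef_rest i x : leading_coef p u alpha i x + (if i == ord0 then 0 else (2 * p i)^-1 * partial i (u (ord0, true)) x) =
  Dpt u x (lead_index i) [::] +
  \sum_(t <- rest_terms p (lead_index i)) xc t * Dpt u x (xi t) (xl t).
Proof.
rewrite leading_coefE /lead_rest ldo_eval_cat ldo_eval_of -!addrA; congr (_ + _).
rewrite -[RHS]addr0; congr (_ + _).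
by case: (i == ord0); rewrite /ldo_eval ?big_seq1 ?big_nil /=; ring.
Qed.

Lemma leading_jet_first tau x r :
  ((leading_coef p u alpha ord0 x * expR (- (2 * p ord0) * tau)) *: vec2 1 (- (2 * p ord0)) : 'cV[R]_2) r 0 =
  leading_jet M (spatial ord0) tau x r.
Proof.
rewrite mxE vec2E /leading_jet !big_cons big_nil !small_first// mulr0 add0r addr0.
rewrite -leading_coef_rest eqxx addr0 jet_weight_minus /beta4 p4_spatial.
have -> : - (2 * p ord0) * tau = (1 - p ord0) * tau + - (1 + p ord0) * tau by ring.
rewrite expRD; have [r0|/negPf r0] := eqVneq r 0; rewrite ?r0 ?eqxx /=; ring.
Qed.

(** In the first entry the terms (2 p_i)^{-1} d_i u_{0,+} of the two eigencomponents cancel. In the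
    second the weights are 0 and - 2 p_i, so only the - component contributes, and it gives d_i
    u_{0,+}. *)
Lemma leading_jet_spatial i tau x r : i != ord0 ->
  (vec2 (leading_coef p u alpha i x + partial i (u (ord0, true)) x * tau) (partial i (u (ord0, true)) x) : 'cV[R]_2) r 0 =
  leading_jet M (spatial i) tau x r.
Proof.
move=> i0; rewrite vec2E /leading_jet !big_cons big_nil addr0 !small_spatial//.
have [pi0 _] := kasner_pos p_kasner p_ordered p_nonflat i0.
rewrite -leading_coef_rest (negPf i0) jet_weight_plus jet_weight_minus /beta4 p4_spatial mulNr expRN.
rewrite /Dpt /=; have := expR_gt0 ((1 - p i) * tau); set E := expR _ => E0.
by have [r0|/negPf r0] := eqVneq r 0; rewrite ?r0 ?eqxx /=; field; rewrite !gt_eqF.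
Qed.

End ComponentExpansion.

Theorem theorem5p5 (R : realType) (p : 'I_3 -> R)
    (p_kasner : is_kasner p)
    (p_ordered : forall i j : 'I_3, (i <= j)%N -> p i <= p j)
    (p_nonflat : p ord_max < 1) :
  let p1 := p ord0 in
  let p3 := p ord_max in
  exists (q : 'I_4 -> nat -> nat) (a : 'I_4 -> nat -> R)
    (Lalpha : 'I_3 -> @ldo R)
    (deg : 'I_4 -> nat -> nat) (LP : 'I_4 -> nat -> nat -> 'I_2 -> @ldo R),
  [/\ forall mu n, (0 < n)%N -> (q mu n <= q mu n.+1)%N,
      forall mu, q mu 1%N = 0%N,
      forall mu k, (0 < k)%N -> a mu k < a mu k.+1 &
      forall mu k, (0 < k)%N -> mu != spatial ord0 -> 0 < a mu k] /\
  [/\ a (spatial ord0) 1%N = Num.min (2 * p1 + 2 * (1 - p3)) 0,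
      a ord0 1%N = 2 * (1 - p3) &
      forall i : 'I_3, i != ord0 -> a (spatial i) 1%N = 2 * (1 - p3)] /\
  forall (omega : 'I_4 -> 'rV[R]_4 -> R) (u : 'I_4 * bool -> 'rV[R]_3 -> R),
    smooth_one_form omega ->
    box_free p omega ->
    is_asymptotic_data p omega u ->
  exists alpha : 'I_3 -> 'rV[R]_3 -> R,
    (forall i, smooth_value (Lalpha i) u (alpha i)) /\
  let U := leading_coef p u alpha in
  let u0 := u (ord0, true) in
  exists c : 'I_4 -> nat -> nat -> 'I_2 -> 'rV[R]_3 -> R,
    (forall mu k j r, smooth_value (LP mu k j r) (leading_family p u alpha) (c mu k j r)) /\
  forall n : nat, (0 < n)%N -> exists N : nat,
  [/\ is_bigO
        (fun tau x => comp_jet omega ord0 tau x -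
           (u0 x *: vec2 1 0 +
            exp_poly_sum (q ord0 n) (a ord0) (deg ord0) (c ord0) tau x))
        (fun tau => japanese tau ^+ N * expR (- (n%:R * (1 - p3)) * tau)),
      is_bigO
        (fun tau x => comp_jet omega (spatial ord0) tau x -
           ((U ord0 x * expR (- (2 * p1) * tau)) *: vec2 1 (- (2 * p1)) +
            exp_poly_sum (q (spatial ord0) n) (a (spatial ord0)) (deg (spatial ord0))
              (c (spatial ord0)) tau x))
        (fun tau => japanese tau ^+ N * expR ((1 - p1 - n%:R * (1 - p3)) * tau)) &
      forall i : 'I_3, i != ord0 ->
      is_bigO
        (fun tau x => comp_jet omega (spatial i) tau x -
           (vec2 (U i x + partial i u0 x * tau) (partial i u0 x) +
            exp_poly_sum (q (spatial i) n) (a (spatial i)) (deg (spatial i))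
              (c (spatial i)) tau x))
        (fun tau => japanese tau ^+ N * expR ((1 - p i - n%:R * (1 - p3)) * tau))].
Proof.
move=> p1 p3.
have d0 := delta_gt0 p_nonflat.
have /choice[e eP] mu := enum_discrete (hat_first p mu) (hat_exponent_fin p_kasner p_ordered p_nonflat mu).
have e0 mu : e mu 0%N = hat_first p mu by have [] := eP mu.
have eS mu k : e mu k < e mu k.+1 by have [] := eP mu.
have eE mu x : hat_exponent p mu x -> e mu 0%N <= x -> exists k, x = e mu k.
  by have [_ _ h _] := eP mu; rewrite e0; exact: h.
have e_le mu : {mono e mu : j k / (j <= k)%N >-> j <= k} by exact: le_step.
(* [q] counts the enumerated exponents below n delta, a finite number because the enumeration is
   unbounded. *)
have /choice[q qP] mu : exists q : nat -> nat, forall n k, (k < q n)%N = (e mu k < n%:R * delta p).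
  suff /choice[q' H] : forall n, exists q, forall k, (k < q)%N = (e mu k < n%:R * delta p) by exists q'.
  move=> n; have [_ _ _ /(_ (n%:R * delta p)) ex] := eP mu.
  case: (ex_minnP ex) => m nm min_m; exists m => k.
  apply/idP/idP => [km|]; last by move=> /lt_le_trans/(_ nm); rewrite ltNge e_le -ltnNge.
  by rewrite ltNge; apply/negP => /min_m; rewrite leqNgt km.
(* An order from which the coefficient at the k-th exponent no longer changes. *)
pose lev mu k := (Num.truncn (e mu k / delta p)).+1.
have levP mu k : e mu k < (lev mu k)%:R * delta p.
  have ek : 0 <= e mu k / delta p.
    rewrite divr_ge0 ?(ltW d0)// (@le_trans _ _ (e mu 0%N)) ?e_le// e0.
    exact: le_trans (ltW d0) (hat_first_ge p_kasner p_ordered p_nonflat mu).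
  by have /andP[_] := truncn_itv ek; rewrite ltr_pdivrMr.
(* Passing from omega^_mu to omega_mu multiplies by e^{beta tau} and so lowers exponents by beta.
   The value at k = 0 is a dummy. *)
pose a mu k := if k is k'.+1 then e mu k' - beta4 p mu else 0.
have a1 mu : a mu 1%N = first_exponent p mu by rewrite /a e0 /hat_first addrK.
have aS mu k : (0 < k)%N -> a mu k < a mu k.+1 by case: k => // k _; rewrite /a ltrD2r.
pose deg mu k := if k is k'.+1 then power_bound p (lev mu k') mu else 0%N.
pose LP mu k j r := if k is k'.+1 then poly_ldo p (e mu k') (lev mu k') mu j r else [::].
exists q, a, (alpha_ldo p), deg, LP.
split; first split => //.
- move=> mu n n0; rewrite leqNgt qP -leNgt.
  rewrite (@le_trans _ _ (n.+1%:R * delta p))//.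
    by rewrite ler_wpM2r ?(ltW d0)// ler_nat.
  by rewrite leNgt -qP ltnn.
- move=> mu; apply/eqP; rewrite -leqn0 leqNgt qP -leNgt mul1r e0.
  exact: hat_first_ge.
- move=> mu k k0 mu1; apply: (@lt_le_trans _ _ (a mu 1%N)).
    by rewrite a1 /first_exponent (negPf mu1) mulr_gt0.
  by case: k k0 => // k _; rewrite /a lerD2r e_le.
split; first split.
- by rewrite a1 /first_exponent eqxx.
- by rewrite a1 /first_exponent neq0_spatial.
- by move=> i i0; rewrite a1 /first_exponent spatial_eq (negPf i0).
move=> omega u smooth_omega box_omega [u_smooth [calN [V [calNP VP V_u]]]].
have approx n k (n0 : (0 < n)%N) := @formal_approximation _ _ p_kasner p_ordered p_nonflat _
  smooth_omega box_omega _ u_smooth _ _ calNP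
  (fun n nN => let: And3 h _ _ := VP n nN in h) (fun n nN => let: And3 _ h _ := VP n nN in h)
  (fun n nN => let: And3 _ _ h := VP n nN in h) V_u n k n0.
exists (fun i => ldo_eval (alpha_ldo p i) u); split.
  by move=> i; split => //; exact: smooth_ldo_eval.
move=> U u0.
set LF := leading_family _ _ _.
exists (fun mu k j r => ldo_eval (LP mu k j r) LF); split.
  move=> mu k j r; split => //; apply: smooth_ldo_eval => i; exact: smooth_leading_family.
move=> n n0.
(* Beyond n for the remainder, and past every window so that the leading coefficients are
   complete. *)
pose M := maxn n.+1 (\max_k window_index p k).
have nM : (n < M)%N by rewrite leq_max leqnn.
have M1 : (1 < M)%N by exact: leq_ltn_trans nM.
have wM k : (window_index p k <= M)%N by rewrite leq_max (leq_bigmax (F := window_index p)) orbT.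
exists (\max_mu power_bound p M mu).
have NM mu : (power_bound p M mu <= \max_mu power_bound p M mu)%N.
  exact: (leq_bigmax (F := power_bound p M)).
have main mu rate lead := @component_bigO R p p_kasner p_ordered p_nonflat omega smooth_omega u u_smooth approx mu
  (e mu) (lev mu) (q mu n) n M _ rate (a mu) (deg mu)
  (fun k j r => ldo_eval (LP mu k j r) LF) lead (eS mu) (e0 mu) (levP mu) (qP mu n) (eE mu)
  (fun=> erefl) (fun=> erefl) (fun _ _ _ => erefl) nM (NM mu).
split.
- apply: (main ord0 _ (fun tau x => u0 x *: vec2 1 0)).
    by rewrite /beta4 p4_0 subrr sub0r.
  by move=> tau x r; exact: leading_jet_time.
- apply: (main (spatial ord0) _ (fun tau x => (U ord0 x * expR (- (2 * p1) * tau)) *: vec2 1 (- (2 * p1)))).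
    by rewrite /beta4 p4_spatial.
  by move=> tau x r; exact: leading_jet_first.
- move=> i i0; apply: (main (spatial i) _ (fun tau x => vec2 (U i x + partial i u0 x * tau) (partial i u0 x))).
    by rewrite /beta4 p4_spatial.
  by move=> tau x r; exact: leading_jet_spatial.
Qed.
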